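(* Fix $t\in(0,1)$, $\alpha,r>0$ and $p\in(0,1)$, and let $\mathfrak{L}^N=(L_1^N,L_2^N)$, $N\in\mathbb{N}$, be an $(\alpha,p,r+1)$-good sequence of simple discrete line ensembles. For $N\ge N_0(\alpha,p,r+1)$ (the constant in the definition of an $(\alpha,p,r+1)$-good sequence) set $$f_N(s)=N^{-\alpha/2}\left(L_1^N(sN^\alpha)-psN^\alpha\right),\qquad s\in[-r,r],$$ and denote by $\mathbb{P}_N$ the law of $f_N$ as a random variable in $(C[-r,r],\mathcal{C})$. Then the sequence $\mathbb{P}_N$ is tight.
   Context: $(C[-r,r],\mathcal{C})$ is the space of continuous functions on $[-r,r]$ with the uniform topology and its Borel $\sigma$-algebra. For integers $T_0<T_1$, $\llbracket T_0,T_1\rrbracket=\{T_0,T_0+1,\dots,T_1\}$. An up-right path on $\llbracket T_0,T_1\rrbracket$ is a function $\ell:\llbracket T_0,T_1\rrbracket\to\mathbb{Z}$ with $\ell(i+1)-\ell(i)\in\{0,1\}$; it is extended to $[T_0,T_1]$ by linear interpolation. For integers $t_1<t_2$ and $0\le z_2-z_1\le t_2-t_1$, $\Omega(t_1,t_2;z_1,z_2)$ is the set of up-right paths on $\llbracket t_1,t_2\rrbracket$ with $\ell(t_1)=z_1,\ \ell(t_2)=z_2$; $\mathbb{P}_{free}^{t_1,t_2;z_1,z_2}$ is the uniform distribution on it and $\mathbb{E}_{free}^{t_1,t_2;z_1,z_2}$ its expectation. A simple discrete line ensemble on $\llbracket T_0,T_1\rrbracket$ is a random pair $(L_1,L_2)$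 of up-right paths on $\llbracket T_0,T_1\rrbracket$ with $L_1(i)\ge L_2(i)$ for all $i$. Weight: for up-right paths $\ell,\ell_{bot}$ on $\llbracket T_0,T_1\rrbracket$ and $S\subset\llbracket T_0+1,T_1\rrbracket$, with $\Delta=\ell-\ell_{bot}$, $$W_t(T_0,T_1,\ell,\ell_{bot};S)=\prod_{i\in S}\left(1-\mathbf{1}_{\{\Delta(i-1)-\Delta(i)=1\}}t^{\Delta(i-1)}\right)$$ if $\ell(i)\ge\ell_{bot}(i)$ for all $i\in S$, and $0$ otherwise. Hall-Littlewood Gibbs property (simple ensembles): $(L_1,L_2)$ with law $\mathbb{P}$ satisfies it with parameter $t$ for $S\subset\llbracket T_0+1,T_1\rrbracket$ if for all integers $a,b$ and every up-right path $\ell_2$ for which the conditioning event below has positive probability, and all $\ell\in\Omega(T_0,T_1;a,b)$, $$\mathbb{P}(L_1=\ell\mid L_1(T_0)=a,L_1(T_1)=b,L_2=\ell_2)=\frac{W_t(T_0,T_1,\ell,\ell_2;S)}{Z_t(T_0,T_1,a,b,\ell_2;S)},$$ where $Z_t(T_0,T_1,a,b,\ell_2;S)=\mathbb{E}_{free}^{T_0,T_1;a,b}[W_t(T_0,T_1,\ell,\ell_2;S)]$ divided by the appropriate normalization so that the right side is a probability distribution in $\ell$ (equivalently, $W_t/\mathbb{E}_{free}^{T_0,T_1;a,b}[W_t]$ is the density of $L_1$ with respect to $\mathbb{P}_{free}^{T_0,T_1;a,b}$). Good sequence: fix $t\in(0,1)$, $\alpha>0$, $p\in(0,1)$, $T>0$.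 Given $T_N\in\mathbb{N}$, a sequence $\mathfrak{L}^N=(L_1^N,L_2^N)$ of simple discrete line ensembles on $\llbracket-T_N,T_N\rrbracket$ is $(\alpha,p,T)$-good if there exists $N_0(\alpha,p,T)$ such that for $N\ge N_0$: (i) $T_N>TN^\alpha$ and $\mathfrak{L}^N$ satisfies the Hall-Littlewood Gibbs property with parameter $t$ for $S=\llbracket-T_N+1,T_N\rrbracket$; (ii) for each $s\in[-T,T]$ the sequence of random variables $N^{-\alpha/2}(L_1^N(sN^\alpha)-psN^\alpha)$ is tight. *)

(* Defs.v *)
From HB Require Import structures.
From mathcomp Require Import all_boot all_order all_algebra finmap.
From mathcomp Require Import all_classical all_reals all_analysis.
From mathcomp Require Import ring lra.

Set Implicit Arguments.
Unset Strict Implicit.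
Unset Printing Implicit Defensive.

Import Order.TTheory GRing.Theory Num.Theory.
Import numFieldNormedType.Exports.

Local Open Scope classical_set_scope.
Local Open Scope ring_scope.

(* A function on the integer interval [T0, T1] is represented by a function on
   int that vanishes off [T0, T1].  This representation is unique, so that
   Leibniz equality of paths is equality on [T0, T1], and only finitely many
   paths have given endpoints. *)
Definition upright (T0 T1 : int) : set (int -> int) :=
  [set l | (forall i : int, T0 <= i < T1 ->
              l (i + 1) - l i = 0 \/ l (i + 1) - l i = 1) /\
           (forall i : int, ~~ (T0 <= i <= T1) -> l i = 0)].

Definition upright_bridge (t1 t2 z1 z2 : int) : set (int -> int) :=
  [set l | [/\ upright t1 t2 l, l t1 = z1 & l t2 = z2]].

Section free.
Context {R : realType}.

Definition free_prob (t1 t2 z1 z2 : int) (l : int -> int) : R :=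
  \1_(upright_bridge t1 t2 z1 z2) l
    / #|` fset_set (upright_bridge t1 t2 z1 z2)|%:R.

Definition free_expectation (t1 t2 z1 z2 : int)
    (X : (int -> int) -> R) : R :=
  \sum_(l \in upright_bridge t1 t2 z1 z2) X l * free_prob t1 t2 z1 z2 l.

(* The exponent is an integer, but it is at least 1 whenever the indicator
   does not vanish and l (i) >= lbot (i). *)
Definition HL_weight (t : R) (l lbot : int -> int) (S : set int) : R :=
  let D := fun i => l i - lbot i in
  if `[< forall i, S i -> lbot i <= l i >] then
    \big[*%R/1]_(i \in S) (1 - (D (i - 1) - D i == 1)%:R * t ^ D (i - 1))
  else 0.

(* The extension of l to a real variable by linear interpolation. *)
Definition interp (l : int -> int) (x : R) : R :=
  let k := Num.floor x in
  (l k)%:~R + (x - k%:~R) * (l (k + 1) - l k)%:~R.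

Lemma interp_local (l : int -> int) (k : int) (y : R) :
  k%:~R - 1 < y < k%:~R + 1 ->
  interp l y = (l k)%:~R
    + (l (k + 1) - l (k - 1))%:~R / 2 * (y - k%:~R)
    + (l (k + 1) + l (k - 1) - 2 * l k)%:~R / 2 * `|y - k%:~R|.
Proof.
move=> /andP[ky yk]; rewrite /interp.
have [yk0|ky0] := ltP y k%:~R.
  have -> : Num.floor y = k - 1.
    by apply/eqP; rewrite floor_eq // !(intrD, intrN) /= ?subrK yk0 andbT ltW.
  rewrite ltr0_norm ?subr_lt0// subrK !(intrD, intrN, intrM); lra.
have -> : Num.floor y = k.
  by apply/eqP; rewrite floor_eq // ky0 intrD.
rewrite ger0_norm ?subr_ge0// !(intrD, intrN, intrM); lra.
Qed.

Lemma continuous_interp (l : int -> int) : continuous (interp l).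
Proof.
move=> x; pose k := Num.floor x.
pose g (y : R) := (l k)%:~R
    + (l (k + 1) - l (k - 1))%:~R / 2 * (y - k%:~R)
    + (l (k + 1) + l (k - 1) - 2 * l k)%:~R / 2 * `|y - k%:~R|.
have xk : k%:~R - 1 < x < k%:~R + 1.
  have /andP[kx xk1] := floor_itv x.
  by apply/andP; split; move: kx xk1; rewrite -/k intrD /=; lra.
have nx : \forall y \near x, g y = interp l y.
  have : \forall y \near x, y \in `](k%:~R - 1), (k%:~R + 1)[%R.
    by apply: near_in_itvoo; rewrite in_itv.
  by apply: filterS => y; rewrite in_itv /= => /(interp_local l) ->.
rewrite /continuous_at (interp_local l xk) -/(g x).
apply: cvg_trans (near_eq_cvg nx) _.
have cs : (fun y : R => y - k%:~R) @ x --> x - k%:~R.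
  by apply: cvgB; [exact: cvg_id|exact: cvg_cst].
apply: cvgD; first apply: cvgD; first exact: cvg_cst.
  by apply: cvgM => //; exact: cvg_cst.
by apply: cvgM; [exact: cvg_cst|exact: cvg_norm].
Qed.

Definition rescaled (alpha p : R) (N : nat) (l : int -> int) (s : R) : R :=
  N%:R `^ (- (alpha / 2))
    * (interp l (s * N%:R `^ alpha) - p * s * N%:R `^ alpha).

Lemma continuous_rescaled (alpha p : R) (N : nat) (l : int -> int) :
  continuous (rescaled alpha p N l).
Proof.
move=> x; apply: cvgM; first exact: cvg_cst.
have cs c : (fun y : R => y * c) @ x --> x * c.
  by apply: cvgM; [exact: cvg_id|exact: cvg_cst].
apply: cvgB.
  by apply: (continuous_comp (cs _)); exact: continuous_interp.
by apply: cvgM; [apply: cvgM; [exact: cvg_cst|exact: cvg_id]|exact: cvg_cst].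
Qed.

End free.

Definition borel (X : ptopologicalType) := g_sigma_algebraType (@open X).
HB.instance Definition _ (X : ptopologicalType) := Measurable.on (borel X).

Definition tight (R : realType) (X : ptopologicalType) (D : set nat)
    (mu : nat -> probability (borel X) R) :=
  forall eps : R, 0 < eps -> exists K : set X,
    compact K /\ forall N, D N -> ((1 - eps)%:E < mu N K)%E.

Section continuous_functions.
Context {R : realType}.

Definition Cspace (r : R) := continuousType `[- r, r]%classic R.

HB.instance Definition _ (r : R) := Choice.on (Cspace r).
HB.instance Definition _ (r : R) := isPointed.Build (Cspace r)
  (mkcts (@cst_continuous `[- r, r]%classic R 0)).
(* The uniform topology, of which arrow_uniform_type is the library's version
   on the space of all functions. *)
HB.instance Definition _ (r : R) := PseudoMetric.copy (Cspace r)
  (initial_topology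
    (id : Cspace r -> arrow_uniform_type `[- r, r]%classic R)).

Lemma continuous_restriction (r : R) (f : R -> R) : continuous f ->
  continuous (f \o set_val : `[- r, r]%classic -> R).
Proof.
by move=> cf x; apply: continuous_comp; [exact: initial_continuous|exact: cf].
Qed.

Definition rescaledC (r alpha p : R) (N : nat) (l : int -> int) : Cspace r :=
  mkcts (@continuous_restriction r _ (@continuous_rescaled R alpha p N l)).

End continuous_functions.

(* The pairs of paths form a countable set, which carries the discrete
   sigma-algebra: hence the form of the measurability condition. *)
Record simple_ensemble d (Om : measurableType d) (T0 T1 : int) := SimpleEnsemble {
  ens_top : Om -> int -> int ;
  ens_bot : Om -> int -> int ;
  ens_lt : T0 < T1 ;
  ens_top_upright : forall w, upright T0 T1 (ens_top w) ;
  ens_bot_upright : forall w, upright T0 T1 (ens_bot w) ;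
  ens_le : forall w i, T0 <= i <= T1 -> ens_bot w i <= ens_top w i ;
  ens_measurable : forall A : set ((int -> int) * (int -> int)),
    measurable [set w | A (ens_top w, ens_bot w)] }.

Section ensembles.
Context {R : realType} d {Om : measurableType d} {T0 T1 : int}.
Variable L : simple_ensemble Om T0 T1.

Definition cond_prob (P : probability Om R) (A B : set Om) : R :=
  fine (P (A `&` B)) / fine (P B).

Definition HL_Gibbs (P : probability Om R) (t : R) (S : set int) :=
  forall (a b : int) (l2 : int -> int), upright T0 T1 l2 ->
  let E := [set w | [/\ ens_top L w T0 = a, ens_top L w T1 = b
                      & ens_bot L w = l2]] in
  (0 < P E)%E ->
  forall l, upright_bridge T0 T1 a b l ->
    cond_prob P [set w | ens_top L w = l] E =
    HL_weight t l l2 S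
      / free_expectation T0 T1 a b (fun l' => HL_weight t l' l2 S)
      * free_prob T0 T1 a b l.

Lemma ens_top_measurable d' (X : measurableType d') (F : (int -> int) -> X) :
  measurable_fun setT (fun w => F (ens_top L w)).
Proof.
by move=> _ A _; rewrite setTI; exact: (ens_measurable L [set q | A (F q.1)]).
Qed.

Definition rescaled_at (alpha p : R) (N : nat) (s : R) (w : Om) : borel R :=
  rescaled alpha p N (ens_top L w) s.

HB.instance Definition _ alpha p N s := isMeasurableFun.Build _ _ _ _
  (rescaled_at alpha p N s)
  (ens_top_measurable (fun l => rescaled alpha p N l s : borel R)).

Definition rescaled_curve (r alpha p : R) (N : nat) (w : Om) :
    borel (Cspace r) :=
  rescaledC r alpha p N (ens_top L w).

HB.instance Definition _ r alpha p N := isMeasurableFun.Build _ _ _ _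
  (rescaled_curve r alpha p N)
  (ens_top_measurable (fun l => rescaledC r alpha p N l : borel (Cspace r))).

End ensembles.

(* N0 is the constant from which on the conditions hold; N ranges over the
   positive integers. *)
Definition good_from (R : realType) (t alpha p T : R)
    (d : nat -> measure_display) (Om : forall N, measurableType (d N))
    (P : forall N, probability (Om N) R) (TN : nat -> nat)
    (L : forall N, simple_ensemble (Om N) (- (TN N)%:Z) (TN N)%:Z) (N0 : nat) :=
  [/\ (0 < N0)%N,
      forall N, (N0 <= N)%N -> T * N%:R `^ alpha < (TN N)%:R
        /\ HL_Gibbs (L N) (P N) t `[(- (TN N)%:Z + 1), (TN N)%:Z]%classic
    & forall s : R, - T <= s <= T ->
        tight [set N | (N0 <= N)%N]
          (fun N => distribution (P N) (rescaled_at (L N) alpha p N s))].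

(* Main.v *)
(* Let X = N^alpha and sg = sqrt X, so that a window of length of order X has
   fluctuations of order sg.  Given its endpoints and the bottom path, L1 is a
   uniform bridge weighted by a product W of factors in [0, 1].  It is enough to
   show that on the window [- r X, r X] the density W / E[W] is bounded with
   high probability, because the modulus of continuity of a uniform bridge at
   scale (X, sg) is under control.

   The weights are not attractive, but removing j up steps from a path costs at
   most the factor (1 - t) ... (1 - t^j) > 0, which gives stochastic monotonicity
   up to a constant.  With it, L1 (hence L2 below it) is at most of order sg on
   the window: if L1 - p i were much larger than sg somewhere, then with
   probability bounded below it would still be large at r X, against one-point
   tightness there.

   Now resample on the larger window [- (r + 1) X, (r + 1) X], first with the
   weights of the middle part dropped.  With probability bounded below the path
   enters and leaves the middle part at a height H sg far above L2, where the
   factors are at least 1 - t^sg, hence E[W] >= 1 / 4 for the middle part.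
   Putting back the middle weights multiplies densities by E[W], so that
   E[W] < delta has conditional probability O(delta). *)
Require Import Defs.
From mathcomp Require Import all_boot all_order all_algebra.
From mathcomp Require Import all_classical all_reals all_analysis.
From mathcomp Require Import ring lra zify.

Set Implicit Arguments.
Unset Strict Implicit.
Unset Printing Implicit Defensive.

Import Order.TTheory GRing.Theory Num.Theory.
Import numFieldNormedType.Exports.
Local Open Scope classical_set_scope.
Local Open Scope ring_scope.

(** * Uniform bridges *)

Section bridge.
Context {R : realType}.
Implicit Types (m n k : nat) (F : seq bool -> R) (s : seq bool).

(** Estimates are stated between unnormalised weighted sums,
    [bridgeE (F * W) <= C * bridgeE (G * W)], rather than between conditional probabilities.
    Conditioning events of probability zero then matter only in [gibbs_mass], and [resampling]
    carries such an inequality over to the ensemble by summing over what lies outside the window.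
    Bridges are lists of booleans with a recursive expectation, so that a coupling becomes an
    induction on the first step.

    The loss in monotonicity is one-sided. Raising the end of a bridge turns flat steps into up
    steps and loses nothing. Raising its start by j with the same end turns up steps into flat ones;
    but while i of them remain to be removed the new path is i above the old one, hence at least i
    above the bottom path, and a flat step there weighs at least 1 - t^i. The product over all i
    converges, so one constant [qconst] serves every scale.

    Domination goes upwards only: up to a constant, a weighted bridge is at least as high as a
    uniform one. Upper bounds are therefore indirect: a path that is high somewhere is pushed to a
    test point where tightness makes this unlikely. *)

Fixpoint sumseq n F : R :=
  if n is n'.+1 then
    sumseq n' (fun s => F (true :: s)) + sumseq n' (fun s => F (false :: s))
  else F [::].

Definition ups s := count id s.
#[global] Arguments ups : simpl never.

(* The expectation of a function of the first m steps of a uniform bridge with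
   n steps, k of which are up: sampling without replacement. *)
Fixpoint bridgeE m n k F : R :=
  if m is m'.+1 then
    k%:R / n%:R * bridgeE m' n.-1 k.-1 (fun s => F (true :: s)) +
    (1 - k%:R / n%:R) * bridgeE m' n.-1 k (fun s => F (false :: s))
  else F [::].

Lemma ups_cons b s : ups (b :: s) = (b + ups s)%N.
Proof. by []. Qed.

Lemma ups_cat s1 s2 : ups (s1 ++ s2) = (ups s1 + ups s2)%N.
Proof. exact: count_cat. Qed.

Lemma ups_size s : (ups s <= size s)%N.
Proof. exact: count_size. Qed.

Lemma eq_sumseq n F F' : (forall s, size s = n -> F s = F' s) ->
  sumseq n F = sumseq n F'.
Proof.
elim: n F F' => [|n IH] F F' e /=; first exact: e.
by congr (_ + _); apply: IH => s sn; apply: e; rewrite /= sn.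
Qed.

Lemma sumseqD n F F' : sumseq n (fun s => F s + F' s) = sumseq n F + sumseq n F'.
Proof. by elim: n F F' => [|n IH] F F' //=; rewrite !IH; ring. Qed.

Lemma sumseqZ n c F : sumseq n (fun s => c * F s) = c * sumseq n F.
Proof. by elim: n F => [|n IH] F //=; rewrite !IH; ring. Qed.

Lemma sumseq0 n : sumseq n (fun=> 0) = 0.
Proof. by elim: n => [|n IH] //=; rewrite IH addr0. Qed.

Lemma le_sumseq n F F' : (forall s, size s = n -> F s <= F' s) ->
  sumseq n F <= sumseq n F'.
Proof.
elim: n F F' => [|n IH] F F' e /=; first exact: e.
by apply: lerD; apply: IH => s sn; apply: e; rewrite /= sn.
Qed.

Lemma sumseq_cat m n F :
  sumseq (m + n) F = sumseq m (fun s1 => sumseq n (fun s2 => F (s1 ++ s2))).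
Proof. by elim: m F => [|m IH] F //=; rewrite !IH. Qed.

Lemma exchange_sumseq m n (F : seq bool -> seq bool -> R) :
  sumseq m (fun s1 => sumseq n (F s1)) =
  sumseq n (fun s2 => sumseq m (fun s1 => F s1 s2)).
Proof.
elim: m F => [|m IH] F //=; rewrite !IH -sumseqD; exact: eq_sumseq.
Qed.

Lemma sumseq_rot m n F :
  sumseq (m + n) F = sumseq (m + n) (fun s => F (rot n s)).
Proof.
rewrite [in RHS]addnC !sumseq_cat exchange_sumseq.
apply: eq_sumseq => s2 s2n; apply: eq_sumseq => s1 s1m.
by rewrite -s2n rot_size_cat.
Qed.

Lemma sumseq_ups n k : sumseq n (fun s => (ups s == k)%:R) = 'C(n, k)%:R.
Proof.
elim: n k => [|n IH] k /=; first by case: k => [|k]; rewrite /ups /= ?bin0.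
case: k => [|k].
  rewrite (@eq_sumseq _ _ (fun=> 0)) // sumseq0 add0r.
  by rewrite (IH 0%N) !bin0.
rewrite binS natrD addrC; congr (_ + _); first exact: IH.
by rewrite -IH; apply: eq_sumseq => s _; rewrite ups_cons add1n eqSS.
Qed.

Lemma eq_bridgeE m n k F F' : (forall s, size s = m -> F s = F' s) ->
  bridgeE m n k F = bridgeE m n k F'.
Proof.
elim: m n k F F' => [|m IH] n k F F' e /=; first exact: e.
by congr (_ * _ + _ * _); apply: IH => s sn; apply: e; rewrite /= sn.
Qed.

Lemma bridgeED m n k F F' :
  bridgeE m n k (fun s => F s + F' s) = bridgeE m n k F + bridgeE m n k F'.
Proof. by elim: m n k F F' => [|m IH] n k F F' //=; rewrite !IH; ring. Qed.

Lemma bridgeEZ m n k c F : bridgeE m n k (fun s => c * F s) = c * bridgeE m n k F.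
Proof. by elim: m n k F => [|m IH] n k F //=; rewrite !IH; ring. Qed.

Lemma bridgeE_cst m n k c : bridgeE m n k (fun=> c) = c.
Proof. by elim: m n k => [|m IH] n k //=; rewrite !IH; ring. Qed.

Lemma bridgeE_cat m1 m2 n k F : bridgeE (m1 + m2) n k F =
  bridgeE m1 n k (fun s1 =>
    bridgeE m2 (n - m1) (k - ups s1) (fun s2 => F (s1 ++ s2))).
Proof.
elim: m1 n k F => [|m1 IH] n k F /=; first by rewrite !subn0.
by rewrite !IH; congr (_ * _ + _ * _); apply: eq_bridgeE => s _;
  rewrite -subn1 -subnDA ?ups_cons // -subn1 -subnDA.
Qed.

Lemma bridgeE_take m n k F : (m <= n)%N ->
  bridgeE n n k (fun s => F (take m s)) = bridgeE m n k F.
Proof.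
move=> mn; rewrite -[X in bridgeE X](subnKC mn) bridgeE_cat.
apply: eq_bridgeE => s sm; rewrite (@eq_bridgeE _ _ _ _ (fun=> F s)).
  exact: bridgeE_cst.
by move=> s2 _; rewrite -sm take_size_cat.
Qed.

(** The prefixes of positive probability, that is, those that extend to a full bridge. Comparison of
    integrands is required only on them, since heights and remaining up steps make sense only
    there. *)
Definition prefix_ok m n k s := [/\ size s = m, (ups s <= k)%N & (k - ups s <= n - m)%N].

Lemma ratio01 n k : (k <= n)%N -> 0 <= k%:R / n%:R :> R /\ k%:R / n%:R <= 1 :> R.
Proof.
move=> kn; split; first by rewrite divr_ge0 ?ler0n.
case: n kn => [|n] kn.
  by rewrite invr0 mulr0.
by rewrite ler_pdivrMr ?ltr0n // mul1r ler_nat.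
Qed.

Lemma le_bridgeE m n k F F' : (m <= n)%N -> (k <= n)%N ->
  (forall s, prefix_ok m n k s -> F s <= F' s) ->
  bridgeE m n k F <= bridgeE m n k F'.
Proof.
elim: m n k F F' => [|m IH] n k F F' mn kn e /=.
  by apply: e; split; rewrite ?subn0.
case: n mn kn e => [//|n] mn kn e /=.
have [r0 r1] := ratio01 kn.
apply: lerD.
  case: k kn e r0 r1 => [|k] kn e r0 r1; first by rewrite !mul0r.
  apply: ler_wpM2l => //; apply: IH => // s [sm sk sn].
  by apply: e; split; rewrite /= ?sm // ups_cons add1n ?subSS.
have [kn1|kn1] := leqP k n; last first.
  have -> : k = n.+1 by apply/eqP; rewrite eqn_leq kn.
  by rewrite divff ?pnatr_eq0 // subrr !mul0r.
apply: ler_wpM2l; first by rewrite subr_ge0.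
by apply: IH => // s [sm sk sn]; apply: e; split; rewrite /= ?sm // ?subSS.
Qed.

Lemma bridgeE_ge0 m n k F : (m <= n)%N -> (k <= n)%N ->
  (forall s, prefix_ok m n k s -> 0 <= F s) -> 0 <= bridgeE m n k F.
Proof. by move=> mn kn h; rewrite -[leLHS](bridgeE_cst m n k 0) le_bridgeE. Qed.

(** A prefix s has 'C(n - m, k - ups s) completions to a bridge. Multiplying by 'C(n, k) instead of
    dividing keeps the identity true for k > n, where both sides vanish. *)
Lemma bridgeE_bin m n k F : (m <= n)%N ->
  'C(n, k)%:R * bridgeE m n k F =
  sumseq m (fun s => (ups s <= k)%N%:R * 'C(n - m, k - ups s)%:R * F s).
Proof.
elim: m n k F => [|m IH] n k F mn.
  by rewrite /= /ups /= !subn0 mul1r.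
have [kn|nk] := leqP k n; last first.
  rewrite bin_small // mul0r (@eq_sumseq _ _ (fun=> 0)) ?sumseq0 // => s sm.
  rewrite [X in _ * X%:R](_ : _ = 0%N) ?mulr0 ?mul0r // bin_small //.
  have := ups_size s; lia.
case: n mn kn => [//|n] mn kn; rewrite [bridgeE _ _ _ _]/= [sumseq _ _]/= mulrDr.
have n0 : n.+1%:R != 0 :> R by rewrite pnatr_eq0.
congr (_ + _).
  case: k kn => [|k] kn.
    by rewrite !mul0r mulr0 (@eq_sumseq _ _ (fun=> 0)) ?sumseq0 // => s _;
      rewrite !mul0r.
  rewrite (_ : _ * _ = 'C(n, k)%:R * bridgeE m n k (fun s => F (true :: s))).
    by rewrite IH //; apply: eq_sumseq.
  rewrite mulrA; congr (_ * _); apply: (mulfI n0).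
  by rewrite [RHS]mulrC -natrM mulnC mul_bin_diag natrM; field; rewrite addrC natr1.
rewrite (_ : _ * _ = 'C(n, k)%:R * bridgeE m n k (fun s => F (false :: s))).
  by rewrite IH //; apply: eq_sumseq.
rewrite mulrA; congr (_ * _); apply: (mulfI n0).
by rewrite -natrM mul_bin_down natrM natrB //; field; rewrite addrC natr1.
Qed.

Lemma bin_neq0 n k : (k <= n)%N -> 'C(n, k)%:R != 0 :> R.
Proof. by move=> kn; rewrite pnatr_eq0 -lt0n bin_gt0. Qed.

Lemma bridgeE_full n k F : (k <= n)%N ->
  'C(n, k)%:R * bridgeE n n k F = sumseq n (fun s => (ups s == k)%:R * F s).
Proof.
move=> kn; rewrite bridgeE_bin //; apply: eq_sumseq => s _; congr (_ * _).
rewrite subnn bin0n -natrM mulnb; congr (_%:R); lia.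
Qed.

(** A rotation preserves the number of up steps, hence the uniform law. Increments after an
    arbitrary time can thus be treated as if that time were 0, as [bridge_max] does. *)
Lemma bridgeE_rot m n k F : (m <= n)%N -> (k <= n)%N ->
  bridgeE n n k F = bridgeE n n k (fun s => F (rot m s)).
Proof.
move=> mn kn; apply: (mulfI (bin_neq0 kn)); rewrite !bridgeE_full //.
rewrite -[X in sumseq X](subnK mn) sumseq_rot; apply: eq_sumseq => s _.
by rewrite {1}/ups /rot count_cat addnC -count_cat cat_take_drop.
Qed.

(** The weight of a prefix in [bridgeE_bin] depends on s only through [ups s]; so, given the number
    of its up steps, a prefix is again a uniform bridge. *)
Lemma bridgeE_cond m n k F : (m <= n)%N -> (k <= n)%N ->
  bridgeE m n k F = bridgeE m n k (fun s => bridgeE m m (ups s) F).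
Proof.
move=> mn kn; apply: (mulfI (bin_neq0 kn)); rewrite !bridgeE_bin //.
pose w j : R := (j <= k)%N%:R * 'C(n - m, k - j)%:R.
transitivity (sumseq m (fun s => sumseq m (fun s' =>
    w (ups s) * ('C(m, ups s)%:R^-1 * ((ups s' == ups s)%:R * F s'))))).
  rewrite exchange_sumseq; apply: eq_sumseq => s' sm.
  rewrite (@eq_sumseq _ _ (fun s => (w (ups s') * 'C(m, ups s')%:R^-1 * F s')
    * (ups s == ups s')%:R)).
    by rewrite sumseqZ sumseq_ups [RHS]mulrAC divfK // bin_neq0 // -sm ups_size.
  move=> s _; rewrite eq_sym; case: eqP => [->|_].
    by rewrite mul1r !mulr1 mulrA.
  by rewrite mul0r !mulr0.
apply: eq_sumseq => s sm; rewrite !sumseqZ; congr (_ * _).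
have um : (ups s <= m)%N by rewrite -sm ups_size.
by rewrite -bridgeE_full // mulKf // bin_neq0.
Qed.

End bridge.

Section bridge_expectation.
Context {R : realType}.
Implicit Types (m n k : nat) (F : seq bool -> R) (s : seq bool).

Lemma eq_bridgeE_ok m n k F F' : (m <= n)%N -> (k <= n)%N ->
  (forall s, prefix_ok m n k s -> F s = F' s) ->
  bridgeE m n k F = bridgeE m n k F'.
Proof.
by move=> mn kn e; apply/eqP; rewrite eq_le !le_bridgeE // => s /e ->.
Qed.

Lemma prefix_ok_full n k s : prefix_ok n n k s -> size s = n /\ ups s = k.
Proof. by case=> sn uk; rewrite subnn leqn0 subn_eq0 => ku; split=> //; lia. Qed.

Lemma bridgeES m n k F : bridgeE m.+1 n k F =
  k%:R / n%:R * bridgeE m n.-1 k.-1 (fun s => F (true :: s)) +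
  (1 - k%:R / n%:R) * bridgeE m n.-1 k (fun s => F (false :: s)).
Proof. by []. Qed.

Lemma prefix_ok0 n k : (k <= n)%N -> prefix_ok 0 n k [::].
Proof. by move=> kn; split; rewrite /ups //= !subn0. Qed.

Lemma bridgeE_ups n k F (h : nat -> R) : (k <= n)%N ->
  bridgeE n n k (fun s => h (ups s) * F s) = h k * bridgeE n n k F.
Proof.
move=> kn; rewrite -bridgeEZ; apply: eq_bridgeE_ok => // s.
by move=> /prefix_ok_full[_ ->].
Qed.

Lemma bridgeE_restr m n k F (h : nat -> R) : (m <= n)%N -> (k <= n)%N ->
  bridgeE m n k (fun s => h (ups s) * F s) =
  bridgeE m n k (fun s => h (ups s) * bridgeE m m (ups s) F).
Proof.
move=> mn kn; rewrite bridgeE_cond //; apply: eq_bridgeE => s sm.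
by rewrite bridgeE_ups // -sm ups_size.
Qed.

(* Splitting a double expectation according to [B] replaces the supremum of g
   over the complement of [B] that the naive argument would need. *)
Lemma bridgeE_quasi_mono m n k c (g : nat -> R) (B : nat -> bool) :
  (m <= n)%N -> (k <= n)%N -> 0 <= c <= 1 ->
  (forall j j', B j -> (j <= j')%N -> B j') ->
  (forall s, prefix_ok m n k s -> 0 <= g (ups s)) ->
  (forall s s', prefix_ok m n k s -> prefix_ok m n k s' ->
     (ups s <= ups s')%N -> c * g (ups s) <= g (ups s')) ->
  c * bridgeE m n k (fun s => (B (ups s))%:R) * bridgeE m n k (fun s => g (ups s))
  <= bridgeE m n k (fun s => (B (ups s))%:R * g (ups s)).
Proof.
move=> mn kn /andP[c0 c1] Bup g0 gm.
set a := bridgeE m n k (fun s => _ * _).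
set P := bridgeE m n k (fun s => (B (ups s))%:R).
pose Q := bridgeE m n k (fun s => (~~ B (ups s))%:R) : R.
pose b := bridgeE m n k (fun s => (~~ B (ups s))%:R * g (ups s)).
have PQ : P + Q = 1.
  rewrite -bridgeED -[RHS](bridgeE_cst m n k); apply: eq_bridgeE => s _.
  by case: (B _); rewrite ?addr0 ?add0r.
have ab : bridgeE m n k (fun s => g (ups s)) = a + b.
  rewrite -bridgeED; apply: eq_bridgeE => s _.
  by case: (B _); rewrite !(mul0r, mul1r, addr0, add0r).
have P0 : 0 <= P by apply: bridgeE_ge0.
have Q0 : 0 <= Q by apply: bridgeE_ge0.
have a0 : 0 <= a.
  by apply: bridgeE_ge0 => // s os; rewrite mulr_ge0 ?ler0n ?g0.
(* Take two independent prefixes s in B and s' outside B. As B is upward closed, [ups s' <= ups s],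
   and [gm] applies pointwise. *)
have aQ : c * P * b <= a * Q.
  rewrite [c * P]mulrC -mulrA mulrC [a * Q]mulrC -!bridgeEZ.
  apply: le_bridgeE => // s os.
  have [Bs|Bs] := boolP (B (ups s)); last by rewrite !(mulr0, mul0r).
  rewrite mulr1 mul1r mulrC -!bridgeEZ; apply: le_bridgeE => // s' os'.
  have [Bs'|Bs'] := boolP (B (ups s')); first by rewrite /= !(mulr0,mul0r).
  rewrite /= mul1r mulr1; apply: gm => //.
  rewrite leqNgt; apply/negP => lt; move/negP: Bs'; apply.
  by apply: (Bup _ _ Bs); apply: ltnW.
have Qe : Q = 1 - P by rewrite -PQ; ring.
rewrite ab mulrDr; apply: (@le_trans _ _ (c * P * a + a * Q)).
  by rewrite lerD2l.
have : c * P * a <= P * a by rewrite -mulrA ler_piMl // mulr_ge0.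
rewrite Qe; lra.
Qed.

Lemma iota_hit (A : seq bool -> bool) b s m :
  has (fun j => A (take j (b :: s))) (iota 0 m.+2) =
  A [::] || has (fun j => A (b :: take j s)) (iota 0 m.+1).
Proof. by rewrite /= -[1%N]/(1 + 0)%N -[X in iota X]/(1 + 1)%N !iotaDl !has_map. Qed.

End bridge_expectation.

(** * Weighted bridges *)

Section weights.
Context {R : realType}.
Variable t : R.
Hypothesis t01 : 0 < t < 1.

(* w i x b is the weight of the step b taken at time i from height x. *)
Record weights (w : nat -> int -> bool -> R) : Prop := Weights {
  weights_ge0 : forall i x b, 0 <= w i x b ;
  weights_le1 : forall i x b, w i x b <= 1 ;
  weights_mono : forall i x y b, x <= y -> w i x b <= w i y b ;
  weights_up : forall i x, w i x false <= w i x true ;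
  weights_merge : forall i x (j : nat),
    (1 - t ^+ j) * w i x true <= w i (x + j%:Z) false }.

Implicit Types (w : nat -> int -> bool -> R) (n k i m : nat) (x : int).

Fixpoint pathW w i x (s : seq bool) : R :=
  if s is b :: s' then w i x b * pathW w i.+1 (x + (b : nat)%:Z) s' else 1.

Definition bridgeZ w n i x k := bridgeE n n k (pathW w i x).

Lemma pathW_cat w i x s1 s2 : pathW w i x (s1 ++ s2) =
  pathW w i x s1 * pathW w (i + size s1) (x + (ups s1)%:Z) s2.
Proof.
elim: s1 i x => [|b s1 IH] i x /=; first by rewrite mul1r addn0 addr0.
by rewrite IH mulrA addSnnS ups_cons PoszD addrA.
Qed.

Lemma pathW_ge0 w i x s : weights w -> 0 <= pathW w i x s.
Proof.
move=> hw; elim: s i x => [|b s IH] i x //=.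
by rewrite mulr_ge0 // (weights_ge0 hw).
Qed.

Lemma pathW_le1 w i x s : weights w -> pathW w i x s <= 1.
Proof.
move=> hw; elim: s i x => [|b s IH] i x //=.
by rewrite mulr_ile1 // ?pathW_ge0 // ?(weights_ge0 hw) ?(weights_le1 hw).
Qed.

Lemma pathW_mono w i x y s : weights w -> x <= y -> pathW w i x s <= pathW w i y s.
Proof.
move=> hw; elim: s i x y => [|b s IH] i x y xy //=.
apply: ler_pM; rewrite ?pathW_ge0 ?(weights_ge0 hw) ?(weights_mono hw) //.
by apply: IH; rewrite lerD2r.
Qed.

Lemma bridgeZ_ge0 w n i x k : weights w -> (k <= n)%N -> 0 <= bridgeZ w n i x k.
Proof. by move=> hw kn; apply: bridgeE_ge0 => // s _; apply: pathW_ge0. Qed.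

Lemma bridgeZ_rec w n i x k : bridgeZ w n.+1 i x k =
  k%:R / n.+1%:R * (w i x true * bridgeZ w n i.+1 (x + 1) k.-1) +
  (1 - k%:R / n.+1%:R) * (w i x false * bridgeZ w n i.+1 x k).
Proof. by rewrite /bridgeZ /= !bridgeEZ addr0. Qed.

(** The q-Pochhammer symbol (t; t)_n. *)
Definition qpoch n : R := \prod_(i < n) (1 - t ^+ i.+1).

Lemma qpochS n : qpoch n.+1 = qpoch n * (1 - t ^+ n.+1).
Proof. exact: big_ord_recr. Qed.

Lemma onem_tX n : 0 <= 1 - t ^+ n <= 1.
Proof.
case/andP: t01 => t0 t1.
by rewrite subr_ge0 lerBlDr lerDl exprn_ge0 ?exprn_ile1 ?ltW.
Qed.

Lemma qpoch_ge0 n : 0 <= qpoch n.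
Proof. by apply: prodr_ge0 => i _; have /andP[] := onem_tX i.+1. Qed.

Lemma qpoch_le1 n : qpoch n <= 1.
Proof. by apply: prodr_ile1 => i _; apply: onem_tX. Qed.

(* Removing j of the up steps at random turns a uniform bridge from x into a
   uniform bridge from x + j with the same endpoint.  The new path is above the
   old one, and the only weights that can decrease are those of the removed
   steps, by at most the factors 1 - t, ..., 1 - t ^+ j.  The induction is this
   coupling, revealed step by step. *)
Lemma bridgeZ_mono_start w n i x k j : weights w -> (j <= k)%N -> (k <= n)%N ->
  qpoch j * bridgeZ w n i x k <= bridgeZ w n i (x + j%:Z) (k - j).
Proof.
move=> hw; elim: n i x k j => [|n IH] i x k j jk kn.
  by rewrite /bridgeZ /= mulr1 qpoch_le1.
have k1n : (k.-1 <= n)%N by lia.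
have jk1 : (j < k -> j <= k.-1)%N by lia.
have pk : ((k - j).-1 = k.-1 - j)%N by lia.
have jE : (j < k)%N || (j == k) by rewrite orbC -leq_eqVlt.
have kE : (k <= n)%N || (k == n.+1) by rewrite orbC -leq_eqVlt.
have jp : (0 < j -> k - j = k.-1 - j.-1)%N by lia.
have xj : (0 < j)%N -> x + j%:Z = x + 1 + j.-1%:Z by lia.
have xj1 : x + j%:Z + 1 = x + 1 + j%:Z by lia.
have jk2 : (0 < j -> j.-1 <= k.-1)%N by lia.
rewrite !bridgeZ_rec.
have [a0 a1] := @ratio01 R _ _ kn.
have [b0 b1] := @ratio01 R _ _ (leq_trans (leq_subr j k) kn).
have [d0 _] := @ratio01 R _ _ (leq_trans jk kn).
have e : (k - j)%:R / n.+1%:R = k%:R / n.+1%:R - j%:R / n.+1%:R :> R.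
  by rewrite natrB // mulrBl.
rewrite e in b0 b1 *.
set al := k%:R / _ in a0 a1 b0 b1 e *; set dl := j%:R / _ in d0 b0 b1 e *.
set u := w i x true; set f := w i x false.
set u' := w i _ true; set f' := w i _ false.
set A := bridgeZ w n _ (x + 1) _; set B := bridgeZ w n _ x _.
set A' := bridgeZ w n _ _ (k - j).-1; set B' := bridgeZ w n _ _ (k - j).
have u0 : 0 <= u := weights_ge0 hw _ _ _.
have f0 : 0 <= f := weights_ge0 hw _ _ _.
have A0 : 0 <= A by apply: bridgeZ_ge0.
have uu' : u <= u' by apply: (weights_mono hw); rewrite lerDl.
have ff' : f <= f' by apply: (weights_mono hw); rewrite lerDl.
have q0 := qpoch_ge0 j.
(* The first step of the coupling is a kept up step with probability [al - dl], a flat step with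
   probability [1 - al], a removed up step with probability [dl]. The removal, in T3, decreases j by
   one and spends the last factor 1 - t^j of [qpoch j]. *)
have T1 : (al - dl) * (qpoch j * (u * A)) <= (al - dl) * (u' * A').
  case/orP: jE => [jk'|/eqP jk']; last by rewrite /al /dl jk' subrr !mul0r.
  apply: ler_wpM2l => //; rewrite mulrCA; apply: ler_pM => //.
    by rewrite mulr_ge0.
  by rewrite /A /A' pk xj1; apply: IH; rewrite ?jk1.
have T2 : (1 - al) * (qpoch j * (f * B)) <= (1 - al) * (f' * B').
  case/orP: kE => [kn'|/eqP nk]; last first.
    by rewrite /al nk divff ?pnatr_eq0 // subrr !mul0r.
  apply: ler_wpM2l; rewrite ?subr_ge0 // mulrCA; apply: ler_pM => //.
    by rewrite mulr_ge0 // bridgeZ_ge0.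
  exact: IH.
have T3 : dl * (qpoch j * (u * A)) <= dl * (f' * B').
  case: (posnP j) => [j0|j0]; first by rewrite /dl j0 !mul0r.
  apply: ler_wpM2l => //.
  have -> : qpoch j = qpoch j.-1 * (1 - t ^+ j) by have := qpochS j.-1; rewrite prednK.
  rewrite (_ : _ * (u * A) = (1 - t ^+ j) * u * (qpoch j.-1 * A)); last ring.
  apply: ler_pM.
  - by rewrite mulr_ge0 //; have /andP[] := onem_tX j.
  - by rewrite mulr_ge0 // qpoch_ge0.
  - exact: (weights_merge hw).
  by rewrite /A /B' jp // xj //; apply: IH; rewrite ?jk2.
lra.
Qed.

(** Turning a random flat step into an up step raises the rest of the path and does not lower any
    weight, so no constant is lost. T2 is the case where the first step is the one that is
    turned. *)
Lemma bridgeZ_mono_end1 w n i x k : weights w -> (k < n)%N ->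
  bridgeZ w n i x k <= bridgeZ w n i x k.+1.
Proof.
move=> hw; elim: n i x k => [//|n IH] i x k kn.
rewrite !bridgeZ_rec -[k.+1.-1]/k.
have [a0 a1] := @ratio01 R _ _ (ltnW kn).
have [b0 b1] := @ratio01 R _ _ kn.
rewrite -natr1 mulrDl in b0 b1 *.
have d0 : 0 <= 1 / n.+1%:R :> R by rewrite divr_ge0 ?ler0n.
set al := k%:R / _ in a0 a1 b0 b1 *; set dl := 1 / _ in d0 b0 b1 *.
have u0 : 0 <= w i x true := weights_ge0 hw _ _ _.
have f0 : 0 <= w i x false := weights_ge0 hw _ _ _.
have T1 : al * (w i x true * bridgeZ w n i.+1 (x + 1) k.-1) <=
    al * (w i x true * bridgeZ w n i.+1 (x + 1) k).
  case: (posnP k) => [k0|k0]; first by rewrite /al k0 !mul0r.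
  apply: ler_wpM2l => //; apply: ler_wpM2l => //.
  by rewrite -[X in _ <= bridgeZ _ _ _ _ X](prednK k0); apply: IH; rewrite prednK.
have T2 : dl * (w i x false * bridgeZ w n i.+1 x k) <=
    dl * (w i x true * bridgeZ w n i.+1 (x + 1) k).
  apply: ler_wpM2l => //; apply: ler_pM => //; first exact: bridgeZ_ge0.
    exact: (weights_up hw).
  by apply: le_bridgeE => // s _; apply: pathW_mono => //; rewrite lerDl.
have T3 : (1 - (al + dl)) * (w i x false * bridgeZ w n i.+1 x k) <=
    (1 - (al + dl)) * (w i x false * bridgeZ w n i.+1 x k.+1).
  have [kn'|nk] := ltnP k n; last first.
    have -> : 1 - (al + dl) = 0; last by rewrite !mul0r.
    have kn1 : k.+1 = n.+1 by apply/eqP; rewrite eqn_leq kn.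
    by rewrite /al /dl -mulrDl natr1 kn1 divff ?subrr ?pnatr_eq0.
  by apply: ler_wpM2l; rewrite ?subr_ge0 //; apply: ler_wpM2l => //; apply: IH.
lra.
Qed.

Lemma bridgeZ_mono_end w n i x k k' : weights w -> (k <= k')%N -> (k' <= n)%N ->
  bridgeZ w n i x k <= bridgeZ w n i x k'.
Proof.
move=> hw kk'; rewrite -(subnKC kk'); elim: (k' - k)%N => [|d IH] kn.
  by rewrite addn0.
rewrite addnS in kn *; apply: le_trans (IH _) (bridgeZ_mono_end1 _ _ hw kn).
exact: ltnW.
Qed.

(** An explicit lower bound for the infinite product (t; t)_oo. It comes from 1 - t^(n+1) >= exp(-
    t^n / (1 - t)), whose exponents sum up to (1 - t)^-2. *)
Definition qconst : R := expR (- (1 - t)^-2).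

Lemma qconst_gt0 : 0 < qconst. Proof. exact: expR_gt0. Qed.

Lemma qconst_le n : qconst <= qpoch n.
Proof.
case/andP: t01 => t0 t1.
have u0 : 0 < 1 - t by rewrite subr_gt0.
suff : expR (- ((1 - t)^-2 * (1 - t ^+ n))) <= qpoch n.
  apply: le_trans; rewrite ler_expR lerN2 ler_piMr ?invr_ge0 ?exprn_ge0 ?(ltW u0) //.
  by have /andP[] := onem_tX n.
elim: n => [|n IH].
  by rewrite expr0 subrr mulr0 oppr0 expR0 /qpoch big_ord0.
rewrite qpochS.
have -> : - ((1 - t) ^- 2 * (1 - t ^+ n.+1)) =
    - ((1 - t) ^- 2 * (1 - t ^+ n)) + - (t ^+ n / (1 - t)).
  by rewrite [t ^+ n.+1]exprS; field; rewrite gt_eqF.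
rewrite expRD; apply: ler_pM; rewrite ?expR_ge0 //.
have tn0 : 0 < t ^+ n by rewrite exprn_gt0.
have tn1 : t ^+ n <= 1 by rewrite exprn_ile1 ?ltW.
rewrite expRN invf_ple ?posrE ?expR_gt0 //; last first.
  by rewrite subr_gt0 exprn_ilt1 // ltW.
apply: le_trans (expR_ge1Dx _).
have v0 : 0 < 1 - t ^+ n.+1 by rewrite subr_gt0 exprn_ilt1 // ltW.
rewrite -[leLHS]mul1r ler_pdivrMr //.
rewrite [t ^+ n.+1]exprS; set a := t ^+ n in tn0 tn1 *.
have -> : (1 + a / (1 - t)) * (1 - t * a) =
    1 + a * (1 - a) * t / (1 - t) + a * (1 - t).
  by field; rewrite gt_eqF.
rewrite -addrA lerDl addr_ge0 ?mulr_ge0 ?invr_ge0 ?subr_ge0 ?(ltW u0) ?(ltW tn0) ?(ltW t0) ?(ltW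
  t1) //.
Qed.

Lemma qconst_le1 : qconst <= 1.
Proof. exact: le_trans (qconst_le 0) (qpoch_le1 0). Qed.

(* At the time m the weighted bridge dominates the uniform one stochastically,
   up to a constant factor: there is no exact stochastic monotonicity. *)
Lemma weighted_domination w n k m i x (B : nat -> bool) : weights w ->
  (m <= n)%N -> (k <= n)%N -> (forall j j', B j -> (j <= j')%N -> B j') ->
  qconst * bridgeE m n k (fun s => (B (ups s))%:R) * bridgeZ w n i x k <=
  bridgeE n n k (fun s => (B (ups (take m s)))%:R * pathW w i x s).
Proof.
move=> hw mn kn Bup.
(* By the Markov property at time m the weights enter only through g, the product of the partition
   functions of the two pieces. When j grows, the left piece has a higher end (no loss) and the
   right piece a higher start (loss [qconst]), so g satisfies the hypothesis of
   [bridgeE_quasi_mono]. *)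
pose g j := bridgeZ w (n - m) (i + m) (x + j%:Z) (k - j) * bridgeZ w m i x j.
have split (h : nat -> R) :
    bridgeE n n k (fun s => h (ups (take m s)) * pathW w i x s) =
    bridgeE m n k (fun s => h (ups s) * g (ups s)).
  rewrite -[X in bridgeE X](subnKC mn) bridgeE_cat.
  transitivity (bridgeE m n k (fun s => (h (ups s) *
      bridgeZ w (n - m) (i + m) (x + (ups s)%:Z) (k - ups s)) * pathW w i x s)).
    apply: eq_bridgeE => s sm; rewrite mulrAC -bridgeEZ.
    apply: eq_bridgeE => s2 _; rewrite pathW_cat sm take_cat sm ltnn subnn take0.
    by rewrite cats0 mulrA.
  rewrite (@bridgeE_restr _ _ _ _ _ (fun j => h j *
      bridgeZ w (n - m) (i + m) (x + j%:Z) (k - j))) //.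
  by apply: eq_bridgeE => s sm; rewrite /g mulrA.
rewrite (split (fun j => (B j)%:R)).
have -> : bridgeZ w n i x k = bridgeE m n k (fun s => g (ups s)).
  transitivity (bridgeE n n k (fun s => 1 * pathW w i x s)).
    by apply: eq_bridgeE => s _; rewrite mul1r.
  by rewrite (split (fun=> 1)); apply: eq_bridgeE => s _; rewrite mul1r.
apply: bridgeE_quasi_mono => //.
- by rewrite qconst_le1 ltW ?qconst_gt0.
- move=> s [sm sk skn]; have := ups_size s; rewrite sm => um.
  by rewrite mulr_ge0 ?bridgeZ_ge0.
move=> s s' [sm sk skn] [sm' sk' skn'] ss'; rewrite /g mulrA.
have := ups_size s; have := ups_size s'; rewrite sm sm' => um' um.
apply: ler_pM.
- by rewrite mulr_ge0 ?bridgeZ_ge0 // ltW ?qconst_gt0.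
- by rewrite bridgeZ_ge0.
- apply: le_trans (_ : qpoch (ups s' - ups s) *
      bridgeZ w (n - m) (i + m) (x + (ups s)%:Z) (k - ups s) <= _).
    by rewrite ler_wpM2r ?bridgeZ_ge0 ?qconst_le.
  rewrite (_ : x + (ups s')%:Z = x + (ups s)%:Z + (ups s' - ups s)%N%:Z); last lia.
  rewrite [X in _ <= bridgeZ _ _ _ _ X](_ : _ = k - ups s - (ups s' - ups s))%N; last lia.
  by apply: bridgeZ_mono_start => //; lia.
exact: bridgeZ_mono_end.
Qed.

(* Ottaviani's argument: decompose along the first prefix that satisfies A. *)
Lemma first_passage w n k m i x c (A B : seq bool -> bool) :
  weights w -> (m <= n)%N -> (k <= n)%N ->
  (forall j s, (j <= m)%N -> prefix_ok j n k s -> A s ->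
    c * bridgeZ w (n - j) (i + j) (x + (ups s)%:Z) (k - ups s) <=
    bridgeE (n - j) (n - j) (k - ups s)
      (fun s' => (B (s ++ s'))%:R * pathW w (i + j) (x + (ups s)%:Z) s')) ->
  c * bridgeE n n k (fun s =>
      (has (fun j => A (take j s)) (iota 0 m.+1))%:R * pathW w i x s) <=
  bridgeE n n k (fun s => (B s)%:R * pathW w i x s).
Proof.
move=> hw; elim: m n k i x A B => [|m IH] n k i x A B mn kn hAB.
  have hB0 : 0 <= bridgeE n n k (fun s => (B s)%:R * pathW w i x s).
    by apply: bridgeE_ge0 => // s _; rewrite mulr_ge0 ?pathW_ge0.
  have [A0|A0] := boolP (A [::]).
    have := hAB 0%N [::] (leqnn _); rewrite !subn0 !addn0 addr0 => /(_ _ A0) h.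
    apply: le_trans (h (prefix_ok0 kn)).
    rewrite le_eqVlt; apply/orP; left; apply/eqP; congr (_ * _).
    by apply: eq_bridgeE => s _; rewrite /= take0 A0 mul1r.
  rewrite (@eq_bridgeE _ _ _ _ _ (fun=> 0)) ?bridgeE_cst ?mulr0 // => s _.
  by rewrite /= take0 (negbTE A0) mul0r.
have [A0|A0] := boolP (A [::]).
  have := hAB 0%N [::] (leq0n _); rewrite !subn0 !addn0 addr0 => /(_ _ A0) h.
  apply: le_trans (h (prefix_ok0 kn)).
  rewrite le_eqVlt; apply/orP; left; apply/eqP; congr (_ * _).
  by apply: eq_bridgeE => s _; rewrite /= take0 A0 mul1r.
case: n mn kn hAB => [//|n] mn kn hAB; rewrite !bridgeES -[n.+1.-1]/n.
have [r0 r1] := @ratio01 R _ _ kn.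
have step (b : bool) k' : (k' <= n)%N -> k = (b + k')%N ->
   c * bridgeE n n k' (fun s =>
     (has (fun j => A (take j (b :: s))) (iota 0 m.+2))%:R * pathW w i x (b :: s)) <=
   bridgeE n n k' (fun s => (B (b :: s))%:R * pathW w i x (b :: s)).
  move=> kn' kE.
  rewrite (@eq_bridgeE _ _ _ _ _ (fun s => w i x b *
    ((has (fun j => A (b :: take j s)) (iota 0 m.+1))%:R *
     pathW w i.+1 (x + (b : nat)%:Z) s))); last first.
    by move=> s _; rewrite iota_hit (negbTE A0) mulrCA.
  rewrite [leRHS](@eq_bridgeE _ _ _ _ _ (fun s => w i x b *
    ((B (b :: s))%:R * pathW w i.+1 (x + (b : nat)%:Z) s))); last first.
    by move=> s _; rewrite mulrCA.
  rewrite !bridgeEZ mulrCA; apply: ler_wpM2l; first exact: (weights_ge0 hw).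
  apply: (IH n k' i.+1 (x + (b : nat)%:Z) (fun s => A (b :: s))
    (fun s => B (b :: s))) => // j s jm [sj sk skn] As.
  have := hAB j.+1 (b :: s) jm; rewrite ups_cons PoszD addrA addSnnS kE subnDl subSS.
  by apply=> //; split; rewrite /= ?sj // ups_cons; lia.
rewrite mulrDr; apply: lerD; rewrite mulrCA.
  case: k kn hAB r0 r1 step => [|k] kn hAB r0 r1 step; first by rewrite !mul0r.
  by apply: ler_wpM2l => //; apply: (step true).
have [kn'|nk] := leqP k n; last first.
  have -> : 1 - k%:R / n.+1%:R = 0 :> R; last by rewrite !mul0r.
  have kE : k = n.+1 by apply/eqP; rewrite eqn_leq kn.
  by rewrite kE divff ?subrr ?pnatr_eq0.
by apply: ler_wpM2l; rewrite ?subr_ge0 //; apply: (step false).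
Qed.

End weights.

(** * Concentration of uniform bridges *)

Section concentration.
Context {R : realType}.
Implicit Types (m n k : nat) (s : seq bool) (e l V th : R).

Lemma expR_le_quad (x : R) : x <= 2^-1 -> expR x <= 1 + x + 2 * x ^+ 2.
Proof.
move=> x2; have x1 : 0 < 1 - x by lra.
rewrite -[x in leLHS]opprK expRN.
apply: (@le_trans _ _ (1 - x)^-1).
  rewrite lef_pV2 ?posrE ?expR_gt0 //; exact: expR_ge1Dx.
rewrite -[leLHS]mul1r ler_pdivrMr // -subr_ge0.
have -> : (1 + x + 2 * x ^+ 2) * (1 - x) - 1 = x ^+ 2 * (1 - 2 * x) by ring.
by rewrite mulr_ge0 ?sqr_ge0 //; lra.
Qed.

(** Moment generating function of a centred Bernoulli variable multiplied by a; the linear terms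
    cancel. The bound is in th rather than a because [bridge_mgf] applies it with a scale that
    shrinks along the bridge. *)
Lemma expR_two_points (q a th : R) : 0 <= q <= 1 -> `|a| <= `|th| -> `|th| <= 2^-1 ->
  q * expR (a * (1 - q)) + (1 - q) * expR (- (a * q)) <= expR (2 * th ^+ 2).
Proof.
move=> /andP[q0 q1] ath th2.
have a2 : a ^+ 2 <= th ^+ 2 by rewrite -(ger0_norm (sqr_ge0 a)) -(ger0_norm (sqr_ge0 th)) !normrX
  lerXn2r ?nnegrE.
have : `|a| <= 2^-1 by apply: le_trans ath th2.
rewrite ler_norml => /andP[al ar].
have h1 : a * (1 - q) <= 2^-1 by nra.
have h2 : - (a * q) <= 2^-1 by nra.
have := expR_le_quad h1; have := expR_le_quad h2.
have := expR_ge1Dx (2 * th ^+ 2); rewrite !expr2 in a2 * => e1 e2 e3.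
have q2 : 0 <= q * (1 - q) <= 1 by apply/andP; split; nra.
have {}e3 := ler_wpM2l q0 e3.
have q1' : 0 <= 1 - q by lra.
have {}e2 := ler_wpM2l q1' e2.
apply: le_trans (_ : 1 + 2 * (a * a) * (q * (1 - q)) <= _); first by lra.
case/andP: q2 => q2 q3.
apply: le_trans e1; rewrite lerD2l -mulrA ler_pM2l //.
by apply: le_trans a2; rewrite ler_piMr // -expr2 sqr_ge0.
Qed.

(** Induction on the first step, as for a martingale. An up step moves the conditional mean by rho
    (1 - al), a flat step by - rho al, where rho = 1 - m/n <= 1 because the remaining steps
    compensate in sampling without replacement. *)
Lemma bridge_mgf m n k th : (m <= n)%N -> (k <= n)%N -> `|th| <= 2^-1 ->
  bridgeE m n k (fun s => expR (th * ((ups s)%:R - m%:R * k%:R / n%:R)))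
  <= expR (2 * th ^+ 2 * m%:R).
Proof.
move=> mn kn th2; elim: m n k mn kn => [|m IH] n k mn kn.
  by rewrite /= /ups /= !mul0r subr0 !mulr0 expR0.
case: n mn kn => [//|n] mn kn; rewrite bridgeES -[n.+1.-1]/n.
set al : R := k%:R / n.+1%:R; pose rho : R := 1 - m%:R / n%:R.
have [a0 a1] : 0 <= al /\ al <= 1 := ratio01 kn.
have [r0 r1] : 0 <= m%:R / n%:R :> R /\ m%:R / n%:R <= 1 :> R := @ratio01 R n m mn.
have n1 : n.+1%:R != 0 :> R by rewrite pnatr_eq0.
have kE : k%:R = al * n.+1%:R by rewrite divfK.
have mnE : m%:R = m%:R / n%:R * n%:R :> R.
  case: (posnP n) => [n0|n0]; last by rewrite divfK // pnatr_eq0 -lt0n.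
  by rewrite n0 mulr0; move: mn; rewrite n0 ltnS leqn0 => /eqP ->.
pose X := expR (2 * th ^+ 2 * m%:R).
have X0 : 0 <= X by apply: expR_ge0.
have T1 : al * bridgeE m n k.-1 (fun s =>
      expR (th * ((ups (true :: s))%:R - m.+1%:R * k%:R / n.+1%:R))) <=
    al * (expR (th * rho * (1 - al)) * X).
  case: (posnP k) => [k0|k0]; first by rewrite /al k0 !mul0r.
  apply: ler_wpM2l => //.
  rewrite (@eq_bridgeE _ _ _ _ _ (fun s => expR (th * rho * (1 - al)) *
    expR (th * ((ups s)%:R - m%:R * k.-1%:R / n%:R)))).
    rewrite bridgeEZ ler_wpM2l ?expR_ge0 //; apply: IH => //.
    by rewrite -ltnS prednK.
  move=> s _; rewrite -expRD; congr expR.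
  rewrite ups_cons natrD -[true%:R]/(1 : R) -[th * rho * _]mulrA -mulrDr; congr (_ * _).
  rewrite -[m.+1%:R * _ / _]mulrA -/al [m%:R * _ / _]mulrAC /rho.
  have -> : k.-1%:R = al * n.+1%:R - 1 :> R by rewrite -kE -subn1 natrB.
  set c := m%:R / n%:R in mnE r0 r1 *.
  rewrite -[m.+1%:R]natr1 mnE -[n.+1%:R]natr1; ring.
have T2 : (1 - al) * bridgeE m n k (fun s =>
      expR (th * ((ups (false :: s))%:R - m.+1%:R * k%:R / n.+1%:R))) <=
    (1 - al) * (expR (- (th * rho * al)) * X).
  have [kn'|nk] := leqP k n; last first.
    have kE' : k = n.+1 by apply/eqP; rewrite eqn_leq kn.
    by rewrite /al kE' divff ?pnatr_eq0 // subrr !mul0r.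
  apply: ler_wpM2l; first by rewrite subr_ge0.
  rewrite (@eq_bridgeE _ _ _ _ _ (fun s => expR (- (th * rho * al)) *
    expR (th * ((ups s)%:R - m%:R * k%:R / n%:R)))).
    by rewrite bridgeEZ ler_wpM2l ?expR_ge0 //; apply: IH.
  move=> s _; rewrite -expRD; congr expR.
  rewrite ups_cons add0n -[th * rho * _]mulrA -[- (th * _)]mulrN -mulrDr; congr (_ * _).
  rewrite -[m.+1%:R * _ / _]mulrA -/al [m%:R * k%:R / _]mulrAC kE /rho.
  set c := m%:R / n%:R in mnE r0 r1 *.
  rewrite -[m.+1%:R]natr1 mnE -[n.+1%:R]natr1; ring.
apply: le_trans (lerD T1 T2) _.
rewrite [al * (_ * _)]mulrA [(1 - al) * (_ * _)]mulrA -mulrDl.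
have -> : 2 * th ^+ 2 * m.+1%:R = 2 * th ^+ 2 * m%:R + 2 * th ^+ 2.
  by rewrite -natr1; ring.
rewrite [leRHS]expRD [leRHS]mulrC ler_wpM2r //.
apply: expR_two_points => //; first by rewrite a0.
by rewrite normrM ler_piMr // ger0_norm /rho; lra.
Qed.

(** Chernoff's bound with th = e l / (4 V), the optimal size for the bound of [bridge_mgf]. The
    condition |th| <= 1/2 needs l <= 2 V; beyond that the event is empty, as the deviation is at
    most m <= V. The number e carries the sign. *)
Lemma bridge_tail m n k e l V : (m <= n)%N -> (k <= n)%N -> `|e| <= 1 ->
  m%:R <= V -> 0 < V -> 0 <= l ->
  bridgeE m n k (fun s => (l <= e * ((ups s)%:R - m%:R * k%:R / n%:R))%R%:R)
  <= expR (- (l ^+ 2 / (8 * V))).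
Proof.
move=> mn kn e1 mV V0 l0.
have [r0 r1] := @ratio01 R _ _ kn.
have [lV|Vl] := leP l (2 * V); last first.
  rewrite (@eq_bridgeE_ok _ _ _ _ _ (fun=> 0)) ?bridgeE_cst ?expR_ge0 // => s [sm _ _].
  have us : (ups s)%:R <= m%:R :> R by rewrite ler_nat -sm ups_size.
  have u0 : 0 <= (ups s)%:R :> R by [].
  have m0 : 0 <= m%:R :> R by [].
  rewrite -[m%:R * _ / _]mulrA; set r := k%:R / _ in r0 r1 *.
  apply/eqP; rewrite pnatr_eq0 eqb0 -ltNge.
  have : `|(ups s)%:R - m%:R * r| <= m%:R by rewrite ler_norml; nra.
  move=> h; apply: le_lt_trans (ler_norm _) _; rewrite normrM.
  have := normr_ge0 ((ups s)%:R - m%:R * r); have := normr_ge0 e; nra.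
pose th := e * (l / (4 * V)).
have th2 : `|th| <= 2^-1.
  rewrite normrM (_ : 2^-1 = 1 * 2^-1); last by rewrite mul1r.
  apply: ler_pM => //; rewrite ger0_norm ?divr_ge0 ?mulr_ge0 ?(ltW V0) //.
  by rewrite ler_pdivrMr ?mulr_gt0 //; lra.
apply: (@le_trans _ _ (expR (- (l * (l / (4 * V)))) *
  bridgeE m n k (fun s => expR (th * ((ups s)%:R - m%:R * k%:R / n%:R))))).
  rewrite -bridgeEZ; apply: le_bridgeE => // s _; rewrite -expRD.
  case: (leP l (e * _)) => /= h; last exact: expR_ge0.
  apply: le_trans (expR_ge1Dx _); rewrite lerDl /th.
  have -> : - (l * (l / (4 * V))) + e * (l / (4 * V)) * ((ups s)%:R - m%:R * k%:R / n%:R) =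
      l / (4 * V) * (e * ((ups s)%:R - m%:R * k%:R / n%:R) - l) by ring.
  by rewrite mulr_ge0 ?subr_ge0 // divr_ge0 ?mulr_ge0 ?(ltW V0).
apply: le_trans (ler_wpM2l (expR_ge0 _) (bridge_mgf mn kn th2)) _.
rewrite -expRD ler_expR.
have e2 : e ^+ 2 <= 1 by rewrite -[e ^+ 2]ger0_norm ?sqr_ge0 // normrX exprn_ile1.
have : 2 * th ^+ 2 * m%:R <= 2 * (l / (4 * V)) ^+ 2 * V.
  apply: ler_pM => //; first by rewrite mulr_ge0 ?sqr_ge0.
  by rewrite ler_pM2l // /th exprMn ler_piMl // sqr_ge0.
have -> : 2 * (l / (4 * V)) ^+ 2 * V = l ^+ 2 / (8 * V) by field; rewrite gt_eqF.
have -> : l * (l / (4 * V)) = 2 * (l ^+ 2 / (8 * V)) by field; rewrite gt_eqF.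
lra.
Qed.

Lemma expRN1_le2V : expR (-1) <= 2^-1 :> R.
Proof. by rewrite expRN lef_pV2 ?posrE ?expR_gt0 //; apply: le_trans (expR_ge1Dx _); lra. Qed.

Lemma weights_one t : 0 < t < 1 -> weights t (fun _ _ _ => 1 : R).
Proof.
move=> t01; split=> // i x j; rewrite mulr1.
by case/andP: (onem_tX t01 j) => _; rewrite lerBlDr lerDl.
Qed.

Lemma pathW_one i x s : pathW (fun _ _ _ => 1 : R) i x s = 1.
Proof. by elim: s i x => [|b s IH] i x //=; rewrite IH mulr1. Qed.

Definition bridge_dev n k j s : R := (ups (take j s))%:R - j%:R * k%:R / n%:R.

(** [first_passage] with all weights equal to 1. From 4 l at time j <= m the conditional mean at
    time m is still at least 2 l, since 2 m <= n gives (n - m) / (n - j) >= 1/2; the bridge then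
    falls below l with probability at most 1/2. *)
Lemma bridge_max_sided m n k e l : (0 < m)%N -> (2 * m <= n)%N -> (k <= n)%N ->
  `|e| <= 1 -> 0 <= l -> 8 * m%:R <= l ^+ 2 ->
  bridgeE n n k (fun s =>
    (has (fun j => 4 * l <= e * bridge_dev n k j s)%R (iota 0 m.+1))%:R)
  <= 2 * expR (- (l ^+ 2 / (8 * m%:R))).
Proof.
move=> m0 mn kn e1 l0 ml.
have t01 : 0 < (2^-1 : R) < 1 by apply/andP; split; lra.
have hw := weights_one t01.
have mn' : (m <= n)%N by lia.
have mR : 0 < m%:R :> R by rewrite ltr0n.
have nmN j : (n - j <= 2 * (n - m))%N by lia.
pose A s := 4 * l <= e * ((ups s)%:R - (size s)%:R * k%:R / n%:R).
pose B s := l <= e * ((ups (take m s))%:R - m%:R * k%:R / n%:R).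
have h : 2^-1 * bridgeE n n k (fun s =>
      (has (fun j => A (take j s)) (iota 0 m.+1))%:R * pathW (fun _ _ _ => 1 : R) 0 0 s) <=
    bridgeE n n k (fun s => (B s)%:R * pathW (fun _ _ _ => 1 : R) 0 0 s).
  apply: (first_passage t01 hw) => // j s jm [sj sk skn].
  rewrite /A sj => As; rewrite /bridgeZ.
  rewrite (@eq_bridgeE _ _ _ _ _ (fun=> 1)); last by move=> ? _; rewrite pathW_one.
  rewrite bridgeE_cst mulr1.
  have mj : (m - j <= n - j)%N by exact: leq_sub2r.
  have nj : 0 < (n - j)%:R :> R by rewrite ltr0n; clear -jm m0 mn; lia.
  have n0 : 0 < n%:R :> R by rewrite ltr0n; exact: leq_trans mn'.
  have nm2 : (n - j)%:R <= 2 * (n%:R - m%:R) :> R.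
    by rewrite -natrB // -natrM ler_nat nmN.
  pose f s' : R := (l <= e * ((ups s)%:R + (ups s')%:R - m%:R * k%:R / n%:R))%R%:R.
  rewrite (@eq_bridgeE _ _ _ _ _ (fun s' => f (take (m - j) s'))); last first.
    by move=> s' _; rewrite pathW_one mulr1 /B take_cat sj ltnNge jm /= ups_cat natrD.
  rewrite (bridgeE_take _ f mj).
  have mjR : (m - j)%:R <= m%:R :> R by rewrite ler_nat leq_subr.
  have e1' : `|- e| <= 1 by rewrite normrN.
  have tl := bridge_tail mj skn e1' mjR mR l0.
  have hx : expR (- (l ^+ 2 / (8 * m%:R))) <= 2^-1.
    apply: le_trans expRN1_le2V; rewrite ler_expR lerN2 ler_pdivlMr ?mulr_gt0 //.
    by rewrite mul1r.
  have {}tl := le_trans tl hx.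
  have : 1 <= 2^-1 + bridgeE (m - j) (n - j) (k - ups s) f.
    apply: le_trans (lerD tl (lexx _)).
    rewrite -bridgeED -[leLHS](bridgeE_cst (m - j) (n - j) (k - ups s)).
    apply: le_bridgeE => // s' _; rewrite /f; case: (leP l (- e * _)) => h1 /=; first by rewrite
      lerDl.
    rewrite add0r; case: (leP l (e * _)) => //= h2; exfalso.
    have mean : e * ((m - j)%:R * (k - ups s)%:R / (n - j)%:R + (ups s)%:R -
        m%:R * k%:R / n%:R) = e * ((ups s)%:R - j%:R * k%:R / n%:R) *
        ((n%:R - m%:R) / (n - j)%:R).
      have jn := leq_trans jm mn'.
      rewrite !natrB //; field.
      by rewrite -natrB // !gt_eqF.
    have r2 : 2^-1 <= (n%:R - m%:R) / (n - j)%:R :> R.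
      by rewrite ler_pdivlMr //; lra.
    set r := (n%:R - m%:R) / _ in mean r2; set d := e * (_ - _) in As mean.
    have : 2 * l <= d * r by nra.
    rewrite -mean; lra.
  lra.
have -> : bridgeE n n k (fun s =>
    (has (fun j => 4 * l <= e * bridge_dev n k j s)%R (iota 0 m.+1))%:R) =
  bridgeE n n k (fun s =>
      (has (fun j => A (take j s)) (iota 0 m.+1))%:R * pathW (fun _ _ _ => 1 : R) 0 0 s).
  apply: eq_bridgeE => s sn; rewrite pathW_one mulr1; congr (nat_of_bool _)%:R.
  apply: eq_in_has => j; rewrite mem_iota => /andP[_ jm].
  by rewrite /A /bridge_dev size_takel // sn; exact: leq_trans mn'.
rewrite -ler_pdivrMl //; apply: le_trans h _.
pose f s : R := (l <= e * ((ups s)%:R - m%:R * k%:R / n%:R))%R%:R.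
rewrite (@eq_bridgeE _ _ _ _ _ (fun s => f (take m s))); last first.
  by move=> s _; rewrite pathW_one mulr1.
by rewrite (bridgeE_take _ f mn'); apply: bridge_tail.
Qed.

Lemma bridgeE_union m n k (I : Type) (r : seq I) (E : I -> seq bool -> bool) c :
  (m <= n)%N -> (k <= n)%N ->
  (forall i, bridgeE m n k (fun s => (E i s)%:R) <= c) ->
  bridgeE m n k (fun s => (has (fun i => E i s) r)%:R) <= (size r)%:R * c :> R.
Proof.
move=> mn kn Ec; elim: r => [|i r IH] /=; first by rewrite bridgeE_cst mul0r.
rewrite -natr1 mulrDl mul1r addrC; apply: le_trans (lerD (Ec i) IH).
rewrite -bridgeED; apply: le_bridgeE => // s _.
by rewrite -natrD ler_nat; case: (E i s); case: (has _ _).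
Qed.

Lemma bridge_max m n k i l : (0 < m)%N -> (2 * m <= n)%N -> (i + m <= n)%N ->
  (k <= n)%N -> 0 <= l -> 8 * m%:R <= l ^+ 2 ->
  bridgeE n n k (fun s =>
    (has (fun j => 4 * l <= `|bridge_dev n k (i + j) s - bridge_dev n k i s|)%R
      (iota 0 m.+1))%:R)
  <= 4 * expR (- (l ^+ 2 / (8 * m%:R))).
Proof.
move=> m0 mn im kn l0 ml.
have i_n : (i <= n)%N by lia.
pose f s : R := (has (fun j => 4 * l <= `|bridge_dev n k j s|)%R (iota 0 m.+1))%:R.
rewrite (@eq_bridgeE _ _ _ _ _ (fun s => f (rot i s))); last first.
  move=> s sn; congr (nat_of_bool _)%:R; apply: eq_in_has => j.
  rewrite mem_iota => /andP[_ jm]; rewrite /bridge_dev /rot takel_cat; last first.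
    by rewrite size_drop sn; lia.
  rewrite takeD ups_cat !natrD; congr (_ <= `| _ |); ring.
rewrite -(bridgeE_rot f i_n kn).
pose e (b : bool) : R := if b then 1 else -1.
have -> : 4 * expR (- (l ^+ 2 / (8 * m%:R))) =
    (size [:: true; false])%:R * (2 * expR (- (l ^+ 2 / (8 * m%:R)))) by rewrite /=; ring.
apply: le_trans (bridgeE_union (E := fun b s => has (fun j =>
    4 * l <= e b * bridge_dev n k j s) (iota 0 m.+1)) [:: true; false] (leqnn n) kn _).
  apply: le_bridgeE => // s _; rewrite /f ler_nat.
  case: (boolP (has (fun j => _ <= `|_|) _)) => // /hasP[j jm h].
  set E := fun b => _; suff -> : has E [:: true; false] by [].
  move: h; rewrite ler_normr => /orP[] h; apply/hasP.
    by exists true; rewrite ?inE //; apply/hasP; exists j; rewrite //= mul1r.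
  by exists false; rewrite ?inE //; apply/hasP; exists j; rewrite //= mulN1r.
by move=> b; apply: bridge_max_sided => //; case: b; rewrite /e ?normrN normr1.
Qed.

Definition oscillation n k m l s : bool :=
  [exists i : 'I_n.+1, exists j : 'I_n.+1,
    [&& (i <= j)%N, (j <= i + m)%N & l <= `|bridge_dev n k j s - bridge_dev n k i s|]].

Lemma bridge_oscillation m n k l : (0 < m)%N -> (4 * m <= n)%N -> (k <= n)%N ->
  0 <= l -> 16 * m%:R <= l ^+ 2 ->
  bridgeE n n k (fun s => (oscillation n k m (8 * l) s)%:R)
  <= (n%:R / m%:R + 1) * (4 * expR (- (l ^+ 2 / (16 * m%:R)))).
Proof.
move=> m0 mn kn l0 ml.
(* Windows of length 2 m starting at multiples of m, so that two times at distance at most m share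
   one of them; near the right end they are moved left to stay in [0, n]. Comparing both times with
   the start of their window doubles 4 l to 8 l. *)
pose b i := minn (i * m) (n - 2 * m).
pose E i s := has (fun j => 4 * l <= `|bridge_dev n k (b i + j) s - bridge_dev n k (b i) s|)
  (iota 0 (2 * m).+1).
have b2 i : (b i + 2 * m <= n)%N by rewrite /b; lia.
have Ei i : bridgeE n n k (fun s => (E i s)%:R) <= 4 * expR (- (l ^+ 2 / (16 * m%:R))).
  apply: le_trans (bridge_max _ _ (b2 i) kn l0 _) _.
  - lia.
  - lia.
  - by rewrite natrM mulrA -natrM.
  by rewrite natrM mulrA -natrM.
apply: le_trans (_ : (size (iota 0 (n %/ m).+1))%:R * (4 * expR (- (l ^+ 2 / (16 * m%:R)))) <= _).
  apply: le_trans (bridgeE_union (iota 0 (n %/ m).+1) (leqnn n) kn Ei).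
  apply: le_bridgeE => // s os; rewrite ler_nat.
  case: (boolP (oscillation _ _ _ _ _)) => // /existsP[i /existsP[j /and3P[ij jm h]]].
  suff -> : has (fun i => E i s) (iota 0 (n %/ m).+1) by [].
  apply/hasP; exists (i %/ m)%N.
    by rewrite mem_iota /= add0n ltnS leq_div2r // -ltnS ltn_ord.
  have bi : (b (i %/ m) <= i)%N /\ (j <= b (i %/ m) + 2 * m)%N.
    have := ltn_ord j; have := leq_divM i m; have := ltn_ceil i m0.
    by rewrite /b mulSn; clear -ij jm m0 mn; lia.
  case: bi => bi bj; rewrite leNgt -[X in _ < X]/(8 * l) in h *.
  apply/negPn/negP => /hasPn nh.
  have := nh (i - b (i %/ m))%N; have := nh (j - b (i %/ m))%N.
  rewrite !mem_iota !add0n !ltnS !leq_subLR (leq_trans ij bj) bj /= !subnKC //; last exact: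
    leq_trans bi ij.
  move=> /(_ isT); rewrite -ltNge => h1 /(_ isT); rewrite -ltNge => h2.
  move/negP: h; apply.
  set c := bridge_dev n k (b _) s in h1 h2.
  rewrite (_ : _ - _ = (bridge_dev n k j s - c) - (bridge_dev n k i s - c)); last by ring.
  apply: le_lt_trans (ler_normB _ _) _; lra.
rewrite size_iota -natr1 ler_wpM2r ?mulr_ge0 ?expR_ge0 // lerD2r.
by rewrite ler_pdivlMr ?ltr0n // -natrM ler_nat leq_divM.
Qed.

(** [bridge_max] controls increments, not values. On the right half the value at time n - m is
    recovered from the vanishing deviation at time n, hence 8 l = 4 l + 4 l. *)
Lemma bridge_dev_max m n k l : (0 < m)%N -> (2 * m <= n <= 2 * m + 1)%N -> (k <= n)%N ->
  0 <= l -> 8 * m%:R <= l ^+ 2 ->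
  bridgeE n n k (fun s => [exists j : 'I_n.+1, 8 * l <= `|bridge_dev n k j s| ]%:R)
  <= 8 * expR (- (l ^+ 2 / (8 * m%:R))).
Proof.
move=> m0 /andP[mn nm] kn l0 ml.
pose b (i : bool) := if i then 0%N else (n - m)%N.
pose E i s := has (fun j => 4 * l <= `|bridge_dev n k (b i + j) s - bridge_dev n k (b i) s|)
  (iota 0 m.+1).
have b2 i : (b i + m <= n)%N by rewrite /b; case: i; lia.
have Ei i := bridge_max m0 mn (b2 i) kn l0 ml.
have -> : 8 * expR (- (l ^+ 2 / (8 * m%:R))) =
  (size [:: true; false])%:R * (4 * expR (- (l ^+ 2 / (8 * m%:R)))) by rewrite /=; ring.
apply: le_trans (bridgeE_union (E := E) [:: true; false] (leqnn n) kn Ei).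
apply: le_bridgeE => // s /prefix_ok_full[sn sk]; rewrite ler_nat.
case: (boolP [exists _, _]) => // /existsP[j h].
suff -> : has (fun i => E i s) [:: true; false] by [].
apply/negPn/negP; rewrite /= orbF negb_or => /andP[/hasPn n1 /hasPn n2].
have d0 : bridge_dev n k 0 s = 0 by rewrite /bridge_dev take0 !mul0r subr0.
have dn : bridge_dev n k n s = 0.
  rewrite /bridge_dev take_oversize ?sn // sk mulrAC divff ?mul1r ?subrr //.
  by rewrite pnatr_eq0 -lt0n; clear -m0 mn; lia.
have [jm|mj] := leqP j m.
  have := n1 j; rewrite mem_iota ltnS jm add0n d0 subr0 => /(_ isT); rewrite -ltNge.
  by move: h; lra.
have jn : (n - m <= j)%N by clear -mj nm; lia.
have := n2 (j - (n - m))%N; have := n2 m.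
have jn' : (j - (n - m) < m.+1)%N by have := ltn_ord j; clear -jn nm mn; lia.
rewrite !mem_iota !add0n !leqnn jn' /= subnKC // subnK; last by clear -mn; lia.
move=> /(_ isT); rewrite -ltNge dn sub0r normrN => h1 /(_ isT); rewrite -ltNge => h2.
have := ler_normD (bridge_dev n k j s - bridge_dev n k (n - m) s) (bridge_dev n k (n - m) s).
by rewrite subrK => /(le_trans h); lra.
Qed.

End concentration.

(** * A lower bound for hypergeometric tails *)

Section hypergeometric.
Context {R : realType}.
Implicit Types (m n k j : nat) (s : seq bool).

Lemma sumseq_sum n (I : finType) (F : I -> seq bool -> R) :
  sumseq n (fun s => \sum_i F i s) = \sum_i sumseq n (F i).
Proof. by elim: n F => [|n IH] F //=; rewrite !IH -big_split. Qed.

Lemma sumseq_count n (f : nat -> R) :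
  sumseq n (fun s => f (ups s)) = \sum_(j < n.+1) 'C(n, j)%:R * f j.
Proof.
transitivity (sumseq n (fun s => \sum_(j < n.+1) f j * (ups s == j)%:R)).
  apply: eq_sumseq => s sn.
  have us : (ups s < n.+1)%N by rewrite ltnS -sn ups_size.
  rewrite (bigD1 (Ordinal us)) //= eqxx mulr1 big1 ?addr0 // => i.
  by rewrite -val_eqE /= eq_sym => /negbTE ->; rewrite mulr0.
rewrite sumseq_sum; apply: eq_bigr => j _.
by rewrite sumseqZ sumseq_ups mulrC.
Qed.

(** Hypergeometric weights before division by 'C(n, k). The indicator guards against the truncated
    subtraction k - j. *)
Definition hyper m n k j : R := 'C(m, j)%:R * ((j <= k)%N%:R * 'C(n - m, k - j)%:R).

Lemma hyper_ge0 m n k j : 0 <= hyper m n k j.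
Proof. by rewrite !mulr_ge0. Qed.

Lemma bridgeE_hyper m n k (f : nat -> R) : (m <= n)%N ->
  'C(n, k)%:R * bridgeE m n k (fun s => f (ups s)) =
  \sum_(j < m.+1) hyper m n k j * f j.
Proof.
move=> mn; rewrite bridgeE_bin //.
rewrite (sumseq_count m (fun j => (j <= k)%N%:R * 'C(n - m, k - j)%:R * f j)).
by apply: eq_bigr => j _; rewrite /hyper mulrA.
Qed.

Lemma hyper_ratio m n k j (c : R) : (m <= n)%N -> (k <= n)%N -> 0 <= c ->
  c * ((j%:R + 1) * (n%:R - m%:R - k%:R + j%:R + 1)) <=
    (m%:R - j%:R) * (k%:R - j%:R) ->
  c * hyper m n k j <= hyper m n k j.+1.
Proof.
move=> mn kn c0 hc.
have [jm|mj] := leqP j m; last first.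
  by rewrite {1}/hyper bin_small // mul0r mulr0 hyper_ge0.
have [jk|kj] := leqP j k; last first.
  by rewrite {1}/hyper leqNgt kj mul0r mulr0 mulr0 hyper_ge0.
have [kjn|nkj] := leqP (k - j) (n - m); last first.
  by rewrite {1}/hyper [X in _ * X%:R]bin_small // !mulr0 hyper_ge0.
have e1 : (n - m - (k - j) + 1)%:R = n%:R - m%:R - k%:R + j%:R + 1 :> R.
  by rewrite natrD !natrB //; ring.
have den0 : 0 < (j%:R + 1) * (n%:R - m%:R - k%:R + j%:R + 1) :> R.
  by rewrite -e1 natr1 -natrM ltr0n muln_gt0 /= addn1.
have [kj|jk'] := leqP k j.
  have jkE : j = k by apply/eqP; rewrite eqn_leq jk.
  rewrite [in leRHS]jkE subrr mulr0 pmulr_lle0 // in hc.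
  by apply: le_trans (hyper_ge0 _ _ _ _); rewrite mulr_le0_ge0 // hyper_ge0.
rewrite -(ler_pM2r den0).
have -> : hyper m n k j.+1 * ((j%:R + 1) * (n%:R - m%:R - k%:R + j%:R + 1)) =
    hyper m n k j * ((m%:R - j%:R) * (k%:R - j%:R)).
  rewrite /hyper jk jk' !mul1r.
  have h1 : 'C(m, j.+1)%:R * (j%:R + 1) = 'C(m, j)%:R * (m%:R - j%:R) :> R.
    by rewrite natr1 -natrB // -!natrM mulnC mul_bin_left mulnC.
  have h2 : 'C(n - m, k - j.+1)%:R * (n%:R - m%:R - k%:R + j%:R + 1) =
      'C(n - m, k - j)%:R * (k%:R - j%:R) :> R.
    have kj1 : (k - j = (k - j.+1).+1)%N by rewrite subnSK.
    rewrite -e1 -natrB // -!natrM kj1 [in RHS]mulnC mul_bin_left mulnC.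
    congr (_ * _)%:R; clear -jk' kjn mn; lia.
  transitivity (('C(m, j.+1)%:R * (j%:R + 1)) *
    ('C(n - m, k - j.+1)%:R * (n%:R - m%:R - k%:R + j%:R + 1)) : R); first ring.
  by rewrite h1 h2; ring.
rewrite mulrAC mulrC; apply: ler_wpM2l => //; exact: hyper_ge0.
Qed.

(** At the mean mu = M K / N the cells of the two-by-two table satisfy (M - mu) (K - mu) = mu (N - M
    - K + mu), so consecutive weights have ratio about 1. Their common product is at least c N^2 and
    each cell is at most N, so each is at least c N. A shift by at most D lowers the numerator by at
    most D N and raises the denominator by at most 2 D N, whence the 3. *)
Lemma hyper_ratio_bound (N M K c D d : R) : 0 < N -> 0 <= M <= N -> 0 <= K <= N ->
  0 < c -> c * N ^+ 4 <= M * (N - M) * (K * (N - K)) -> 14 * D <= c * N ->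
  - D <= d <= D - 1 ->
  (1 - 3 * D / (c * N)) * ((M * K / N + d + 1) * (N - M - K + M * K / N + d + 1)) <=
  (M - (M * K / N + d)) * (K - (M * K / N + d)).
Proof.
move=> N0 /andP[M0 MN] /andP[K0 KN] c0 hc Dc /andP[d1 d2].
set mu := M * K / N.
have Nn0 : N != 0 by rewrite gt_eqF.
pose al := K - mu; pose be := M - mu; pose ep := N - M - K + mu.
have alE : al = K * (N - M) / N by rewrite /al /mu; field.
have beE : be = M * (N - K) / N by rewrite /be /mu; field.
have epE : ep = (N - M) * (N - K) / N by rewrite /ep /mu; field.
have NM : 0 <= N - M by rewrite subr_ge0.
have NK : 0 <= N - K by rewrite subr_ge0.
have mu0 : 0 <= mu by rewrite divr_ge0 ?mulr_ge0 // ltW.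
have al0 : 0 <= al by rewrite alE divr_ge0 ?mulr_ge0 // ltW.
have be0 : 0 <= be by rewrite beE divr_ge0 ?mulr_ge0 // ltW.
have ep0 : 0 <= ep by rewrite epE divr_ge0 ?mulr_ge0 // ltW.
have pE : al * be = mu * ep by rewrite alE beE epE /mu; field.
have ab : al + be <= N by rewrite /al /be; move: ep0; rewrite /ep; lra.
have me : mu + ep <= N by move: al0 be0; rewrite /ep /al /be; lra.
have pc : c * N ^+ 2 <= al * be.
  rewrite -(ler_pM2r (exprn_gt0 2 N0)) -mulrA -exprD.
  by apply: le_trans hc _; rewrite alE beE le_eqVlt; apply/orP; left; apply/eqP; field.
have D0 : 0 <= D by lra.
have alc : c * N <= al.
  rewrite -(ler_pM2r N0) -mulrA -expr2; apply: le_trans pc _.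
  by apply: ler_wpM2l => //; lra.
have bec : c * N <= be.
  rewrite -(ler_pM2r N0) -mulrA -expr2; apply: le_trans pc _.
  by rewrite mulrC; apply: ler_wpM2l => //; lra.
have muc : c * N <= mu.
  rewrite -(ler_pM2r N0) -mulrA -expr2; apply: le_trans pc _.
  by rewrite pE; apply: ler_wpM2l => //; lra.
have epc : c * N <= ep.
  rewrite -(ler_pM2r N0) -mulrA -expr2; apply: le_trans pc _.
  by rewrite pE mulrC; apply: ler_wpM2l => //; lra.
have DN : D <= N by lra.
have cN : 0 < c * N by rewrite mulr_gt0.
set xi := 3 * D / (c * N).
have xiE : xi * (c * N) = 3 * D by rewrite /xi divfK // gt_eqF.
have xi0 : 0 <= xi by rewrite divr_ge0 ?mulr_ge0 // ltW.
have xi1 : xi <= 1 by rewrite ler_pdivrMr //; lra.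
have up : (mu + d + 1) * (N - M - K + mu + d + 1) <= al * be + 2 * (D * N).
  apply: (@le_trans _ _ ((mu + D) * (ep + D))).
    apply: ler_pM; rewrite /ep in epc *; lra.
  have -> : (mu + D) * (ep + D) = al * be + D * (mu + ep) + D * D by rewrite pE; ring.
  have := ler_wpM2l D0 me; have := ler_wpM2l D0 DN; lra.
have low : al * be - D * N <= (M - (mu + d)) * (K - (mu + d)).
  apply: (@le_trans _ _ ((be - D) * (al - D))).
    have -> : (be - D) * (al - D) = al * be - D * (al + be) + D * D by ring.
    have := ler_wpM2l D0 ab; have := mulr_ge0 D0 D0; lra.
  apply: ler_pM; rewrite /al /be in alc bec *; lra.
apply: le_trans low.
have x1 : 0 <= 1 - xi by lra.
apply: le_trans (ler_wpM2l x1 up) _.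
have h1 : 3 * (D * N) <= xi * (al * be).
  apply: le_trans (ler_wpM2l xi0 pc).
  have -> : xi * (c * N ^+ 2) = xi * (c * N) * N by ring.
  by rewrite xiE; lra.
have := mulr_ge0 xi0 (mulr_ge0 D0 (ltW N0)).
have -> : (1 - xi) * (al * be + 2 * (D * N)) =
  al * be + 2 * (D * N) - xi * (al * be) - 2 * (xi * (D * N)) by ring.
lra.
Qed.

(** The injective map j -> j + d sends the typical values into V, and each weight loses at most r^d
    on the way. Values beyond m have weight 0, so the shifted sum is at most the sum over V. *)
Lemma hyper_shift m n k (mu l r : R) (d : nat) (V : R -> bool) :
  (m <= n)%N -> (k <= n)%N -> 0 <= r ->
  (forall j, `|j%:R - mu| <= l -> V (j + d)%N%:R) ->
  (forall j i, `|j%:R - mu| <= l -> (i < d)%N ->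
     r * hyper m n k (j + i) <= hyper m n k (j + i).+1) ->
  r ^+ d * bridgeE m n k (fun s => (`|(ups s)%:R - mu| <= l)%R%:R) <=
  bridgeE m n k (fun s => (V (ups s)%:R)%:R).
Proof.
move=> mn kn r0 hV hr.
have C0 : 0 < 'C(n, k)%:R :> R by rewrite ltr0n bin_gt0.
rewrite -(ler_pM2l C0) mulrCA.
rewrite (bridgeE_hyper k (fun j => (`|j%:R - mu| <= l)%R%:R) mn).
rewrite (bridgeE_hyper k (fun j => (V j%:R)%:R) mn).
have step j : `|j%:R - mu| <= l -> r ^+ d * hyper m n k j <= hyper m n k (j + d).
  move=> jl; elim: d {hV} hr => [|d IH] hr; first by rewrite expr0 mul1r addn0.
  rewrite exprS addnS -mulrA; apply: le_trans (hr j d jl (ltnSn d)).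
  by apply: ler_wpM2l => //; apply: IH => i j' ij jd; apply: hr => //; apply: ltnW.
pose g j : R := hyper m n k j * (V j%:R)%:R.
apply: (@le_trans _ _ (\sum_(j < m.+1) g (j + d)%N)).
  rewrite mulr_sumr; apply: ler_sum => j _; rewrite mulrA /g.
  case: (leP `|_| l) => jl; last by rewrite !mulr0 mulr_ge0 // hyper_ge0.
  by rewrite hV // !mulr1; apply: step.
rewrite -(big_mkord xpredT (fun j => g (j + d)%N)) -(big_mkord xpredT g).
apply: (@le_trans _ _ (\sum_(0 <= j < m.+1 + d) g j)).
  rewrite [leRHS](@big_cat_nat _ _ _ d) //= ?leq_addl //.
  have -> : \sum_(d <= j < m.+1 + d) g j = \sum_(0 <= j < m.+1) g (j + d)%N.
    by rewrite -{1}[d]add0n big_addn addnK.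
  by rewrite lerDr; apply: sumr_ge0 => j _; rewrite mulr_ge0 // hyper_ge0.
rewrite (@big_cat_nat _ _ _ m.+1) //= ?leq_addr // gerDl le_eqVlt.
apply/orP; left; apply/eqP; rewrite big_nat; apply: big1 => j /andP[mj _].
by rewrite /g /hyper bin_small ?mul0r.
Qed.

Lemma bridge_concentrated m n k (l : R) : (m <= n)%N -> (k <= n)%N -> (0 < n)%N ->
  0 <= l -> 16 * n%:R <= l ^+ 2 ->
  2^-1 <= bridgeE (R := R) m n k (fun s => (`|(ups s)%:R - m%:R * k%:R / n%:R| <= l)%R%:R).
Proof.
move=> mn kn n0 l0 ln.
have nR : 0 < n%:R :> R by rewrite ltr0n.
have mR : m%:R <= n%:R :> R by rewrite ler_nat.
have t1 : `|1 : R| <= 1 by rewrite normr1.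
have t2 : `|-1 : R| <= 1 by rewrite normrN normr1.
have := lerD (bridge_tail mn kn t1 mR nR l0) (bridge_tail mn kn t2 mR nR l0).
have ex : expR (- (l ^+ 2 / (8 * n%:R))) <= 4^-1 :> R.
  apply: (@le_trans _ _ (expR (-2))).
    by rewrite ler_expR lerN2 ler_pdivlMr ?mulr_gt0 //; lra.
  have -> : -2 = -1 - 1 :> R by lra.
  rewrite expRD (_ : 4^-1 = 2^-1 * 2^-1 :> R); last by lra.
  by apply: ler_pM; rewrite ?expR_ge0 ?expRN1_le2V.
set a := bridgeE _ _ _ _; set b := bridgeE _ _ _ _; set c := bridgeE _ _ _ _ => ab.
have : 1 <= c + (a + b).
  rewrite -!bridgeED -[leLHS](bridgeE_cst m n k); apply: le_bridgeE => // s _.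
  rewrite mul1r mulN1r ler_norml; set x := (ups s)%:R - _.
  case: (leP l x) => h1; first by rewrite addrCA lerDl addr_ge0.
  case: (leP l (- x)) => h2; first by rewrite addrA lerDr addr_ge0.
  have -> : - l <= x by lra.
  by rewrite (ltW h1) !addr0.
lra.
Qed.

(* Shifting a typical value by D changes the hypergeometric weights by a
   bounded factor as long as D is of order at most the square root of n. *)
Lemma bridge_tail_lower m n k (c H q : R) : (m <= n)%N -> (k <= n)%N -> (0 < n)%N ->
  0 < c -> 0 <= H -> 0 <= q -> n%:R <= q ^+ 2 ->
  c * n%:R ^+ 4 <= m%:R * (n%:R - m%:R) * (k%:R * (n%:R - k%:R)) ->
  14 * (H + 8 * q + 1) <= c * n%:R ->
  2^-1 * expR (- (6 * (H + 8 * q + 1) ^+ 2 / (c * n%:R))) <=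
  bridgeE m n k (fun s => (m%:R * k%:R / n%:R + H <= (ups s)%:R)%R%:R).
Proof.
move=> mn kn n0 c0 H0 q0 nq hc; set D := H + 8 * q + 1 => Dc.
(* With l = 4 q the interval of radius l around the mean has probability at least 1/2. The shift by
   d > H + l carries all of it above mean + H, and D = H + 2 l + 1 bounds every displacement met on
   the way. *)
pose l := 4 * q; pose d := (Num.truncn (H + l)).+1.
have l0 : 0 <= l by rewrite mulr_ge0.
have nR : 0 < n%:R :> R by rewrite ltr0n.
have cn0 : 0 < c * n%:R by rewrite mulr_gt0.
have D0 : 0 < D by rewrite /D; lra.
have /andP[tr1 tr2] : (Num.truncn (H + l))%:R <= H + l < d%:R.
  by apply: truncn_itv; rewrite addr_ge0.
set mu := m%:R * k%:R / n%:R.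
set xi := 3 * D / (c * n%:R).
have xi0 : 0 <= xi by rewrite divr_ge0 ?mulr_ge0 // ltW.
have xi2 : xi <= 2^-1 by rewrite ler_pdivrMr //; lra.
have conc : 2^-1 <= bridgeE (R := R) m n k (fun s => (`|(ups s)%:R - mu| <= l)%R%:R).
  apply: bridge_concentrated => //; rewrite /l exprMn; lra.
have dD : d%:R <= D by rewrite -natr1 /D; rewrite /l in tr1; lra.
apply: le_trans (@hyper_shift m n k mu l (1 - xi) d _ mn kn _ _ _).
- rewrite mulrC; apply: ler_pM; rewrite ?expR_ge0 ?invr_ge0 //.
  have x2 : expR (- (2 * xi)) <= 1 - xi.
    rewrite expRN invf_ple ?posrE ?expR_gt0 //; last by lra.
    apply: le_trans (expR_ge1Dx _); rewrite -[leLHS]mul1r ler_pdivrMr; last by lra.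
    nra.
  apply: (@le_trans _ _ (expR (- (2 * xi)) ^+ d)); last first.
    by rewrite lerXn2r ?nnegrE ?expR_ge0 //; lra.
  rewrite -expRM_natr ler_expR mulNr lerN2.
  have -> : 6 * D ^+ 2 / (c * n%:R) = 2 * xi * D.
    by rewrite /xi; field; rewrite !gt_eqF.
  by apply: ler_wpM2l => //; rewrite mulr_ge0.
- lra.
- move=> j; rewrite ler_norml => /andP[jl _]; rewrite natrD; lra.
move=> j i; rewrite ler_norml => /andP[jl ju] id.
have i1 : i%:R + 1 <= d%:R :> R by rewrite natr1 ler_nat.
have i0 : 0 <= i%:R :> R by [].
apply: hyper_ratio => //; first by lra.
have mR : 0 <= (m%:R : R) <= n%:R by rewrite ler0n ler_nat.
have kR : 0 <= (k%:R : R) <= n%:R by rewrite ler0n ler_nat.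
have := @hyper_ratio_bound n%:R m%:R k%:R c D ((j + i)%N%:R - mu) nR mR kR c0 hc Dc.
have dR : - D <= (j + i)%N%:R - mu <= D - 1.
  by rewrite natrD /D; rewrite /l in jl ju tr1; rewrite -natr1 in i1 dD; apply/andP; split; lra.
move=> /(_ dR); rewrite -/mu -/xi [mu + _]addrC subrK.
by rewrite -[_ - _ - _ + mu + _]addrA [mu + _]addrC subrK.
Qed.

End hypergeometric.

(** * The Gibbs property and resampling *)

Section paths.
Implicit Types (l : int -> int) (s : seq bool) (n m j : nat) (A B a : int).

Definition steps l A n : seq bool :=
  [seq (l (A + i%:Z + 1) - l (A + i%:Z) == 1) | i <- iota 0 n].

(** The value 0 off the interval is the one that [upright] prescribes, so that a path equals the one
    rebuilt from its start and steps. *)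
Definition path_of A a s : int -> int := fun i =>
  if (A <= i) && (i <= A + (size s)%:Z) then a + (ups (take (absz (i - A)%R) s))%:Z else 0.

Lemma size_steps l A n : size (steps l A n) = n.
Proof. by rewrite size_map size_iota. Qed.

Lemma stepsS l A n : steps l A n.+1 = (l (A + 1) - l A == 1) :: steps l (A + 1) n.
Proof.
rewrite /steps /= addr0; congr (_ :: _); rewrite (iotaDl 1 0 n) -map_comp.
by apply: eq_map => i /=; rewrite PoszD addrA.
Qed.

Lemma steps_cat l A m n : steps l A (m + n) = steps l A m ++ steps l (A + m%:Z) n.
Proof.
elim: m A => [|m IH] A; first by rewrite addr0.
by rewrite addSn !stepsS IH -addrA -intS.
Qed.

Lemma take_steps l A m n : (m <= n)%N -> take m (steps l A n) = steps l A m.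
Proof.
move=> mn; rewrite -(subnKC mn) steps_cat.
by rewrite -[X in take X _](size_steps l A m) take_size_cat.
Qed.

Lemma drop_steps l A m n : drop m (steps l A (m + n)) = steps l (A + m%:Z) n.
Proof. by rewrite steps_cat drop_size_cat ?size_steps. Qed.

Lemma upright_step A B l i : upright A B l -> A <= i -> i < B ->
  l (i + 1) = l i + ((l (i + 1) - l i == 1) : nat)%:Z.
Proof.
move=> [ul _] Ai iB; have [|e|e] := ul i; first by rewrite Ai.
  by rewrite e; lia.
by rewrite e; lia.
Qed.

Lemma upright_steps l A B i n : upright A B l -> A <= i -> i + n%:Z <= B ->
  l (i + n%:Z) = l i + (ups (steps l i n))%:Z.
Proof.
move=> ul; elim: n i => [|n IH] i Ai iB; first by rewrite !addr0.
rewrite intS addrA stepsS IH; [|lia|lia].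
by rewrite ups_cons PoszD addrA -(upright_step ul) //; lia.
Qed.

Lemma upright_inj l l' A n : upright A (A + n%:Z) l -> upright A (A + n%:Z) l' ->
  l A = l' A -> steps l A n = steps l' A n -> l = l'.
Proof.
move=> ul ul' e0 es; apply/funext => i.
have [/andP[Ai iB]|iAB] := boolP ((A <= i) && (i <= A + n%:Z)); last first.
  by rewrite (proj2 ul) // (proj2 ul').
pose j := absz (i - A)%R; have jE : i = A + j%:Z by rewrite /j; lia.
have jn : (j <= n)%N by rewrite /j; lia.
have jB : A + j%:Z <= A + n%:Z by rewrite -jE.
rewrite jE (upright_steps ul) // (upright_steps ul') // e0.
by rewrite -(take_steps l A jn) -(take_steps l' A jn) es.
Qed.

Lemma path_ofE A a s j : (j <= size s)%N ->
  path_of A a s (A + j%:Z) = a + (ups (take j s))%:Z.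
Proof.
move=> js; rewrite /path_of (_ : absz (A + j%:Z - A)%R = j); last by lia.
by rewrite ifT //; apply/andP; split; lia.
Qed.

Lemma path_of0 A a s : path_of A a s A = a.
Proof. by have := @path_ofE A a s 0 isT; rewrite addr0 take0 addr0. Qed.

Lemma path_of_upright A a s : upright A (A + (size s)%:Z) (path_of A a s).
Proof.
split=> [i iAB|i]; last by rewrite /path_of => /negbTE ->.
pose j := absz (i - A)%R; have jE : i = A + j%:Z by rewrite /j; lia.
have js : (j < size s)%N by rewrite /j; lia.
rewrite jE -addrA (_ : j%:Z + 1 = (j.+1)%:Z); last by lia.
rewrite !path_ofE ?(ltnW js) // (take_nth false js) /ups -cats1 count_cat /= addn0.
by case: (nth _ _ _) => /=; lia.
Qed.

Lemma steps_path_of A a s : steps (path_of A a s) A (size s) = s.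
Proof.
apply: (@eq_from_nth _ false); first by rewrite size_steps.
move=> j; rewrite size_steps => js.
rewrite (nth_map 0%N) ?size_iota // nth_iota // add0n -addrA.
rewrite (_ : j%:Z + 1 = (j.+1)%:Z); last by lia.
rewrite !path_ofE ?(ltnW js) // (take_nth false js) /ups -cats1 count_cat /= addn0.
by case: (nth _ _ _) => /=; lia.
Qed.

End paths.

(** * Hall-Littlewood weights as weights of single steps *)

Section HL_weights.
Context {R : realType}.
Variable t : R.
Hypothesis t01 : 0 < t < 1.
Implicit Types (l : int -> int) (n j : nat) (A : int).

(* Weights of the steps of a path over the bottom path l, from the time A on.
   Below l they vanish. *)
Definition HLw l A (i : nat) (x : int) (b : bool) : R :=
  let h := x - l (A + i%:Z) in
  if h < 0 then 0
  else if b then 1 else 1 - (l (A + i%:Z + 1) - l (A + i%:Z) == 1)%:R * t ^+ absz h.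

Lemma HLw_shift l A m i x b : HLw l A (m + i) x b = HLw l (A + m%:Z) i x b.
Proof. by rewrite /HLw PoszD addrA. Qed.

(** After raising by j a position that is not below l the gap is at least j, so a flat step weighs
    at least 1 - t^j: this is [weights_merge]. From below l its left side is 0. *)
Lemma HLw_weights l A : weights t (HLw l A).
Proof.
have t0 n : 0 <= t ^+ n by case/andP: t01 => ? _; rewrite exprn_ge0 ?ltW.
have t1 n : t ^+ n <= 1 by have /andP[] := onem_tX t01 n; rewrite subr_ge0.
have tn m n : (m <= n)%N -> t ^+ n <= t ^+ m.
  by move=> mn; case/andP: t01 => ? ?; rewrite ler_wiXn2l ?ltW.
have le1 (c : bool) n : c%:R * t ^+ n <= 1 by case: c; rewrite ?mul1r ?mul0r ?t1.
have ge0 (c : bool) n : 0 <= c%:R * t ^+ n by case: c; rewrite ?mul1r ?mul0r ?t0.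
split=> [i x b|i x b|i x y b xy|i x|i x j]; rewrite /HLw /=.
- by case: ifP => // _; case: b; rewrite ?subr_ge0 ?le1.
- by case: ifP => // _; case: b; rewrite // lerBlDr lerDl.
- have [xl|lx] := ltP (x - l (A + i%:Z)) 0.
    by case: ifP => // _; case: b; rewrite ?subr_ge0 ?le1.
  have -> : (y - l (A + i%:Z) < 0) = false by lia.
  by case: b => //; rewrite lerD2l lerN2 ler_wpM2l // tn //; lia.
- by case: ifP => // _; rewrite lerBlDr lerDl.
have [xl|lx] := ltP (x - l (A + i%:Z)) 0.
  by rewrite mulr0; case: ifP => // _; rewrite subr_ge0 le1.
have -> : (x + j%:Z - l (A + i%:Z) < 0) = false by lia.
rewrite mulr1 lerD2l lerN2; apply: (@le_trans _ _ (1 * t ^+ absz (x + j%:Z - l (A + i%:Z))%R)).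
  by apply: ler_wpM2r => //; case: (_ == _).
by rewrite mul1r tn //; lia.
Qed.

Lemma pathW_steps (w : nat -> int -> bool -> R) l A B n :
  upright A B l -> A + n%:Z <= B -> pathW w 0 (l A) (steps l A n) =
  \prod_(i < n) w i (l (A + i%:Z)) (l (A + i%:Z + 1) - l (A + i%:Z) == 1).
Proof.
move=> ul; elim: n => [|n IH] nB; first by rewrite big_ord0.
rewrite big_ord_recr -[nat_of_ord ord_max]/n -IH; last by lia.
rewrite -[in LHS]addn1 steps_cat pathW_cat size_steps /= mulr1 !addr0; congr (_ * w _ _ _).
by rewrite (upright_steps ul) //; lia.
Qed.

(** The two ways of forbidding a crossing agree: a path passes below l2 only by a flat step at gap 0
    under an up step of l2, whose factor is 1 - t^0 = 0. This also covers the last site, which is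
    not the start of a step. The order at A is a hypothesis because the set of sites starts at A +
    1. *)
Lemma HL_weightE l l2 A n : upright A (A + n%:Z) l -> upright A (A + n%:Z) l2 ->
  l2 A <= l A ->
  HL_weight t l l2 `[(A + 1), (A + n%:Z)]%classic =
  pathW (HLw l2 A) 0 (l A) (steps l A n).
Proof.
move=> ul ul2 l0; rewrite (pathW_steps _ ul) //.
pose w (i : nat) : R := HLw l2 A i (l (A + i%:Z)) (l (A + i%:Z + 1) - l (A + i%:Z) == 1).
pose D i := l i - l2 i.
rewrite /HL_weight; case: ifPn => [/asboolP le2|nle].
  have D0 (i : nat) : (i <= n)%N -> 0 <= D (A + i%:Z).
    move=> i_n; rewrite /D; case: i i_n => [|i] i_n; first by rewrite addr0; lia.
    by have := le2 (A + i.+1%:Z); rewrite /= in_itv /= => /(_ ltac:(lia)); lia.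
  rewrite (@reindex_fsbig _ _ _ _ _ (fun i : nat => A + 1 + i%:Z) `I_n); last first.
    split.
    - by move=> i /= i_n; rewrite in_itv /=; lia.
    - by move=> i j _ _ /= /addrI[].
    - move=> i /=; rewrite in_itv /= => iAB; exists (absz (i - (A + 1))%R) => /=; lia.
  rewrite -(fsbig_ord _ _ (fun i : nat => 1 - (D (A + 1 + i%:Z - 1) - D (A + 1 + i%:Z) == 1)%:R *
    t ^ D (A + 1 + i%:Z - 1))).
  apply: eq_bigr => i _; have := D0 i (ltnW (ltn_ord i)).
  rewrite (_ : A + 1 + i%:Z - 1 = A + i%:Z); last by lia.
  rewrite (_ : A + 1 + i%:Z = A + i%:Z + 1); last by lia.
  rewrite /HLw -/(D _) => Di; rewrite ltNge Di /=.
  have i1 := ltn_ord i.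
  have u1 : A <= A + i%:Z by lia.
  have u2 : A + i%:Z < A + n%:Z by lia.
  have [e1|e1] := proj1 ul (A + i%:Z) ltac:(by rewrite u1 u2);
  have [e2|e2] := proj1 ul2 (A + i%:Z) ltac:(by rewrite u1 u2); rewrite e1 e2 /=.
  - by rewrite (_ : (_ == 1) = false) ?mul0r ?subr0 //; rewrite /D; lia.
  - rewrite (_ : (_ == 1) = true); last by rewrite /D; lia.
    by rewrite -[in LHS](gez0_abs Di).
  - by rewrite (_ : (_ == 1) = false) ?mul0r ?subr0 //; rewrite /D; lia.
  - by rewrite (_ : (_ == 1) = false) ?mul0r ?subr0 //; rewrite /D; lia.
apply/esym/eqP; apply: contraNT nle => /prodf_neq0 nz; apply/asboolP => i.
rewrite /= in_itv /= => iAB.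
pose j := absz (i - A)%R; have -> : i = A + j%:Z by rewrite /j; lia.
have : (j <= n)%N by rewrite /j; lia.
elim: (j) => [_|k IH kn]; first by rewrite addr0.
have := nz (Ordinal kn) isT; rewrite /HLw /= => hw.
have u1 : A <= A + k%:Z by lia.
have u2 : A + k%:Z < A + n%:Z by lia.
have kE : A + k.+1%:Z = A + k%:Z + 1 by lia.
have {}IH := IH (ltnW kn).
have [e1|e1] := proj1 ul (A + k%:Z) ltac:(by rewrite u1 u2);
have [e2|e2] := proj1 ul2 (A + k%:Z) ltac:(by rewrite u1 u2); rewrite kE; try lia.
move: hw; rewrite e1 e2 /= mul1r; case: ifP => _; first by rewrite eqxx.
have [e|] := eqVneq (l (A + k%:Z)) (l2 (A + k%:Z)); last by lia.
by rewrite e subrr expr0 subrr eqxx.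
Qed.

End HL_weights.

Section sumseq_ups.
Context {R : realType}.

Lemma sumseq_by_ups n (h : nat -> R) (F : seq bool -> R) :
  sumseq n (fun s => h (ups s) * F s) =
  \sum_(k < n.+1) h k * ('C(n, k)%:R * bridgeE n n k F).
Proof.
transitivity (sumseq n (fun s => \sum_(k < n.+1) h k * ((ups s == k)%:R * F s))).
  apply: eq_sumseq => s sn.
  have us : (ups s < n.+1)%N by rewrite ltnS -sn ups_size.
  rewrite (bigD1 (Ordinal us)) //= eqxx mul1r big1 ?addr0 // => i.
  by rewrite -val_eqE /= eq_sym => /negbTE ->; rewrite mul0r mulr0.
rewrite sumseq_sum; apply: eq_bigr => k _; rewrite sumseqZ; congr (_ * _).
by rewrite bridgeE_full // -ltnS ltn_ord.
Qed.

End sumseq_ups.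

(** * From the Gibbs property to a comparison principle *)

Section resampling.
Context {R : realType} d {Om : measurableType d} {T0 T1 : int}.
Variables (L : simple_ensemble Om T0 T1) (P : probability Om R) (t : R).
Hypothesis t01 : 0 < t < 1.

Definition ens_pr (Q : (int -> int) -> (int -> int) -> Prop) : R :=
  fine (P [set w | Q (ens_top L w) (ens_bot L w)]).

Lemma ens_meas (Q : (int -> int) -> (int -> int) -> Prop) :
  measurable [set w | Q (ens_top L w) (ens_bot L w)].
Proof. exact: (ens_measurable L [set q | Q q.1 q.2]). Qed.

Lemma ens_prE Q : P [set w | Q (ens_top L w) (ens_bot L w)] = (ens_pr Q)%:E.
Proof. by rewrite /ens_pr fineK // fin_num_measure //; exact: ens_meas. Qed.

Lemma ens_pr_ge0 Q : 0 <= ens_pr Q.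
Proof. by rewrite /ens_pr fine_ge0. Qed.

Lemma ens_pr_le Q Q' : (forall l1 l2, upright T0 T1 l1 -> upright T0 T1 l2 ->
    (forall i, T0 <= i <= T1 -> l2 i <= l1 i) -> Q l1 l2 -> Q' l1 l2) -> ens_pr Q <= ens_pr Q'.
Proof.
move=> QQ'; rewrite -lee_fin -!ens_prE; apply: le_measure; rewrite ?inE; try exact: ens_meas.
by move=> w /=; apply: QQ'; [exact: ens_top_upright|exact: ens_bot_upright|exact: ens_le].
Qed.

Lemma ens_pr_eq Q Q' : (forall l1 l2, upright T0 T1 l1 -> upright T0 T1 l2 ->
    (forall i, T0 <= i <= T1 -> l2 i <= l1 i) -> Q l1 l2 <-> Q' l1 l2) -> ens_pr Q = ens_pr Q'.
Proof.
move=> QQ'; apply/eqP; rewrite eq_le !ens_pr_le // => l1 l2 u1 u2 l12 h; exact/(QQ' l1 l2).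
Qed.

Lemma ens_pr_split (Q B : (int -> int) -> (int -> int) -> Prop) :
  ens_pr Q = ens_pr (fun l1 l2 => Q l1 l2 /\ B l1 l2) + ens_pr (fun l1 l2 => Q l1 l2 /\ ~ B l1 l2).
Proof.
have m1 := ens_meas (fun l1 l2 => Q l1 l2 /\ B l1 l2).
have m2 := ens_meas (fun l1 l2 => Q l1 l2 /\ ~ B l1 l2).
apply: EFin_inj; rewrite EFinD -!ens_prE -measureU //.
  congr (P _); apply/seteqP; split => w /=; last by tauto.
  by case: (pselect (B (ens_top L w) (ens_bot L w))); tauto.
by apply/seteqP; split => w //= [[_ ?] [_ ?]].
Qed.

Lemma ens_pr_steps Q A n : ens_pr Q = sumseq n (fun s =>
  ens_pr (fun l1 l2 => Q l1 l2 /\ steps l1 A n = s)).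
Proof.
elim: n A Q => [|n IH] A Q /=; first by apply: ens_pr_eq => l1 l2 _ _ _; split => // -[].
rewrite (ens_pr_split Q (fun l1 _ => (l1 (A + 1) - l1 A == 1))).
congr (_ + _); rewrite (IH (A + 1)); apply: eq_sumseq => s _;
  apply: ens_pr_eq => l1 l2 _ _ _; rewrite stepsS.
  by split=> [[[q ->] ->]//|[q [-> ->]]].
by split=> [[[q /negP/negbTE ->] ->]//|[q [-> ->]]].
Qed.

(** Conditioning on a countable statistic without conditional probabilities: an inequality on each
    level set of c is summed by countable additivity. Levels are numbered by [pickle], and numbers
    outside its range give empty events. *)
Lemma ens_pr_code (I : countType) (c : (int -> int) -> (int -> int) -> I)
    (F G : (int -> int) -> (int -> int) -> Prop) (C : R) :
  (forall i, ens_pr (fun l1 l2 => F l1 l2 /\ c l1 l2 = i) <=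
     C * ens_pr (fun l1 l2 => G l1 l2 /\ c l1 l2 = i)) ->
  ens_pr F <= C * ens_pr G.
Proof.
move=> h; rewrite -lee_fin EFinM -!ens_prE.
pose E (Q : (int -> int) -> (int -> int) -> Prop) n :=
  [set w | Q (ens_top L w) (ens_bot L w) /\ pickle (c (ens_top L w) (ens_bot L w)) = n].
have mE Q n : measurable (E Q n) by exact: (ens_meas (fun l1 l2 => Q l1 l2 /\ pickle (c l1 l2) =
  n)).
have sE Q : P [set w | Q (ens_top L w) (ens_bot L w)] = (\sum_(0 <= n <oo | n \in setT) P (E Q
  n))%E.
  rewrite -measure_bigcup //.
    congr (P _); apply/seteqP; split => w /=; last by case=> n _ [].
    by move=> q; exists (pickle (c (ens_top L w) (ens_bot L w))).
  move=> i j _ _ /= [w [[_ <-] [_ <-]]] //.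
rewrite !sE -nneseriesZl //; apply: lee_nneseries => // n _.
rewrite (ens_prE (fun l1 l2 => F l1 l2 /\ pickle (c l1 l2) = n)).
rewrite (ens_prE (fun l1 l2 => G l1 l2 /\ pickle (c l1 l2) = n)) -EFinM lee_fin.
have [[i ni]|no] := pselect (exists i : I, pickle i = n).
  have e Q : ens_pr (fun l1 l2 => Q l1 l2 /\ pickle (c l1 l2) = n) =
      ens_pr (fun l1 l2 => Q l1 l2 /\ c l1 l2 = i).
    apply: ens_pr_eq => l1 l2 _ _ _; rewrite -ni.
    by split=> -[q]; [move/(pcan_inj pickleK) ->|move=> ->].
  by rewrite !e.
have e Q : ens_pr (fun l1 l2 => Q l1 l2 /\ pickle (c l1 l2) = n) = 0.
  apply/eqP; rewrite eq_le ens_pr_ge0 andbT.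
  have -> : 0 = ens_pr (fun _ _ => False) by rewrite /ens_pr (_ : [set _ | _] = set0) ?measure0.
  by apply: ens_pr_le => l1 l2 _ _ _ [_ pn]; apply: no; exists (c l1 l2).
by rewrite !e mulr0.
Qed.

Variable n : nat.
Hypothesis T01 : T1 = T0 + n%:Z.
Hypothesis gibbs : HL_Gibbs L P t `[(T0 + 1), T1]%classic.

(** Conditional probability, partition function and number of paths depend on the top path only
    through its right end, so they are absorbed into c, which vanishes when the conditioning event
    is null. *)
Lemma gibbs_mass (l2 : int -> int) (a : int) : upright T0 T1 l2 ->
  exists c : nat -> R, (forall k, 0 <= c k) /\ forall s, size s = n ->
  ens_pr (fun l1 l2' => (l1 T0 = a /\ l2' = l2) /\ steps l1 T0 n = s) =
  c (ups s) * pathW (HLw t l2 T0) 0 a s.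
Proof.
move=> u2.
have uT l : upright T0 T1 l = upright T0 (T0 + n%:Z) l by rewrite T01.
(* The Gibbs weight does not look at the site T0. A start below l2 is excluded by [ens_le] instead
   and gets c = 0. *)
have [al|la] := ltP a (l2 T0).
  exists (fun=> 0); split=> // s sn; rewrite mul0r; apply/eqP; rewrite eq_le ens_pr_ge0 andbT.
  have -> : 0 = ens_pr (fun _ _ => False) by rewrite /ens_pr (_ : [set _ | _] = set0) ?measure0.
  apply: ens_pr_le => l1 l2' _ _ /(_ T0); rewrite lexx T01 lerDl lez_nat /= => /(_ isT).
  by move=> h [[e1 e2] _]; move: h; rewrite e1 e2 leNgt al.
pose E k : set Om := [set w | [/\ ens_top L w T0 = a, ens_top L w T1 = a + k%:Z & ens_bot L w =
  l2]].
have mE k : measurable (E k).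
  exact: (ens_meas (fun l1 l2' => [/\ l1 T0 = a, l1 T1 = a + k%:Z & l2' = l2])).
pose fe k : R := free_expectation T0 T1 a (a + k%:Z)
  (fun l' => HL_weight t l' l2 `[(T0 + 1), T1]%classic).
pose card k : R := (size (finmap.enum_fset (fset_set (upright_bridge T0 T1 a (a + k%:Z)))))%:R.
have HLE l k : upright_bridge T0 T1 a (a + k%:Z) l ->
    HL_weight t l l2 `[(T0 + 1), T1]%classic = pathW (HLw t l2 T0) 0 a (steps l T0 n).
  case=> ul la0 _; rewrite T01 HL_weightE // -?uT ?la0 //.
have fe0 k : 0 <= fe k.
  apply: fsumr_ge0 => l bl; rewrite (HLE _ _ bl) mulr_ge0 //.
    by apply: pathW_ge0; exact: HLw_weights.
  by rewrite /free_prob divr_ge0 // indicE.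
exists (fun k => fine (P (E k)) / fe k / card k); split.
  by move=> k; rewrite !divr_ge0 // fine_ge0.
move=> s sn; set k := ups s; pose l := path_of T0 a s.
have ul : upright T0 T1 l by rewrite uT -sn; exact: path_of_upright.
have l0 : l T0 = a by exact: path_of0.
have l1 : l T1 = a + k%:Z by rewrite /l T01 -sn path_ofE // take_size.
have bl : upright_bridge T0 T1 a (a + k%:Z) l by [].
have ls : steps l T0 n = s by rewrite -sn steps_path_of.
have setE : [set w | (ens_top L w T0 = a /\ ens_bot L w = l2) /\ steps (ens_top L w) T0 n = s] =
    [set w | ens_top L w = l] `&` E k.
  apply/seteqP; split => w /=.
    case=> -[e1 e2] e3; have e : ens_top L w = l.
      have := ens_top_upright L w; rewrite uT => utop.
      have ul' := ul; rewrite uT in ul'.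
      by apply: (upright_inj utop ul'); rewrite ?l0 ?ls.
    by split=> //; split; rewrite // e.
  by case=> e [e1 e2 e3]; rewrite e l0 ls.
rewrite /ens_pr setE.
have [PE0|PE0] := eqVneq (P (E k)) 0%E.
  rewrite PE0 /= !mul0r; apply/eqP; rewrite fine_eq0.
    rewrite -measure_le0 -PE0; apply: le_measure; rewrite ?inE //.
    apply: measurableI => //; exact: (ens_meas (fun l1 _ => l1 = l)).
  rewrite fin_num_measure //; apply: measurableI => //; exact: (ens_meas (fun l1 _ => l1 = l)).
have PEpos : (0 < P (E k))%E by rewrite lt0e PE0 /=.
have := gibbs u2 PEpos bl; rewrite /cond_prob -/(E k) (HLE _ _ bl) ls -/(fe k).
rewrite /free_prob -/(card k) indicE mem_set // -[true%:R]/(1 : R) mul1r => e.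
have f0 : fine (P (E k)) != 0 by rewrite fine_eq0 // fin_num_measure.
by rewrite -[LHS](divfK f0) e; ring.
Qed.

(** The Gibbs property on a window of n2 steps, as a comparison principle. F and G see only the
    bottom path and the top path inside the window; an inequality between their weighted sums,
    uniform in the data at its boundary, passes to the ensemble with the same C. *)
Lemma resampling (n1 n2 n3 : nat) (F G : (int -> int) -> int -> seq bool -> Prop) (C : R) :
  n = (n1 + (n2 + n3))%N ->
  (forall l2 x k, upright T0 T1 l2 -> (k <= n2)%N ->
    bridgeE n2 n2 k (fun s => (`[< F l2 x s >])%:R * pathW (HLw t l2 (T0 + n1%:Z)) 0 x s) <=
    C * bridgeE n2 n2 k (fun s => (`[< G l2 x s >])%:R * pathW (HLw t l2 (T0 + n1%:Z)) 0 x s)) ->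
  ens_pr (fun l1 l2 => F l2 (l1 (T0 + n1%:Z)) (steps l1 (T0 + n1%:Z) n2)) <=
  C * ens_pr (fun l1 l2 => G l2 (l1 (T0 + n1%:Z)) (steps l1 (T0 + n1%:Z) n2)).
Proof.
move=> nE h.
apply: (@ens_pr_code _ (fun l1 l2 => (l1 T0, (l2 T0, steps l2 T0 n)))) => -[a [a2 s2]].
have [sn2|sn2] := eqVneq (size s2) n; last first.
  have e Q : ens_pr (fun l1 l2 => Q l1 l2 /\ (l1 T0, (l2 T0, steps l2 T0 n)) = (a, (a2, s2))) = 0.
    apply/eqP; rewrite eq_le ens_pr_ge0 andbT.
    have -> : 0 = ens_pr (fun _ _ => False) by rewrite /ens_pr (_ : [set _ | _] = set0) ?measure0.
    apply: ens_pr_le => l1 l2 _ _ _ [_ [_ _ e]].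
    by move: sn2; rewrite -e size_steps eqxx.
  by rewrite (e (fun l1 l2 => F l2 _ _)) (e (fun l1 l2 => G l2 _ _)) mulr0.
pose l2 := path_of T0 a2 s2.
have u2 : upright T0 T1 l2 by rewrite T01 -sn2; exact: path_of_upright.
have [c [c0 hc]] := gibbs_mass a u2.
have main (Q : (int -> int) -> int -> seq bool -> Prop) :
    ens_pr (fun l1 l2 => Q l2 (l1 (T0 + n1%:Z)) (steps l1 (T0 + n1%:Z) n2) /\
      (l1 T0, (l2 T0, steps l2 T0 n)) = (a, (a2, s2))) =
    sumseq n1 (fun s1 => sumseq n3 (fun s3 =>
      pathW (HLw t l2 T0) 0 a s1 * sumseq n2 (fun s =>
      (c (ups s1 + (ups s + ups s3))%N *
        pathW (HLw t l2 T0) (n1 + n2) (a + (ups s1)%:Z + (ups s)%:Z) s3) *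
      ((`[< Q l2 (a + (ups s1)%:Z) s >])%:R *
        pathW (HLw t l2 (T0 + n1%:Z)) 0 (a + (ups s1)%:Z) s)))).
  rewrite (ens_pr_steps _ T0 n) [in sumseq n]nE sumseq_cat; apply: eq_sumseq => s1 sn1.
  rewrite sumseq_cat exchange_sumseq; apply: eq_sumseq => s3 sn3.
  rewrite -sumseqZ; apply: eq_sumseq => s sn.
  have ssn : size (s1 ++ s ++ s3) = n by rewrite !size_cat sn1 sn sn3.
  transitivity ((`[< Q l2 (a + (ups s1)%:Z) s >])%:R *
      ens_pr (fun l1 l2' => (l1 T0 = a /\ l2' = l2) /\ steps l1 T0 n = s1 ++ s ++ s3)).
    have iff l1 l2' : upright T0 T1 l1 -> upright T0 T1 l2' ->
        (Q l2' (l1 (T0 + n1%:Z)) (steps l1 (T0 + n1%:Z) n2) /\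
          (l1 T0, (l2' T0, steps l2' T0 n)) = (a, (a2, s2))) /\ steps l1 T0 n = s1 ++ s ++ s3 <->
        Q l2 (a + (ups s1)%:Z) s /\ ((l1 T0 = a /\ l2' = l2) /\ steps l1 T0 n = s1 ++ s ++ s3).
      move=> u1 u2'.
      have val : l1 T0 = a -> steps l1 T0 n = s1 ++ s ++ s3 ->
          l1 (T0 + n1%:Z) = a + (ups s1)%:Z /\ steps l1 (T0 + n1%:Z) n2 = s.
        move=> e1 e2; split.
          rewrite (upright_steps u1) // ?e1; last by rewrite T01 nE; lia.
          congr (_ + (ups _)%:Z); rewrite -(@take_steps _ _ n1 n); last by rewrite nE leq_addr.
          by rewrite e2 -sn1 take_size_cat.
        have := congr1 (take n2 \o drop n1) e2; rewrite /= nE drop_steps take_steps ?leq_addr //.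
        by move=> ->; rewrite -{1}sn1 drop_size_cat // -sn take_size_cat.
      split.
        case=> -[q [e1 e2 e3]] e4; have [v1 v2] := val e1 e4.
        have e : l2' = l2.
          have u2n := u2; rewrite T01 in u2' u2n.
          by apply: (upright_inj u2' u2n); rewrite /l2 ?path_of0 // -{2}sn2 steps_path_of.
        by split; [rewrite -e -v1 -v2|].
      case=> q [[e1 e2] e3]; have [v1 v2] := val e1 e3.
      by rewrite v1 v2 e2 e1 /l2 path_of0 -{1}sn2 steps_path_of.
    case: asboolP => q.
      by rewrite mul1r; apply: ens_pr_eq => l1 l2' u1 u2' _; rewrite iff //; tauto.
    rewrite mul0r; apply/eqP; rewrite eq_le ens_pr_ge0 andbT.
    have -> : 0 = ens_pr (fun _ _ => False) by rewrite /ens_pr (_ : [set _ | _] = set0) ?measure0.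
    by apply: ens_pr_le => l1 l2' u1 u2' _; rewrite iff //; tauto.
  rewrite hc // !pathW_cat !ups_cat sn1 sn add0n.
  have -> : pathW (HLw t l2 T0) n1 (a + (ups s1)%:Z) s =
      pathW (HLw t l2 (T0 + n1%:Z)) 0 (a + (ups s1)%:Z) s.
    rewrite -[in LHS](addn0 n1); elim: (s) (0%N) (a + _) => [|b s' IH] i x //=.
    by rewrite HLw_shift -addnS IH.
  by ring.
rewrite !main -sumseqZ; apply: le_sumseq => s1 sn1.
rewrite -sumseqZ; apply: le_sumseq => s3 sn3; rewrite mulrCA.
have hw := HLw_weights t01 l2 T0.
apply: ler_wpM2l; first exact: pathW_ge0 hw.
(* With the outer steps s1 and s3 fixed, the factors outside the window depend on the middle steps
   only through their number of up steps, so the middle sum is a mixture of uniform bridges. *)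
pose hh j := c (ups s1 + (j + ups s3))%N *
  pathW (HLw t l2 T0) (n1 + n2) (a + (ups s1)%:Z + j%:Z) s3.
have hh0 j : 0 <= hh j by rewrite mulr_ge0 //; exact: pathW_ge0 hw.
rewrite !(sumseq_by_ups n2 hh) mulr_sumr; apply: ler_sum => k _.
rewrite [leRHS]mulrCA; apply: ler_wpM2l => //; rewrite [leRHS]mulrCA; apply: ler_wpM2l => //.
by apply: h => //; rewrite -ltnS.
Qed.

End resampling.

(** * The weighted bridge at the diffusive scale *)

Section estimates.
Context {R : realType}.
Implicit Types (m n k j i : nat) (s : seq bool) (x : int).

(** Heights are relative to a line of slope p, and y is the one at the start. The last hypothesis
    puts the chord at time m at least l above v, and falling l below the chord has probability at
    most 1/2. *)
Lemma bridge_above m n k (y v l p : R) : (m <= n)%N -> (k <= n)%N -> (0 < n)%N ->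
  0 <= l -> 8 * n%:R <= l ^+ 2 ->
  v + l <= (1 - m%:R / n%:R) * y + m%:R / n%:R * (y + k%:R - p * n%:R) ->
  2^-1 <= bridgeE (R := R) m n k (fun s => (v <= y + (ups s)%:R - p * m%:R)%R%:R).
Proof.
move=> mn kn n0 l0 nl vl.
have nR : 0 < n%:R :> R by rewrite ltr0n.
have mR : m%:R <= n%:R :> R by rewrite ler_nat.
have t2 : `|-1 : R| <= 1 by rewrite normrN normr1.
have tl := bridge_tail mn kn t2 mR nR l0.
have ex : expR (- (l ^+ 2 / (8 * n%:R))) <= 2^-1 :> R.
  apply: le_trans expRN1_le2V; rewrite ler_expR lerN2 ler_pdivlMr ?mulr_gt0 //.
  by rewrite mul1r.
have {ex}tl := le_trans tl ex.
set b := bridgeE _ _ _ _ in tl; set c := bridgeE _ _ _ _.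
suff : 1 <= c + b by lra.
rewrite -!bridgeED -[leLHS](bridgeE_cst m n k); apply: le_bridgeE => // s _.
case: (leP l (-1 * _)) => h; first by rewrite lerDr.
have -> : v <= y + (ups s)%:R - p * m%:R; last by rewrite addr0.
have e : (1 - m%:R / n%:R) * y + m%:R / n%:R * (y + k%:R - p * n%:R) =
    y + m%:R * k%:R / n%:R - p * m%:R by field; rewrite gt_eqF.
rewrite e in vl; lra.
Qed.

(** From height r0 at a time j <= m, with the right end at least - M, the chord at time m is at
    least rho r0 - M >= v + l, as a fraction rho of the time remains. A uniform bridge is then above
    v with probability at least 1/2, a weighted one at the cost of [qconst t], and [first_passage]
    sums over j. *)
Lemma hit_transfer (t : R) w n m k i x (y p r0 M v l rho : R) :
  0 < t < 1 -> weights t w -> (m < n)%N -> (k <= n)%N ->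
  0 <= l -> 8 * n%:R <= l ^+ 2 -> 0 <= rho -> rho * n%:R <= n%:R - m%:R ->
  0 <= r0 -> 0 <= M -> v + l + M <= rho * r0 ->
  - M <= y + k%:R - p * n%:R ->
  qconst t / 2 * bridgeE n n k (fun s =>
    (has (fun j => r0 <= y + (ups (take j s))%:R - p * j%:R)%R (iota 0 m.+1))%:R *
    pathW w i x s) <=
  bridgeE n n k (fun s => (v <= y + (ups (take m s))%:R - p * m%:R)%R%:R * pathW w i x s).
Proof.
move=> t01 hw mn kn l0 nl rho0 rhon r00 M0 vl yM.
pose A s := r0 <= y + (ups s)%:R - p * (size s)%:R.
pose B s := v <= y + (ups (take m s))%:R - p * m%:R.
have -> : bridgeE n n k (fun s =>
    (has (fun j => r0 <= y + (ups (take j s))%:R - p * j%:R)%R (iota 0 m.+1))%:R *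
    pathW w i x s) =
   bridgeE n n k (fun s => (has (fun j => A (take j s)) (iota 0 m.+1))%:R * pathW w i x s).
  apply: eq_bridgeE => s sn; congr ((nat_of_bool _)%:R * _).
  apply: eq_in_has => j; rewrite mem_iota => /andP[_ jm].
  by rewrite /A size_takel // sn; apply: leq_trans (ltnW mn).
apply: (first_passage t01 hw) => //; first exact: ltnW.
move=> j s jm [sj sk skn]; rewrite /A sj => As.
have nj0 : (0 < n - j)%N by clear -jm mn; lia.
have mj : (m - j <= n - j)%N by apply/leq_sub2r/ltnW.
have jn : (j <= n)%N by apply: leq_trans jm (ltnW mn).
pose BB u := v <= y + (ups s)%:R - p * j%:R + u%:R - p * (m - j)%:R.
apply: le_trans (_ : qconst t * bridgeE (m - j) (n - j) (k - ups s) (fun s' => (BB (ups s'))%:R) *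
    bridgeZ w (n - j) (i + j) (x + (ups s)%:Z) (k - ups s) <= _).
  rewrite -!mulrA ler_wpM2l ?(ltW (qconst_gt0 t)) // ler_wpM2r ?(bridgeZ_ge0 _ _ hw) //.
  apply: (@bridge_above _ _ _ _ _ l p) => //.
    by apply: le_trans nl; rewrite ler_wpM2l // ler_nat leq_subr.
  have nR : 0 < (n - j)%:R :> R by rewrite ltr0n.
  have r1 : rho <= (1 - (m - j)%:R / (n - j)%:R).
    have -> : 1 - (m - j)%:R / (n - j)%:R = (n%:R - m%:R) / (n - j)%:R :> R.
      by rewrite !natrB //; field; rewrite -natrB // gt_eqF.
    rewrite ler_pdivlMr //; apply: le_trans rhon; apply: ler_wpM2l => //.
    by rewrite ler_nat leq_subr.
  have r2 : 0 <= (m - j)%:R / (n - j)%:R :> R by rewrite divr_ge0.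
  have end1 : y + (ups s)%:R - p * j%:R + (k - ups s)%:R - p * (n - j)%:R = y + k%:R - p * n%:R.
    by rewrite !natrB //; ring.
  rewrite end1; set th := (m - j)%:R / _ in r1 r2 *.
  have := ler_pM rho0 r00 r1 As.
  have th1 : th <= 1 by rewrite ler_pdivrMr // mul1r ler_nat.
  have := ler_wpM2l r2 yM; have : th * M <= M by rewrite ler_piMl.
  lra.
apply: le_trans (weighted_domination t01 _ _ hw mj skn _) _.
  by move=> u u' h uu'; apply: le_trans h _; rewrite lerD2r lerD2l ler_nat.
apply: le_bridgeE => // s' _; rewrite ler_wpM2r ?(pathW_ge0 _ _ _ hw) // /BB /B.
have -> : take m (s ++ s') = s ++ take (m - j) s' by rewrite take_cat sj ltnNge jm.
rewrite ups_cat natrD natrB // (_ : y + _ - _ + _ - _ = y + ((ups s)%:R + (ups (take (m - j)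
  s'))%:R) - p * m%:R) //.
by ring.
Qed.

End estimates.

Section reach.
Context {R : realType}.
Implicit Types (m n k j i : nat) (s : seq bool) (x : int).

Lemma chord_bound (e th y z A M : R) : 0 < e -> e <= th -> th <= 1 -> 0 <= M ->
  - M <= y -> 0 <= A -> (1 - th) * y + th * z <= A -> z <= (A + M) / e.
Proof.
move=> e0 eth th1 M0 yM A0 h; rewrite ler_pdivlMr //.
have [z0|z0] := leP z 0; first by apply: (@le_trans _ _ 0); [rewrite mulr_le0_ge0 // ltW|rewrite
  addr_ge0].
have th0 : 0 <= 1 - th by rewrite subr_ge0.
have h1 := ler_wpM2l th0 yM; have h2 := ler_wpM2r (ltW z0) eth.
have h3 : (1 - th) * M <= M by rewrite ler_piMl //; lra.
rewrite mulrN in h1; rewrite [z * e]mulrC; lra.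
Qed.

Lemma cross_ratio_bound (p e N m k C : R) : 0 < p < 1 -> 0 < e -> 0 < N ->
  e * N <= m -> e * N <= N - m ->
  C <= p / 2 * N -> C <= (1 - p) / 2 * N ->
  - C <= k - p * N -> k - p * N <= C ->
  e ^+ 2 * (p * (1 - p) / 4) * N ^+ 4 <= m * (N - m) * (k * (N - k)).
Proof.
move=> /andP[p0 p1] e0 N0 h1 h2 C1 C2 k1 k2.
have -> : e ^+ 2 * (p * (1 - p) / 4) * N ^+ 4 =
  (e * N) * (e * N) * ((p / 2 * N) * ((1 - p) / 2 * N)) by field.
have g0 : 0 <= e * N by rewrite mulr_ge0 // ltW.
have g3 : 0 <= p / 2 * N by rewrite mulr_ge0 ?divr_ge0 ?ltW.
have g4 : 0 <= (1 - p) / 2 * N by rewrite mulr_ge0 ?divr_ge0 ?subr_ge0 ?ltW.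
have kk1 : p / 2 * N <= k by lra.
have kk2 : (1 - p) / 2 * N <= N - k by lra.
exact: ler_pM (mulr_ge0 g0 g0) (mulr_ge0 g3 g4) (ler_pM g0 g0 h1 h2) (ler_pM g3 g4 kk1 kk2).
Qed.

(** [bridge_tail_lower] in diffusive units. As D <= C3 sg and n >= 2 ka sg^2, the exponent 6 D^2 /
    (c n) is at most 3 C3^2 / (c ka), which is free of sg. *)
Lemma bridge_reach_tail m n k (c H0 B sg ka C3 : R) : (m <= n)%N -> (k <= n)%N -> (0 < n)%N ->
  0 < c -> 0 <= H0 -> 0 <= B -> 0 < ka -> 1 <= sg -> n%:R <= (B * sg) ^+ 2 ->
  c * n%:R ^+ 4 <= m%:R * (n%:R - m%:R) * (k%:R * (n%:R - k%:R)) ->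
  H0 + 8 * B + 1 <= C3 -> 7 * C3 <= c * ka * sg -> 2 * (ka * sg ^+ 2) <= n%:R ->
  2^-1 * expR (- (3 * C3 ^+ 2 / (c * ka))) <=
  bridgeE m n k (fun s => (m%:R * k%:R / n%:R + H0 * sg <= (ups s)%:R)%R%:R).
Proof.
move=> mn kn n0 c0 H00 B0 ka0 sg1 nB hc C3l C3u nn.
have sp : 0 < sg by lra.
have n0' : 0 < n%:R :> R by rewrite ltr0n.
pose D := H0 * sg + 8 * (B * sg) + 1.
have D0 : 0 <= D by rewrite !addr_ge0 // ?mulr_ge0 // ltW.
have DC : D <= C3 * sg by have := ler_wpM2r (ltW sp) C3l; rewrite /D; lra.
have nn' : c * (2 * (ka * sg ^+ 2)) <= c * n%:R by rewrite ler_pM2l.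
apply: (@le_trans _ _ (2^-1 * expR (- (6 * D ^+ 2 / (c * n%:R))))); last first.
  apply: bridge_tail_lower => //; try by rewrite mulr_ge0 // ltW.
  have := ler_wpM2r (ltW sp) C3u; rewrite expr2 in nn'; rewrite -/D; lra.
rewrite ler_pM2l ?invr_gt0 // ler_expR lerN2 ler_pdivrMr ?mulr_gt0 //.
apply: (@le_trans _ _ (6 * (C3 * sg) ^+ 2)).
  by rewrite ler_pM2l // lerXn2r ?nnegrE // (le_trans D0).
have -> : 3 * C3 ^+ 2 / (c * ka) * (c * n%:R) = 3 * C3 ^+ 2 / ka * n%:R.
  by field; rewrite !gt_eqF.
have -> : 6 * (C3 * sg) ^+ 2 = 3 * C3 ^+ 2 / ka * (2 * (ka * sg ^+ 2)).
  by field; rewrite gt_eqF.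
by rewrite ler_wpM2l // divr_ge0 ?(ltW ka0) // mulr_ge0 ?sqr_ge0.
Qed.

(* Either the chord is already high, or it stays within the diffusive scale,
   in which case its slope is close to p and the hypergeometric tail applies. *)
Lemma bridge_reach (p ka a M H : R) : 0 < p < 1 -> 0 < ka -> 0 < a -> 0 <= M -> 0 <= H ->
  exists c sg0 : R, [/\ 0 < c, 1 <= sg0 & forall (sg y : R) m n k, sg0 <= sg -> (m <= n)%N -> (k
    <= n)%N ->
    ka * sg ^+ 2 <= m%:R -> ka * sg ^+ 2 <= (n - m)%:R -> n%:R <= a * sg ^+ 2 ->
    - (M * sg) <= y -> - (M * sg) <= y + k%:R - p * n%:R ->
    c <= bridgeE (R := R) m n k (fun s => (H * sg <= y + (ups s)%:R - p * m%:R)%R%:R)].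
Proof.
move=> p01 ka0 a0 M0 H0; have /andP[p0 p1] := p01.
(* [e] bounds m/n and 1 - m/n from below; La and B are chosen for La^2 >= 8 a and B^2 >= a. If the
   chord is low at time m, both ends are at most (H + La + M) sg / e by [chord_bound], whence |k - p
   n| <= C2 sg. *)
pose e := ka / a; pose La := 8 * a + 1; pose B := a + 1.
pose C2 := (H + La + M) / e + M.
pose c := e ^+ 2 * (p * (1 - p) / 4); pose C3 := (H + M) + 8 * B + 1.
have q0 : 0 < 1 - p by rewrite subr_gt0.
have e0 : 0 < e by rewrite divr_gt0.
have c0 : 0 < c by rewrite /c mulr_gt0 ?exprn_gt0 ?divr_gt0 ?mulr_gt0.
have La1 : 1 <= La by rewrite lerDr mulr_ge0 // ltW.
have B0 : 0 <= B by rewrite addr_ge0 // ltW.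
have LaB : 8 * a <= La ^+ 2 /\ a <= B ^+ 2.
  by rewrite /La /B !expr2; have := mulr_ge0 (ltW a0) (ltW a0); split; lra.
have La0 : 0 <= La by apply: le_trans La1.
have C20 : 0 <= C2 by exact: addr_ge0 (divr_ge0 (addr_ge0 (addr_ge0 H0 La0) M0) (ltW e0)) M0.
have C30 : 0 <= C3 by rewrite !addr_ge0 // mulr_ge0.
have d1 : 0 < p * ka by rewrite mulr_gt0.
have d2 : 0 < (1 - p) * ka by rewrite mulr_gt0.
have d3 : 0 < c * ka by rewrite mulr_gt0.
have f1 : 0 <= C2 / (p * ka) by rewrite divr_ge0 // ltW.
have f2 : 0 <= C2 / ((1 - p) * ka) by rewrite divr_ge0 // ltW.
have f3 : 0 <= 7 * C3 / (c * ka) by rewrite divr_ge0 ?(ltW d3) // mulr_ge0.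
(* The terms of the threshold make C2 sg at most p n / 2 and (1 - p) n / 2, so that the bridge has
   many steps of both kinds, and make the shift C3 sg admissible in [bridge_reach_tail]. *)
exists (2^-1 * expR (- (3 * C3 ^+ 2 / (c * ka)))),
  (1 + C2 / (p * ka) + C2 / ((1 - p) * ka) + 7 * C3 / (c * ka)); split.
- by rewrite mulr_gt0 ?expR_gt0.
- by rewrite -!addrA lerDl !addr_ge0.
move=> sg y m n k sgl mn kn mk nmk nsg yM yM'.
have [sg1 g1 g2 g3] : [/\ 1 <= sg, C2 / (p * ka) <= sg,
    C2 / ((1 - p) * ka) <= sg & 7 * C3 / (c * ka) <= sg].
  move: f1 f2 f3 sgl.
  move: (C2 / (p * ka)) (C2 / ((1 - p) * ka)) (7 * C3 / (c * ka)) => x1 x2 x3.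
  by clear; move=> *; split; lra.
have sp : 0 < sg by apply: lt_le_trans sg1.
rewrite !ler_pdivrMr // in g1 g2 g3.
have s20 : 0 < sg ^+ 2 by rewrite exprn_gt0.
have m0 : 0 < m%:R :> R by apply: lt_le_trans mk; rewrite mulr_gt0.
have n0 : 0 < n%:R :> R by apply: lt_le_trans m0 _; rewrite ler_nat.
have n0' : (0 < n)%N by rewrite -(ltr0n R).
have nmE : (n - m)%:R = n%:R - m%:R :> R by rewrite natrB.
rewrite nmE in nmk.
have nn : 2 * (ka * sg ^+ 2) <= n%:R by clear -mk nmk; lra.
pose th : R := m%:R / n%:R.
have en : e * n%:R <= ka * sg ^+ 2.
  rewrite /e mulrAC ler_pdivrMr // -mulrA ler_pM2l //; clear -nsg; lra.
have eth : e <= th by rewrite ler_pdivlMr // (le_trans en).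
have eth' : e <= 1 - th.
  have -> : 1 - th = (n%:R - m%:R) / n%:R by rewrite /th; field; rewrite gt_eqF.
  by rewrite ler_pdivlMr // (le_trans en).
have th1 : th <= 1 by clear -eth' e0; lra.
have th1' : 1 - th <= 1 by clear -eth e0; lra.
have Msg : 0 <= M * sg by rewrite mulr_ge0 // ltW.
have HLsg : 0 <= H * sg + La * sg.
  by rewrite -mulrDl; exact: mulr_ge0 (addr_ge0 H0 La0) (ltW sp).
have [big|small] := leP (H * sg + La * sg) ((1 - th) * y + th * (y + k%:R - p * n%:R)).
  apply: (@le_trans _ _ (2^-1)).
    rewrite ler_piMr // ?invr_ge0 // expR_le1 oppr_le0 divr_ge0 ?(ltW d3) // mulr_ge0 ?sqr_ge0 //.
  apply: (bridge_above (l := La * sg) (p := p)) => //.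
    exact: mulr_ge0 La0 (ltW sp).
  apply: (@le_trans _ _ (8 * a * sg ^+ 2)); first by clear -nsg; lra.
  by rewrite exprMn ler_wpM2r ?(ltW s20) //; case: LaB.
set z := y + k%:R - p * n%:R in yM' small *.
have zC := chord_bound e0 eth th1 Msg yM HLsg (ltW small).
have yC : y <= (H * sg + La * sg + M * sg) / e.
  apply: (chord_bound e0 eth' th1' Msg yM' HLsg); apply: le_trans (ltW small).
  by clear; lra.
have CE : (H * sg + La * sg + M * sg) / e + M * sg = C2 * sg.
  by rewrite /C2; field; rewrite gt_eqF.
have kp1 : k%:R - p * n%:R <= C2 * sg by rewrite -CE; rewrite /z in zC; clear -zC yM; lra.
have kp2 : - (C2 * sg) <= k%:R - p * n%:R by rewrite -CE; rewrite /z in yM'; clear -yC yM'; lra.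
have hc : c * n%:R ^+ 4 <= m%:R * (n%:R - m%:R) * (k%:R * (n%:R - k%:R)).
  apply: (cross_ratio_bound p01 e0 n0 _ _ _ _ kp2 kp1).
  - exact: le_trans mk.
  - exact: le_trans nmk.
  - have := ler_wpM2r (ltW sp) g1; have := ler_wpM2l (ltW p0) nn.
    by rewrite expr2; clear; lra.
  - have := ler_wpM2r (ltW sp) g2; have := ler_wpM2l (ltW q0) nn.
    by rewrite expr2; clear; lra.
have HM0 : 0 <= H + M by rewrite addr_ge0.
have nB : n%:R <= (B * sg) ^+ 2.
  by apply: le_trans nsg _; rewrite exprMn ler_wpM2r ?(ltW s20) //; case: LaB.
have g3' : 7 * C3 <= c * ka * sg by rewrite [leRHS]mulrC.
apply: le_trans (bridge_reach_tail mn kn n0' c0 HM0 B0 ka0 sg1 nB hc (lexx C3) g3' nn) _.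
apply: le_bridgeE => // s _; rewrite ler_nat.
case: (leP _ (ups s)%:R) => // h.
have -> // : H * sg <= y + (ups s)%:R - p * m%:R.
have mnM : - (M * sg) <= y + m%:R * k%:R / n%:R - p * m%:R.
  have -> : y + m%:R * k%:R / n%:R - p * m%:R = (1 - th) * y + th * z.
    by rewrite /th /z; field; rewrite gt_eqF.
  have t0 : 0 <= th by apply: le_trans eth; exact: ltW.
  have t1 : 0 <= 1 - th by apply: le_trans eth'; exact: ltW.
  have := ler_wpM2l t1 yM; have := ler_wpM2l t0 yM'; clear; lra.
by move: h mnM; rewrite mulrDl; clear; lra.
Qed.

End reach.

(** * Partition functions of high bridges, and acceptance of the middle weights *)

Section window_estimates.
Context {R : realType}.
Variable t : R.
Hypothesis t01 : 0 < t < 1.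
Implicit Types (m n k j i : nat) (s : seq bool) (x : int) (w : nat -> int -> bool -> R).

Lemma pathW_ge w i x s (e : R) : weights t w -> 0 <= e ->
  (forall j, (j < size s)%N ->
    1 - e <= w (i + j)%N (x + (ups (take j s))%:Z) (nth false s j)) ->
  1 - (size s)%:R * e <= pathW w i x s.
Proof.
move=> hw e0; elim: s i x => [|b s IH] i x h; first by rewrite mul0r subr0.
have h0 := h 0%N isT; rewrite addn0 take0 addr0 /= in h0.
have {}IH : 1 - (size s)%:R * e <= pathW w i.+1 (x + (b : nat)%:Z) s.
  apply: IH => j js; have := h j.+1 js.
  by rewrite /= ups_cons PoszD addrA addnS.
have := pathW_le1 i.+1 (x + (b : nat)%:Z) s hw.
have := weights_le1 hw i x b; rewrite /= -natr1.
set u := w i x b in h0 *; set v := pathW _ _ _ _ in IH *.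
clear -IH h0 => h1 h2.
have : 0 <= (1 - u) * (1 - v) by rewrite mulr_ge0 ?subr_ge0.
by move: IH h0; lra.
Qed.

(** With both ends at least b + 8 l the bridge stays above b with probability at least 1/2, because
    8 exp(-4) <= 8/16. There the n factors, each at least 1 - e, have product at least 1 - n e >=
    1/2. *)
Lemma bridgeZ_high w m n i x k (y p b l e : R) : weights t w -> (0 < m)%N -> n = (2 * m)%N ->
  (k <= n)%N -> 0 <= l -> 32 * m%:R <= l ^+ 2 -> 0 <= e -> n%:R * e <= 2^-1 ->
  b + 8 * l <= y -> b + 8 * l <= y + k%:R - p * n%:R ->
  (forall j u c, (j < n)%N -> b <= y + u%:R - p * j%:R -> 1 - e <= w (i + j)%N (x + u%:Z) c) ->
  4^-1 <= bridgeZ w n i x k.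
Proof.
move=> hw m0 nE kn l0 ml e0 ne hy hz hbw.
have mn2 : (2 * m <= n <= 2 * m + 1)%N by rewrite nE leqnn leq_addr.
have mR : 0 < m%:R :> R by rewrite ltr0n.
have nR : 0 < n%:R :> R by rewrite ltr0n nE muln_gt0.
have ml' : 8 * m%:R <= l ^+ 2 by clear -ml mR; lra.
have := bridge_dev_max m0 mn2 kn l0 ml'.
set E := bridgeE _ _ _ _ => hE.
have E2 : E <= 2^-1.
  apply: le_trans hE _.
  have : expR (- (l ^+ 2 / (8 * m%:R))) <= 16^-1.
    apply: (@le_trans _ _ (expR (- 4%:R))).
      by rewrite ler_expR lerN2 ler_pdivlMr ?mulr_gt0 //; clear -ml; lra.
    have -> : - 4%:R = -1 * 4%:R :> R by rewrite mulN1r.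
    rewrite expRM_natr (_ : 16^-1 = 2^-1 ^+ 4 :> R); last by field.
    by rewrite lerXn2r ?nnegrE ?expR_ge0 ?invr_ge0 // expRN1_le2V.
  by clear; lra.
apply: (@le_trans _ _ (2^-1 * (1 - E))); first by clear -E2; lra.
have -> : 1 - E = bridgeE n n k (fun s =>
    1 + -1 * [exists j : 'I_n.+1, 8 * l <= `|bridge_dev n k j s|]%:R).
  by rewrite bridgeED bridgeE_cst bridgeEZ mulN1r.
rewrite -bridgeEZ; apply: le_bridgeE => // s /prefix_ok_full[sn sk].
case: existsP => [_|nb]; first by rewrite /= mulr1 subrr mulr0 (pathW_ge0 _ _ _ hw).
rewrite /= mulr0 addr0 mulr1; apply: le_trans (pathW_ge hw e0 _); last first.
  move=> j js; rewrite sn in js; apply: hbw => //.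
  have jn : (j < n.+1)%N by rewrite ltnS ltnW.
  have dj : `|bridge_dev n k j s| < 8 * l.
    by rewrite ltNge; apply/negP => h; apply: nb; exists (Ordinal jn).
  have th0 : 0 <= j%:R / n%:R :> R by rewrite divr_ge0.
  have th1 : j%:R / n%:R <= 1 :> R by rewrite ler_pdivrMr // mul1r ler_nat ltnW.
  have e1 : y + (ups (take j s))%:R - p * j%:R =
     (1 - j%:R / n%:R) * y + j%:R / n%:R * (y + k%:R - p * n%:R) + bridge_dev n k j s.
    by rewrite /bridge_dev; field; rewrite gt_eqF.
  rewrite e1; move: dj; rewrite ltr_norml => /andP[dj _].
  have h1 := ler_wpM2l th0 hz.
  have th1' : 0 <= 1 - j%:R / n%:R :> R by rewrite subr_ge0.
  have h2 := ler_wpM2l th1' hy.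
  by move: h1 h2 dj; clear; lra.
by rewrite sn; clear -ne; lra.
Qed.

(** Write t = exp(- b) and z = b sg / 6. Since [truncn sg >= sg / 2] for sg >= 2, the power of t is
    at most exp(- 3 z) <= z^-3, which beats sg^2; 432 is 2 * 6^3. *)
Lemma geometric_small (a : R) : 0 < a -> exists s0 : R, 1 <= s0 /\
  forall sg : R, s0 <= sg -> a * sg ^+ 2 * t ^+ (Num.truncn sg) <= 2^-1.
Proof.
move=> a0; have /andP[t0 t1] := t01.
pose b := - ln t; have b0 : 0 < b by rewrite oppr_gt0 ln_lt0 // t0.
have tE : t = expR (- b) by rewrite opprK lnK.
have h0 : 0 <= 432%:R * a / b ^+ 3.
  exact: divr_ge0 (mulr_ge0 (ler0n _ _) (ltW a0)) (exprn_ge0 3 (ltW b0)).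
exists (2 + 432%:R * a / b ^+ 3); split.
  by rewrite (le_trans _ (lerD (lexx 2) h0)) // addr0 ler1n.
move=> sg hs.
have s2 : 2 <= sg by clear -hs h0; lra.
have s0 : 0 < sg by clear -s2; lra.
have hs' : 432%:R * a / b ^+ 3 <= sg by clear -hs; lra.
rewrite ler_pdivrMr ?exprn_gt0 // in hs'.
have /andP[_ tr] : (Num.truncn sg)%:R <= sg < (Num.truncn sg).+1%:R.
  by apply: truncn_itv; exact: ltW.
have trl : sg / 2 <= (Num.truncn sg)%:R by rewrite -natr1 in tr; clear -tr s2; lra.
pose z := b * sg / 6; have z0 : 0 < z by rewrite divr_gt0 ?mulr_gt0.
have tz : t ^+ Num.truncn sg <= z ^- 3.
  rewrite tE -expRM_natr; apply: (@le_trans _ _ (expR (- z * 3%:R))).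
    have -> : - z * 3%:R = - (b * (sg / 2)) by rewrite /z; field.
    by rewrite ler_expR mulNr lerN2 ler_wpM2l // ltW.
  rewrite mulNr expRN expRM_natr lef_pV2 ?posrE ?exprn_gt0 ?expR_gt0 //.
  rewrite lerXn2r ?nnegrE ?(ltW z0) ?expR_ge0 //; apply: le_trans (expR_ge1Dx z).
  by rewrite lerDr.
apply: le_trans (ler_wpM2l _ tz) _; first by rewrite mulr_ge0 ?sqr_ge0 // ltW.
rewrite ler_pdivrMr ?exprn_gt0 //.
have -> : 2^-1 * z ^+ 3 = (sg * b ^+ 3) * sg ^+ 2 / 432 by rewrite /z; field.
have c432 : 0 < (432%:R : R) by rewrite ltr0n.
by rewrite (ler_pdivlMr _ _ c432) mulrAC [a * _]mulrC ler_wpM2r ?sqr_ge0.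
Qed.

(* Replacing the weights in the middle by 1 multiplies the conditional
   probability of a small middle partition function by its inverse. *)
Lemma acceptance w m1 m2 m3 n k x (J K : nat -> bool) (c0 p1 p2 dl : R) : weights t w ->
  n = (m1 + (m2 + m3))%N -> (k <= n)%N -> 0 < c0 -> 0 < p1 -> 0 < p2 -> 0 <= dl ->
  (forall j j', J j -> (j <= j')%N -> J j') -> (forall j j', K j -> (j <= j')%N -> K j') ->
  (forall j j2, J j -> K (j + j2)%N -> (j2 <= m2)%N -> c0 <= bridgeZ w m2 m1 (x + j%:Z) j2) ->
  p1 <= bridgeE m1 n k (fun s => (J (ups s))%:R) ->
  (forall s, prefix_ok m1 n k s -> J (ups s) ->
     p2 <= bridgeE m2 (n - m1) (k - ups s) (fun s2 => (K (ups s + ups s2)%N)%:R)) ->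
  bridgeE n n k (fun s =>
    (bridgeZ w m2 m1 (x + (ups (take m1 s))%:Z) (ups (take m2 (drop m1 s))) < dl)%R%:R *
    pathW w 0 x s) <=
  dl / (c0 * (qconst t ^+ 2 * p1 * p2)) * bridgeE n n k (pathW w 0 x).
Proof.
move=> hw nE kn c00 p10 p20 dl0 Jup Kup hc hp1 hp2.
(* The constant 1 satisfies all five conditions of [weights], so domination applies to the modified
   weights too. *)
pose w' i x b : R := if (m1 <= i < m1 + m2)%N then 1 else w i x b.
have hw' : weights t w'.
  split=> [i z b|i z b|i z z' b zz'|i z|i z j]; rewrite /w'; case: ifP => // _.
  - exact: weights_ge0 hw _ _ _.
  - exact: weights_le1 hw _ _ _.
  - exact: weights_mono hw _ _ _ _ zz'.
  - exact: weights_up hw _ _.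
  - by rewrite mulr1; have /andP[] := onem_tX t01 j; rewrite lerBlDr lerDl.
  - exact: weights_merge hw _ _ _.
pose Q j1 j2 := bridgeZ w m2 m1 (x + j1%:Z) j2.
have nm1 : (n - m1 = m2 + m3)%N by rewrite nE addKn.
have nm2 : (n - m1 - m2 = m3)%N by rewrite nm1 addKn.
have outer z s i : (forall j, (j < size s)%N -> ~~ (m1 <= i + j < m1 + m2)%N) ->
    pathW w' i z s = pathW w i z s.
  elim: s i z => [//|b s IH] i z h /=; rewrite IH; last first.
    by move=> j js; rewrite addSnnS; apply: h.
  by congr (_ * _); rewrite /w' ifN //; have := h 0%N isT; rewrite addn0.
have middle z s i : (forall j, (j < size s)%N -> (m1 <= i + j < m1 + m2)%N) ->
    pathW w' i z s = 1.
  elim: s i z => [//|b s IH] i z h /=; rewrite IH; last first.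
    by move=> j js; rewrite addSnnS; apply: h.
  by rewrite mulr1 /w' ifT //; have := h 0%N isT; rewrite addn0.
pose Z3 j1 j2 j3 := bridgeZ w m3 (m1 + m2) (x + j1%:Z + j2%:Z) j3.
have split3 v (h : nat -> nat -> R) :
    (forall s z, size s = m1 -> pathW v 0 z s = pathW w 0 z s) ->
    (forall s z, size s = m3 -> pathW v (m1 + m2) z s = pathW w (m1 + m2) z s) ->
    bridgeE n n k (fun s => h (ups (take m1 s)) (ups (take m2 (drop m1 s))) * pathW v 0 x s) =
    bridgeE m1 n k (fun s1 => pathW w 0 x s1 *
      bridgeE m2 (n - m1) (k - ups s1) (fun s2 =>
        h (ups s1) (ups s2) * Z3 (ups s1) (ups s2) (k - ups s1 - ups s2)%N *
        pathW v m1 (x + (ups s1)%:Z) s2)).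
  move=> v1 v3; rewrite [X in bridgeE X]nE bridgeE_cat; apply: eq_bridgeE => s1 s1m.
  rewrite bridgeE_cat -bridgeEZ; apply: eq_bridgeE => s2 s2m; rewrite nm2.
  transitivity (bridgeE m3 m3 (k - ups s1 - ups s2) (fun s3 =>
    (pathW w 0 x s1 * (h (ups s1) (ups s2) * pathW v m1 (x + (ups s1)%:Z) s2)) *
    pathW w (m1 + m2) (x + (ups s1)%:Z + (ups s2)%:Z) s3)).
    apply: eq_bridgeE => s3 s3m; rewrite -{1 2}s1m take_size_cat // drop_size_cat //.
    rewrite -{1}s2m take_size_cat // !pathW_cat v1 // s1m s2m add0n v3 //; ring.
  by rewrite bridgeEZ /Z3 /bridgeZ; ring.
(* Averaging over the middle piece given its two ends replaces its weight by Q, so Q is the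
   unnormalised density of the law with weights w relative to the one with w'. *)
have weighted (h : nat -> nat -> R) :
    bridgeE n n k (fun s => h (ups (take m1 s)) (ups (take m2 (drop m1 s))) * pathW w 0 x s) =
    bridgeE n n k (fun s => (h (ups (take m1 s)) (ups (take m2 (drop m1 s))) *
      Q (ups (take m1 s)) (ups (take m2 (drop m1 s)))) * pathW w' 0 x s).
  rewrite (split3 w) // (split3 w' (fun a b => h a b * Q a b)); first last.
  - by move=> s z sm; apply: outer => j; rewrite sm; clear; lia.
  - by move=> s z sm; apply: outer => j; rewrite sm; clear; lia.
  apply: eq_bridgeE_ok => //; first by rewrite nE leq_addr.
  move=> s1 [sm sk sn]; congr (_ * _).
  rewrite (bridgeE_restr _ (fun j => h (ups s1) j * Z3 (ups s1) j (k - ups s1 - j)%N)) //; last by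
    rewrite nm1 leq_addr.
  apply: eq_bridgeE => s2 s2m; rewrite middle; last by move=> j; rewrite s2m; clear; lia.
  by rewrite -/(bridgeZ _ _ _ _ _) -/(Q _ _); ring.
have q0 := qconst_gt0 t.
have m1n : (m1 <= n)%N by rewrite nE leq_addr.
pose T := bridgeE n n k (pathW w' 0 x).
have T0 : 0 <= T by apply: bridgeE_ge0 => // s _; exact: pathW_ge0 hw'.
have upper : bridgeE n n k (fun s =>
    (bridgeZ w m2 m1 (x + (ups (take m1 s))%:Z) (ups (take m2 (drop m1 s))) < dl)%R%:R *
    pathW w 0 x s) <= dl * T.
  rewrite (weighted (fun a b => (Q a b < dl)%R%:R)) -bridgeEZ.
  apply: le_bridgeE => // s _; apply: ler_wpM2r; first exact: pathW_ge0 hw'.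
  by case: ltP => h; rewrite ?mul0r // mul1r ltW.
have E1 : qconst t * p1 * T <=
    bridgeE n n k (fun s => (J (ups (take m1 s)))%:R * pathW w' 0 x s).
  apply: le_trans (weighted_domination t01 _ _ hw' m1n kn Jup).
  by rewrite ler_wpM2r // ler_wpM2l // ltW.
have E2 : qconst t * p2 * bridgeE n n k (fun s => (J (ups (take m1 s)))%:R * pathW w' 0 x s) <=
    bridgeE n n k (fun s => ((J (ups (take m1 s)))%:R *
      (K (ups (take m1 s) + ups (take m2 (drop m1 s)))%N)%:R) * pathW w' 0 x s).
  rewrite nE !bridgeE_cat -nE -bridgeEZ; apply: le_bridgeE => // s1 os1.
  case: (os1) => sm sk sn.
  rewrite -bridgeEZ.
  rewrite (@eq_bridgeE _ _ _ _ _ (fun s => (J (ups s1))%:R * pathW w' 0 x s1 *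
     (qconst t * p2 * pathW w' m1 (x + (ups s1)%:Z) s))); last first.
    move=> s _; rewrite -{1}sm take_size_cat // pathW_cat sm add0n; ring.
  rewrite [leRHS](@eq_bridgeE _ _ _ _ _ (fun s => (J (ups s1))%:R * pathW w' 0 x s1 *
     ((K (ups s1 + ups (take m2 s))%N)%:R * pathW w' m1 (x + (ups s1)%:Z) s))); last first.
    move=> s _; rewrite -{1 2 3}sm take_size_cat // drop_size_cat // pathW_cat sm add0n; ring.
  rewrite !bridgeEZ; have [Js|nJ] := boolP (J (ups s1)); last by rewrite !mul0r.
  rewrite mul1r; apply: ler_wpM2l; first exact: pathW_ge0 hw'.
  have m2n : (m2 <= m2 + m3)%N by rewrite leq_addr.
  rewrite nm1 in sn.
  have h := @weighted_domination R t t01 w' (m2 + m3) (k - ups s1) m2 m1 (x + (ups s1)%:Z)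
    (fun j => K (ups s1 + j)%N) hw' m2n sn _.
  rewrite nm1; apply: le_trans (h _); last first.
    by move=> j j' Kj jj'; apply: Kup Kj _; rewrite leq_add2l.
  rewrite ler_wpM2r ?(bridgeZ_ge0 _ _ hw') // ler_wpM2l ?(ltW q0) //.
  by have := hp2 s1 os1 Js; rewrite nm1.
(* Where J and K hold, the density Q is at least c0. With E1 and E2, two successive dominations each
   costing [qconst t], this bounds the total mass T of the modified weights by a multiple of the
   true one; [upper] bounds the bad event by dl T. *)
have E3 : c0 * bridgeE n n k (fun s => ((J (ups (take m1 s)))%:R *
      (K (ups (take m1 s) + ups (take m2 (drop m1 s)))%N)%:R) * pathW w' 0 x s) <=
    bridgeE n n k (pathW w 0 x).
  have -> : bridgeE n n k (pathW w 0 x) = bridgeE n n k (fun s =>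
      (1 * Q (ups (take m1 s)) (ups (take m2 (drop m1 s)))) * pathW w' 0 x s).
    rewrite -(weighted (fun _ _ => 1)); apply: eq_bridgeE => s _; by rewrite mul1r.
  rewrite -bridgeEZ; apply: le_bridgeE => // s /prefix_ok_full[sn _].
  rewrite mulrA; apply: ler_wpM2r; first exact: pathW_ge0 hw'.
  have um2 : (ups (take m2 (drop m1 s)) <= m2)%N.
    by apply: leq_trans (ups_size _) _; rewrite size_take_min geq_minl.
  have Q0 : 0 <= Q (ups (take m1 s)) (ups (take m2 (drop m1 s))) by exact: bridgeZ_ge0 hw um2.
  case: (boolP (J _)) => Js; last by rewrite !mul0r mulr0 mul1r.
  case: (boolP (K _)) => Ks; last by rewrite !mulr0 mul1r.
  by rewrite !mulr1 mul1r; exact: hc.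
apply: le_trans upper _; rewrite mulrAC ler_pdivlMr; last by rewrite !mulr_gt0 ?exprn_gt0.
rewrite -[dl * T * _]mulrA ler_wpM2l //; apply: le_trans E3.
rewrite mulrCA ler_pM2l //; apply: le_trans E2.
have -> : T * (qconst t ^+ 2 * p1 * p2) = qconst t * p2 * (qconst t * p1 * T) by ring.
by rewrite ler_wpM2l // mulr_ge0 // ltW.
Qed.

End window_estimates.

(** * Oscillation of a uniform bridge around a line of slope p *)

Section window_oscillation.
Context {R : realType}.
Implicit Types (m n k j i : nat) (s : seq bool).

Definition window_osc (p : R) n m (l : R) s : bool :=
  [exists i : 'I_n.+1, exists j : 'I_n.+1, [&& (i <= j)%N, (j <= i + m)%N &
    l <= `|((ups (take j s))%:R - p * j%:R) - ((ups (take i s))%:R - p * i%:R)|]].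

Lemma expRN_le_quad (x : R) : 0 < x -> expR (- x) <= 2 / x ^+ 2.
Proof.
move=> x0; rewrite expRN -[leRHS]invrK lef_pV2 ?posrE ?expR_gt0 ?invr_gt0 ?divr_gt0 ?exprn_gt0 //.
have := expR_ge1Dxn 1 (ltW x0); rewrite invf_div.
by have -> : (2`!)%:R = 2 :> R by []; move=> h; apply: le_trans h; rewrite lerDr.
Qed.

(** [oscillation] is measured from the chord, whose slope differs from p by O(1/sg); over dl sg^2
    steps this costs at most eta sg / 2. For the rest, the union bound over order 1/dl windows is
    beaten by exp(- c / dl) <= 2 dl^2 / c^2. *)
Lemma window_osc_small (p ka a M eta eps : R) : 0 < ka -> 0 < a -> 0 <= M -> 0 < eta -> 0 < eps ->
  exists dl sg0 : R, [/\ 0 < dl, 1 <= sg0 & forall (sg y : R) n k, sg0 <= sg -> (k <= n)%N ->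
    ka * sg ^+ 2 <= n%:R -> n%:R <= a * sg ^+ 2 ->
    `|y| <= M * sg -> `|y + k%:R - p * n%:R| <= M * sg ->
    bridgeE n n k (fun s =>
      (window_osc p n (Num.truncn (dl * sg ^+ 2)) (eta * sg) s)%:R) <= eps].
Proof.
move=> ka0 a0 M0 eta0 eps0.
(* With l = eta sg / 16 below, 8 l is the remaining eta sg / 2, and l^2 = 16 c sg^2. *)
pose c := eta ^+ 2 / 4096%:R.
have c4 : 0 < (4096%:R : R) by rewrite ltr0n.
have c0 : 0 < c by rewrite divr_gt0 ?exprn_gt0.
pose D := 8 * (2 * a + 1) / c ^+ 2.
have D0 : 0 < D by rewrite divr_gt0 ?exprn_gt0 // mulr_gt0 // addr_gt0 // mulr_gt0.
have M4 : 0 < 4 * M + 1 by rewrite ltr_wpDl // mulr_ge0.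
(* The bounds serve, in order: the count n/m + 1 of windows, 4 m <= n, 16 m <= l^2, the final
   probability dl D <= eps, and the slope error. *)
pose dl := Num.min (Num.min 1 (ka / 4)) (Num.min c (Num.min (eps / D) (eta * ka / (4 * M + 1)))).
have dl0 : 0 < dl.
  rewrite /dl !lt_min ltr01 c0 (divr_gt0 eps0 D0) (divr_gt0 (mulr_gt0 eta0 ka0) M4).
  by rewrite divr_gt0.
have [d1 d2 d3 d4 d5] : [/\ dl <= 1, dl * 4 <= ka, dl <= c, dl * D <= eps & dl * (4 * M + 1) <=
  eta * ka].
  split; rewrite -?ler_pdivlMr // /dl ?ge_min ?lexx ?orbT //.
exists dl, (1 + 2 / dl); split=> //; first by rewrite lerDl divr_ge0 // ltW.
move=> sg y n k hs kn kan na yM zM.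
have id0 : 0 < 2 / dl by rewrite divr_gt0.
have sg1 : 1 <= sg by clear -hs id0; lra.
have sp : 0 < sg by clear -sg1; lra.
have s2 : sg <= sg ^+ 2 by rewrite expr2 ler_peMl // ltW.
have s20 : 0 < sg ^+ 2 by rewrite exprn_gt0.
have dls : 2 <= dl * sg ^+ 2.
  rewrite mulrC -ler_pdivrMr //; apply: le_trans s2; clear -hs; lra.
set m := Num.truncn _.
have /andP[tr1 tr2] : m%:R <= dl * sg ^+ 2 < m.+1%:R.
  by apply: truncn_itv; rewrite mulr_ge0 // ltW.
rewrite -natr1 in tr2.
have mlow : dl * sg ^+ 2 / 2 <= m%:R by clear -tr2 dls; lra.
have mR : 1 <= m%:R :> R by clear -mlow dls; lra.
have m0 : (0 < m)%N by rewrite -(ltr0n R); clear -mR; lra.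
have mR0 : 0 < m%:R :> R by rewrite ltr0n.
have n0 : 0 < n%:R :> R by apply: lt_le_trans kan; rewrite mulr_gt0.
have mn : (4 * m <= n)%N.
  rewrite -(ler_nat R) natrM; apply: le_trans kan.
  have := ler_wpM2r (ltW s20) d2; clear -tr1; lra.
pose l := eta * sg / 16.
have l0 : 0 <= l by rewrite divr_ge0 // mulr_ge0 ?ltW.
have l2 : l ^+ 2 = 16 * c * sg ^+ 2 by rewrite /l /c; field.
have ml : 16 * m%:R <= l ^+ 2.
  rewrite l2 -mulrA ler_pM2l //; apply: le_trans tr1 _.
  by rewrite ler_wpM2r // ltW.
apply: (@le_trans _ _ (bridgeE n n k (fun s => (oscillation n k m (8 * l) s)%:R))).
  apply: le_bridgeE => // s _; rewrite ler_nat.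
  case: (boolP (window_osc _ _ _ _ _)) => // /existsP[i /existsP[j /and3P[ij jm h]]].
  suff -> : oscillation n k m (8 * l) s by [].
  apply/existsP; exists i; apply/existsP; exists j; apply/and3P; split=> //.
  have e1 : (ups (take j s))%:R - p * j%:R - ((ups (take i s))%:R - p * i%:R) =
     (bridge_dev n k j s - bridge_dev n k i s) +
     (k%:R - p * n%:R) / n%:R * (j - i)%N%:R.
    by rewrite natrB // /bridge_dev; field; rewrite gt_eqF.
  rewrite e1 in h; have := le_trans h (ler_normD _ _).
  have kp : `|k%:R - p * n%:R| <= 2 * (M * sg).
    have -> : k%:R - p * n%:R = (y + k%:R - p * n%:R) - y by ring.
    apply: le_trans (ler_normB _ _) _; clear -yM zM; lra.
  have jmR : (j - i)%N%:R <= m%:R :> R by rewrite ler_nat leq_subLR.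
  have sl : `|(k%:R - p * n%:R) / n%:R * (j - i)%N%:R| <= eta * sg / 2.
    rewrite !normrM (ger0_norm (ler0n _ (j - i))) normfV (ger0_norm (ltW n0)).
    rewrite mulrAC ler_pdivrMr //.
    apply: (@le_trans _ _ (2 * (M * sg) * (dl * sg ^+ 2))).
      by apply: ler_pM => //; apply: le_trans jmR tr1.
    apply: (@le_trans _ _ (eta * sg / 2 * (ka * sg ^+ 2))); last first.
      by apply: ler_wpM2l => //; rewrite divr_ge0 // mulr_ge0 ?ltW.
    have -> : 2 * (M * sg) * (dl * sg ^+ 2) = (sg ^+ 3 / 2) * (dl * (4 * M)) by field.
    have -> : eta * sg / 2 * (ka * sg ^+ 2) = (sg ^+ 3 / 2) * (eta * ka) by field.
    apply: ler_wpM2l; first by rewrite divr_ge0 ?exprn_ge0 // ltW.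
    apply: le_trans d5; rewrite ler_wpM2l ?(ltW dl0) //; clear; lra.
  have -> : 8 * l = eta * sg - eta * sg / 2 by rewrite /l; field.
  move: sl; clear; lra.
apply: le_trans (bridge_oscillation m0 mn kn l0 ml) _.
have x0 : 0 < l ^+ 2 / (16 * m%:R) by rewrite l2 !(divr_gt0, mulr_gt0).
have xl : c / dl <= l ^+ 2 / (16 * m%:R).
  have -> : l ^+ 2 / (16 * m%:R) = c * (sg ^+ 2 / m%:R) by rewrite l2; field; rewrite gt_eqF.
  rewrite ler_pM2l // ler_pdivlMr // mulrC ler_pdivrMr // mulrC; exact: tr1.
have ex : expR (- (l ^+ 2 / (16 * m%:R))) <= 2 * dl ^+ 2 / c ^+ 2.
  apply: (@le_trans _ _ (expR (- (c / dl)))); first by rewrite ler_expR lerN2.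
  apply: le_trans (expRN_le_quad _) _; first by rewrite divr_gt0.
  by rewrite le_eqVlt; apply/orP; left; apply/eqP; field; rewrite !gt_eqF.
have nm : n%:R / m%:R + 1 <= (2 * a + 1) / dl.
  rewrite mulrDl lerD //; last by rewrite mul1r -[leLHS]invr1 lef_pV2 ?posrE.
  rewrite ler_pdivrMr //; apply: le_trans na _.
  have -> : 2 * a / dl * m%:R = a * (2 / dl * m%:R) by ring.
  rewrite ler_pM2l // mulrAC ler_pdivlMr //; move: mlow; clear; lra.
apply: (@le_trans _ _ ((2 * a + 1) / dl * (4 * (2 * dl ^+ 2 / c ^+ 2)))).
  have g1 : 0 <= n%:R / m%:R + 1 :> R by rewrite addr_ge0 // divr_ge0.
  have g2 : 0 <= 4 * expR (- (l ^+ 2 / (16 * m%:R))) by rewrite mulr_ge0 ?expR_ge0.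
  by apply: (ler_pM g1 g2 nm); rewrite ler_pM2l.
apply: le_trans d4; rewrite /D le_eqVlt; apply/orP; left; apply/eqP.
by field; rewrite !gt_eqF.
Qed.

End window_oscillation.

(** * The modulus of continuity of the top curve *)

Section modulus.
Context {R : realType}.

Definition centered (p : R) (l : int -> int) (i : int) : R := (l i)%:~R - p * i%:~R.

Lemma centered_steps (p : R) l A B i n j : upright A B l -> A <= i -> i + n%:Z <= B ->
  (j <= n)%N -> centered p l (i + j%:Z) =
  centered p l i + (ups (take j (steps l i n)))%:R - p * j%:R.
Proof.
move=> ul Ai iB jn; rewrite take_steps // /centered (upright_steps ul) //; last by lia.
by rewrite !intrD /= -!pmulrn; ring.
Qed.

Lemma pathW_shift (t : R) l A m i z s :
  pathW (HLw t l A) (m + i) z s = pathW (HLw t l (A + m%:Z)) i z s.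
Proof. by elim: s i z => [//|b s IH] i z /=; rewrite HLw_shift -addnS IH. Qed.

Section union.
Context d {Om : measurableType d} {T0 T1 : int}.
Variables (L : simple_ensemble Om T0 T1) (P : probability Om R).

Lemma ens_pr_union (Q Q1 Q2 : (int -> int) -> (int -> int) -> Prop) (a b : R) :
  (forall l1 l2, upright T0 T1 l1 -> upright T0 T1 l2 ->
    (forall i, T0 <= i <= T1 -> l2 i <= l1 i) -> Q l1 l2 -> Q1 l1 l2 \/ Q2 l1 l2) ->
  ens_pr L P Q1 <= a -> ens_pr L P Q2 <= b -> ens_pr L P Q <= a + b.
Proof.
move=> h h1 h2; rewrite (ens_pr_split L P Q Q1).
apply: lerD; [apply: le_trans h1|apply: le_trans h2]; apply: ens_pr_le => l1 l2 u1 u2 l12.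
  by case.
by case=> q n1; case: (h l1 l2 u1 u2 l12 q).
Qed.

Lemma ens_pr_le1 (Q : (int -> int) -> (int -> int) -> Prop) : ens_pr L P Q <= 1.
Proof. by rewrite -lee_fin -ens_prE; apply: probability_le1; exact: ens_meas. Qed.

End union.

(* Four of the seven eps are for the values at the four points, the others for
   a large maximum (R0 sg), for a small partition function (less than ac), and
   for the oscillation of a bridge whose partition function is at least ac. *)
Lemma modulus_bound (t p r eps eta M M' : R) : 0 < t < 1 -> 0 < p < 1 -> 0 < r ->
  0 < eps -> 0 < eta -> 0 <= M -> 0 <= M' ->
  exists dl sg0 : R, [/\ 0 < dl, 1 <= sg0 & forall (d : measure_display)
    (Om : measurableType d) (T : nat) (L : simple_ensemble Om (- T%:Z) T%:Z)
    (P : probability Om R) (sg : R) (m1 m2 : nat), sg0 <= sg ->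
    m1 = (Num.truncn (r * sg ^+ 2)).+1 -> m2 = Num.truncn ((r + 1) * sg ^+ 2) ->
    (m2 <= T)%N -> HL_Gibbs L P t `[(- T%:Z + 1), T%:Z]%classic ->
    ens_pr L P (fun l _ => M * sg < `|centered p l (- m1%:Z)|) <= eps ->
    ens_pr L P (fun l _ => M * sg < `|centered p l m1%:Z|) <= eps ->
    ens_pr L P (fun l _ => centered p l (- m2%:Z) < - (M * sg)) <= eps ->
    ens_pr L P (fun l _ => centered p l m2%:Z < - (M * sg)) <= eps ->
    ens_pr L P (fun l _ => M' * sg <= centered p l m1%:Z) <= eps * (qconst t / 2) ->
    ens_pr L P (fun l _ => window_osc p (2 * m1) (Num.truncn (dl * sg ^+ 2)) (eta * sg)
       (steps l (- m1%:Z) (2 * m1))) <= 7 * eps].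
Proof.
move=> t01 p01 r0 eps0 eta0 M0 M'0.
(* The side pieces have length at least sg^2 / 2 and the middle window at least 2 r sg^2, so ka sg^2
   and a sg^2 bound all lengths that occur. *)
pose a := 2 * (r + 1); pose ka := Num.min 2^-1 (2 * r).
have a0 : 0 < a by rewrite mulr_gt0 // addr_gt0.
have ka0 : 0 < ka by rewrite lt_min invr_gt0 ltr0n mulr_gt0.
have ka2 : ka <= 2^-1 by rewrite ge_min lexx.
have kar : ka <= 2 * r by rewrite ge_min lexx orbT.
pose La := 16 * a + 1.
have La1 : 1 <= La by rewrite lerDr mulr_ge0 // ltW.
have La0 : 0 <= La by exact: le_trans La1.
have La2 : 16 * a <= La ^+ 2.
  by have := mulr_ge0 (ltW a0) (ltW a0); rewrite /La expr2; clear -a0; lra.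
(* A lower bound for (m2 - m1) / (2 m2), the fraction of time left after m1. R0 solves rho R0 = M' +
   La + M, as [hit_transfer] requires. *)
pose rho := (4 * (r + 1))^-1.
have rho0 : 0 < rho by rewrite invr_gt0 mulr_gt0 // addr_gt0.
pose R0 := (M' + La + M) / rho.
have R00 : 0 <= R0 by exact: divr_ge0 (addr_ge0 (addr_ge0 M'0 La0) M0) (ltW rho0).
(* R0 sg bounds the bottom path, one more sg is the gap that makes the factors at least 1 -
   t^(truncn sg), and 8 La sg is the room for fluctuations in [bridgeZ_high]. *)
pose H := R0 + 1 + 8 * La.
have H0 : 0 <= H by apply: addr_ge0; [apply: addr_ge0|apply: mulr_ge0].
have [c [s1 [c0 s11 reach]]] := bridge_reach p01 ka0 a0 M0 H0.
have [s2 [s21 geo]] := geometric_small t01 a0.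
have q0 := qconst_gt0 t.
pose C := 4^-1 * (qconst t ^+ 2 * c * c).
have C0 : 0 < C by rewrite !mulr_gt0 ?exprn_gt0 ?invr_gt0.
(* C collects the losses of [acceptance]: 1/4 from [bridgeZ_high], two dominations, and two
   applications of [reach]. The bad event then has probability at most ac / C = eps. *)
pose ac := eps * C; have ac0 : 0 < ac by rewrite mulr_gt0.
have [dl [s3 [dl0 s31 osc]]] := @window_osc_small R p ka a M eta (eps * ac) ka0 a0 M0 eta0
  (mulr_gt0 eps0 ac0).
exists dl, (2 + s1 + s2 + s3); split=> //; first by clear -s11 s21 s31; lra.
move=> d Om T L P sg m1 m2 hs m1E m2E m2T gibbs hm1 hp1 hm2 hp2 htest.
have [sg2 hs1 hs2 hs3] : [/\ 2 <= sg, s1 <= sg, s2 <= sg & s3 <= sg].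
  by clear -s11 s21 s31 hs; split; lra.
have sp : 0 < sg by apply: lt_le_trans sg2.
have s20 : 0 < sg ^+ 2 by rewrite exprn_gt0.
have s24 : 4 <= sg ^+ 2 by rewrite expr2; clear -sg2; nra.
(* m1 is rounded up so that the middle window contains [- r sg^2, r sg^2]; m2 is rounded down so
   that the outer one stays within (r + 1) sg^2. *)
have /andP[tr1 tr2] : (Num.truncn (r * sg ^+ 2))%:R <= r * sg ^+ 2 < m1%:R.
  by rewrite m1E; apply: truncn_itv; rewrite mulr_ge0 // ltW.
have /andP[tr3 tr4] : m2%:R <= (r + 1) * sg ^+ 2 < m2.+1%:R.
  by rewrite m2E; apply: truncn_itv; rewrite mulr_ge0 ?addr_ge0 // ltW.
have m1u : m1%:R <= r * sg ^+ 2 + 1 by rewrite m1E -natr1 lerD2r.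
rewrite -natr1 in tr4.
have gap : sg ^+ 2 / 2 <= m2%:R - m1%:R by clear -m1u tr4 s24; lra.
have m12 : (m1 < m2)%N by rewrite -(ltr_nat R); clear -gap s24; lra.
have m1pos : (0 < m1)%N by rewrite m1E.
pose m3 := (m2 - m1)%N; pose n := (2 * m2)%N.
have m3R : m3%:R = m2%:R - m1%:R :> R by rewrite natrB // ltnW.
have nR : n%:R = 2 * m2%:R :> R by rewrite natrM.
have nE : n = (m3 + (2 * m1 + m3))%N by rewrite /n /m3; clear -m12; lia.
have kasg : ka * sg ^+ 2 <= sg ^+ 2 / 2 by rewrite mulrC ler_pM2l.
have m3ka : ka * sg ^+ 2 <= m3%:R by rewrite m3R (le_trans kasg).
have m1ka : ka * sg ^+ 2 <= (2 * m1)%:R.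
  have := ler_wpM2r (ltW s20) kar; rewrite natrM; move: tr2; clear; lra.
have na : n%:R <= a * sg ^+ 2 by rewrite nR /a; move: tr3; clear; lra.
have m1a : (2 * m1)%:R <= a * sg ^+ 2.
  by rewrite natrM /a; move: m1u s24; clear; lra.
pose A : int := - m2%:Z.
have AE : - T%:Z + (T - m2)%N%:Z = A by rewrite /A; clear -m2T; lia.
have A'E : A + m3%:Z = - m1%:Z by rewrite /A /m3; clear -m12; lia.
have l2La : 16 * (a * sg ^+ 2) <= (La * sg) ^+ 2.
  by rewrite exprMn mulrA ler_wpM2r // ltW.
have Lasg : 0 <= La * sg by rewrite mulr_ge0 // ltW.
have T01 : T%:Z = - T%:Z + (2 * T)%N%:Z by clear; lia.
pose hit l := has (fun j => R0 * sg <= centered p l (A + j%:Z)) (iota 0 (m2 + m1).+1).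
have ul_dev l i j : upright (- T%:Z) T%:Z l -> (j <= n)%N -> i = A + j%:Z ->
    centered p l i = centered p l A + (ups (take j (steps l A n)))%:R - p * j%:R.
  by move=> ul jn ->; apply: (centered_steps _ ul) => //; rewrite /A /n; clear -m2T; lia.
have nT : (2 * T)%N = ((T - m2) + (n + (T - m2)))%N by rewrite /n; clear -m2T; lia.
have mm : (m2 + m1 < n)%N by rewrite /n; clear -m12; lia.
(* Hitting R0 sg is compared with being above M' sg at m1, which [htest] makes rare. F includes the
   condition at m2 because the chord argument needs a right end that is not too low. *)
have step1 : ens_pr L P (fun l _ => hit l /\ - (M * sg) <= centered p l m2%:Z) <= eps.
  pose y x : R := x%:~R - p * A%:~R.
  pose F (l2 : int -> int) x s := has (fun j => R0 * sg <= y x + (ups (take j s))%:R - p * j%:R)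
    (iota 0 (m2 + m1).+1)
     /\ - (M * sg) <= y x + (ups s)%:R - p * n%:R.
  pose G (l2 : int -> int) x s : Prop := M' * sg <= y x + (ups (take (m2 + m1) s))%:R - p * (m2 +
    m1)%:R.
  have := @resampling R d Om _ _ L P t t01 (2 * T) T01 gibbs (T - m2) n (T - m2) F G (2 / qconst
    t) nT.
  rewrite AE => res.
  apply: le_trans (_ : ens_pr L P (fun l1 l2 => F l2 (l1 A) (steps l1 A n)) <= _).
    apply: ens_pr_le => l1 l2 u1 _ _ [h1 h2]; split.
      move: h1 => /hasP[j jm h]; apply/hasP; exists j => //.
      rewrite -(ul_dev l1 (A + j%:Z)) //; apply: leq_trans (ltnW mm).
      by move: jm; rewrite mem_iota add0n ltnS.
    have := ul_dev l1 m2%:Z n u1 (leqnn n); rewrite take_oversize ?size_steps // => <- //.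
    by rewrite /A /n; clear; lia.
  apply: le_trans (res _) _.
    move=> l2 x k u2 kn.
    have [lo|lo] := leP (- (M * sg)) (y x + k%:R - p * n%:R); last first.
      rewrite (@eq_bridgeE_ok _ _ _ _ _ (fun=> 0)) //.
        rewrite bridgeE_cst mulr_ge0 ?divr_ge0 ?(ltW q0) //; apply: bridgeE_ge0 => // s _.
        by rewrite mulr_ge0 // (pathW_ge0 _ _ _ (HLw_weights t01 _ _)).
      move=> s /prefix_ok_full[_ sk]; rewrite asboolF ?mul0r //; case=> _.
      by rewrite sk leNgt lo.
    have := @hit_transfer R t (HLw t l2 A) n (m2 + m1) k 0 x (y x) p (R0 * sg) (M * sg) (M' * sg)
      (La * sg) rho
      t01 (HLw_weights t01 _ _) mm kn Lasg.
    have h1 : 8 * n%:R <= (La * sg) ^+ 2 by move: l2La na (ler0n R n); clear; lra.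
    have h2 : rho * n%:R <= n%:R - (m2 + m1)%:R.
      rewrite natrD nR /rho mulrC ler_pdivrMr ?mulr_gt0 ?addr_gt0 //.
      have rr : 0 <= r + 1 by rewrite addr_ge0 // ltW.
      have := ler_wpM2l rr gap; move: tr3; clear; lra.
    have h3 : M' * sg + La * sg + M * sg <= rho * (R0 * sg).
      rewrite mulrA [rho * _]mulrC /R0 divfK ?gt_eqF //.
      by rewrite !mulrDl.
    move=> /(_ h1 (ltW rho0) h2 (mulr_ge0 R00 (ltW sp)) (mulr_ge0 M0 (ltW sp)) h3 lo) h.
    rewrite -ler_pdivrMl ?divr_gt0 // invf_div; apply: le_trans (le_trans h _); last first.
      apply: le_bridgeE => // s _; rewrite ler_wpM2r ?(pathW_ge0 _ _ _ (HLw_weights t01 _ _)) //.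
      by rewrite ler_nat; case: (leP (M' * sg)) => // hh; rewrite asboolT.
    rewrite ler_pM2l ?divr_gt0 //; apply: le_bridgeE => // s _.
    rewrite ler_wpM2r ?(pathW_ge0 _ _ _ (HLw_weights t01 _ _)) // ler_nat.
    by case: asboolP => // -[-> _].
  rewrite -ler_pdivlMl ?divr_gt0 // invf_div mulrC; apply: le_trans htest.
  apply: ens_pr_le => l1 l2 u1 _ _; rewrite /G /y -/(centered p l1 A).
  rewrite -(ul_dev l1 m1%:Z) //; first exact: ltnW.
  by rewrite /A; clear; lia.
pose w2 (l2 : int -> int) := HLw t l2 (- m1%:Z).
pose small l1 l2 := bridgeZ (w2 l2) (2 * m1) 0 (l1 (- m1%:Z)) (ups (steps l1 (- m1%:Z) (2 * m1)))
  < ac.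
have shiftZ l2 z j : bridgeZ (HLw t l2 A) (2 * m1) m3 z j = bridgeZ (w2 l2) (2 * m1) 0 z j.
  apply: eq_bridgeE => s _; by rewrite -[in LHS](addn0 m3) pathW_shift A'E.
(* As L2 <= L1, the negation of [hit] bounds L2 by R0 sg on the middle window. F keeps only this
   bound on l2, which is left untouched when L1 is resampled. *)
have step2 : ens_pr L P (fun l1 l2 => [/\ ~~ hit l1, - (M * sg) <= centered p l1 (- m2%:Z),
    - (M * sg) <= centered p l1 m2%:Z & small l1 l2]) <= eps.
  pose y x : R := x%:~R - p * A%:~R.
  pose F (l2 : int -> int) x s := [/\ (forall j, (j <= 2 * m1)%N -> centered p l2 (A + m3%:Z +
    j%:Z) <= R0 * sg),
    - (M * sg) <= y x, - (M * sg) <= y x + (ups s)%:R - p * n%:R &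
    bridgeZ (HLw t l2 A) (2 * m1) m3 (x + (ups (take m3 s))%:Z) (ups (take (2 * m1) (drop m3 s)))
      < ac].
  have := @resampling R d Om _ _ L P t t01 (2 * T) T01 gibbs (T - m2) n (T - m2) F (fun _ _ _ =>
    True) eps nT.
  rewrite AE => res.
  apply: le_trans (_ : ens_pr L P (fun l1 l2 => F l2 (l1 A) (steps l1 A n)) <= _).
    apply: ens_pr_le => l1 l2 u1 u2 l12 [h1 h2 h3 h4]; split=> //.
    - move=> j jm; rewrite leNgt; apply/negP => h; move/negP: h1; apply.
      apply/hasP; exists (m3 + j)%N.
        by rewrite mem_iota add0n ltnS /m3 /=; clear -jm m12; lia.
      rewrite PoszD addrA; apply: le_trans (ltW h) _; rewrite /centered lerD2r ler_int; apply: l12.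
      by rewrite A'E; clear -jm m12 m2T; lia.
    - have := ul_dev l1 m2%:Z n u1 (leqnn n); rewrite take_oversize ?size_steps // => <- //.
      by rewrite /A /n; clear; lia.
    rewrite take_steps; last by rewrite nE leq_addr.
    rewrite nE drop_steps take_steps ?leq_addr // A'E.
    rewrite -(upright_steps u1) ?A'E; [|by rewrite /A; clear -m2T; lia|by clear -m12 m2T; lia].
    by rewrite shiftZ.
  apply: le_trans (res _) _; last first.
    by rewrite ler_piMr ?(ltW eps0) // ens_pr_le1.
  move=> l2 x k u2 kn.
  have hw := HLw_weights t01 l2 A.
  pose cond := [/\ (forall j, (j <= 2 * m1)%N -> centered p l2 (A + m3%:Z + j%:Z) <= R0 * sg),
    - (M * sg) <= y x & - (M * sg) <= y x + k%:R - p * n%:R].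
  have [[c1 c2 c3]|nc] := pselect cond; last first.
    rewrite (@eq_bridgeE_ok _ _ _ _ _ (fun=> 0)) //.
      rewrite bridgeE_cst mulr_ge0 ?(ltW eps0) //; apply: bridgeE_ge0 => // s _.
      by rewrite mulr_ge0 // (pathW_ge0 _ _ _ hw).
    move=> s /prefix_ok_full[_ sk]; rewrite asboolF ?mul0r // => -[g1 g2 g3 _].
    by apply: nc; split=> //; rewrite -sk.
  pose J j := H * sg <= y x + j%:R - p * m3%:R.
  pose K j := H * sg <= y x + j%:R - p * (m3 + 2 * m1)%:R.
  have acc := @acceptance R t t01 (HLw t l2 A) m3 (2 * m1) m3 n k x J K 4^-1 c c ac hw nE kn _ c0
    c0 (ltW ac0).
  have {}acc := acc _ _ _ _ _ _.
  apply: le_trans (_ : bridgeE n n k (fun s =>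
    (bridgeZ (HLw t l2 A) (2 * m1) m3 (x + (ups (take m3 s))%:Z) (ups (take (2 * m1) (drop m3 s)))
      < ac)%R%:R *
    pathW (HLw t l2 A) 0 x s) <= _).
    apply: le_bridgeE => // s _; rewrite ler_wpM2r ?(pathW_ge0 _ _ _ hw) // ler_nat.
    by case: asboolP => // -[_ _ _ ->].
  apply: le_trans (acc _ _ _ _ _ _) _.
  - by rewrite invr_gt0.
  - by move=> j j' h jj'; apply: le_trans h _; rewrite lerD2r lerD2l ler_nat.
  - by move=> j j' h jj'; apply: le_trans h _; rewrite lerD2r lerD2l ler_nat.
  - move=> j j2 Jj Kj j2m.
    apply: (@bridgeZ_high R t (HLw t l2 A) m1 (2 * m1) m3 (x + j%:Z) j2
      (y x + j%:R - p * m3%:R) p (R0 * sg + sg) (La * sg) (t ^+ Num.truncn sg)) => //.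
    + move: l2La m1a; rewrite natrM; clear -s20; lra.
    + by case/andP: t01 => t0 _; rewrite exprn_ge0 // ltW.
    + apply: le_trans (geo sg hs2); rewrite ler_wpM2r //.
      by case/andP: t01 => t0 _; rewrite exprn_ge0 // ltW.
    + by move: Jj; rewrite /J /H; clear; lra.
    + by move: Kj; rewrite /K /H [(j + _)%:R]natrD [(m3 + _)%:R]natrD; clear; lra.
    move=> i u b im hb.
    have gapi : sg <= (x + j%:Z + u%:Z - l2 (A + (m3 + i)%N%:Z))%:~R.
      have := c1 i (ltnW im); rewrite -addrA -PoszD /centered => h.
      move: hb h; rewrite /y !(intrD, intrN, rmorphB) /= !PoszD !intrD -!pmulrn; clear; lra.
    have gz : 0 <= x + j%:Z + u%:Z - l2 (A + (m3 + i)%N%:Z).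
      by rewrite -(ler0z R); apply: le_trans gapi; rewrite ltW.
    rewrite /HLw ltNge gz /=; case: b; first by rewrite lerBlDr lerDl exprn_ge0 //; case/andP: t01
      => /ltW.
    rewrite lerD2l lerN2.
    have tt : t ^+ absz (x + j%:Z + u%:Z - l2 (A + (m3 + i)%N%:Z))%R <= t ^+ Num.truncn sg.
      case/andP: t01 => t0 t1; apply: ler_wiXn2l; rewrite ?ltW //.
      rewrite -(ler_nat R); have /andP[tr _] := truncn_itv (ltW sp).
      by apply: le_trans tr _; rewrite natr_absz ger0_norm.
    apply: le_trans tt; rewrite ler_piMl ?exprn_ge0 //; last by case: (_ == 1).
    by case/andP: t01 => /ltW.
  - apply: (reach sg) => //; first by rewrite nE leq_addr.
    by rewrite nE addKn natrD (le_trans m3ka) // lerDr.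
  - move=> s [sm sk sn] Js.
    have e1 : y x + (ups s)%:R - p * m3%:R + (k - ups s)%N%:R - p * (n - m3)%N%:R = y x + k%:R - p
      * n%:R.
      have m3n : (m3 <= n)%N by rewrite nE leq_addr.
      by rewrite (natrB _ sk) (natrB _ m3n); ring.
    apply: le_trans (reach sg (y x + (ups s)%:R - p * m3%:R) (2 * m1)%N (n - m3)%N (k - ups s)%N
      hs1 _ sn m1ka _ _ _ _) _.
    + by rewrite nE addKn leq_addr.
    + by rewrite nE addKn addKn.
    + by apply: le_trans na; rewrite ler_nat leq_subr.
    + by apply: le_trans Js; rewrite (@le_trans _ _ 0) ?oppr_le0 // mulr_ge0 // ltW.
    + by rewrite e1.
    apply: le_bridgeE => //; first by rewrite nE addKn leq_addr.
    move=> s' _; rewrite ler_nat /K [(ups s + _)%:R]natrD [(m3 + _)%:R]natrD.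
    by case: leP => // h; case: leP => //; move: h; clear; lra.
  have -> : ac / (4^-1 * (qconst t ^+ 2 * c * c)) = eps by rewrite /ac mulfK // gt_eqF.
  rewrite ler_pM2l //; apply: le_bridgeE => // s _.
  by rewrite asboolT // mul1r.
have step3 : ens_pr L P (fun l1 l2 => [/\ ~ small l1 l2, `|centered p l1 (- m1%:Z)| <= M * sg,
    `|centered p l1 m1%:Z| <= M * sg &
    window_osc p (2 * m1) (Num.truncn (dl * sg ^+ 2)) (eta * sg)
       (steps l1 (- m1%:Z) (2 * m1))]) <= eps.
  have AE' : - T%:Z + (T - m1)%N%:Z = - m1%:Z by clear -m2T m12; lia.
  have nT' : (2 * T)%N = ((T - m1) + (2 * m1 + (T - m1)))%N by clear -m2T m12; lia.
  pose y x : R := x%:~R - p * (- m1%:Z)%:~R.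
  pose F (l2 : int -> int) x s := [/\ ac <= bridgeZ (w2 l2) (2 * m1) 0 x (ups s), `|y x| <= M * sg,
    `|y x + (ups s)%:R - p * (2 * m1)%:R| <= M * sg &
    window_osc p (2 * m1) (Num.truncn (dl * sg ^+ 2)) (eta * sg) s].
  have := @resampling R d Om _ _ L P t t01 (2 * T) T01 gibbs (T - m1) (2 * m1) (T - m1) F (fun _ _
    _ => True) eps nT'.
  rewrite AE' => res.
  apply: le_trans (_ : ens_pr L P (fun l1 l2 => F l2 (l1 (- m1%:Z)) (steps l1 (- m1%:Z) (2 * m1)))
    <= _).
    apply: ens_pr_le => l1 l2 u1 u2 l12 [h1 h2 h3 h4]; split=> //.
      by rewrite leNgt; apply/negP.
    have := @centered_steps p l1 _ _ (- m1%:Z) (2 * m1) (2 * m1) u1.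
    rewrite take_oversize ?size_steps // (_ : - m1%:Z + (2 * m1)%N%:Z = m1%:Z); last by clear; lia.
    by move=> <- //; clear -m12 m2T; lia.
  apply: le_trans (res _) _; last first.
    by rewrite ler_piMr ?(ltW eps0) // ens_pr_le1.
  move=> l2 x k u2 kn.
  have hw : weights t (w2 l2) := HLw_weights t01 l2 _.
  pose cond := [/\ ac <= bridgeZ (w2 l2) (2 * m1) 0 x k, `|y x| <= M * sg &
    `|y x + k%:R - p * (2 * m1)%:R| <= M * sg].
  have [[c1 c2 c3]|nc] := pselect cond; last first.
    rewrite (@eq_bridgeE_ok _ _ _ _ _ (fun=> 0)) //.
      rewrite bridgeE_cst mulr_ge0 ?(ltW eps0) //; apply: bridgeE_ge0 => // s _.
      by rewrite mulr_ge0 // (pathW_ge0 _ _ _ hw).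
    move=> s /prefix_ok_full[_ sk]; rewrite asboolF ?mul0r // => -[g1 g2 g3 _].
    by apply: nc; split=> //; rewrite -sk.
  (* The weight, at most 1, is dropped on the left; on the right the partition function is at least
     ac. This is why [osc] was obtained for eps * ac. *)
  apply: le_trans (_ : bridgeE (2 * m1) (2 * m1) k (fun s =>
     (window_osc p (2 * m1) (Num.truncn (dl * sg ^+ 2)) (eta * sg) s)%:R) <= _).
    apply: le_bridgeE => // s _; apply: (@le_trans _ _ (`[< F l2 x s >])%:R).
      by rewrite ler_piMr // (pathW_le1 _ _ _ hw).
    by rewrite ler_nat; case: asboolP => // -[_ _ _ ->].
  apply: le_trans (osc sg (y x) _ _ hs3 kn m1ka m1a c2 c3) _.
  rewrite ler_pM2l //; apply: le_trans c1 _; apply: le_bridgeE => // s _.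
  by rewrite asboolT // mul1r.
have either Q1 Q2 b1 b2 : ens_pr L P Q1 <= b1 -> ens_pr L P Q2 <= b2 ->
    ens_pr L P (fun l1 l2 => Q1 l1 l2 \/ Q2 l1 l2) <= b1 + b2.
  by apply: ens_pr_union.
have := either _ _ _ _ hm1 (either _ _ _ _ hp1 (either _ _ _ _ hm2 (either _ _ _ _ hp2
  (either _ _ _ _ step1 (either _ _ _ _ step2 step3))))).
have -> : eps + (eps + (eps + (eps + (eps + (eps + eps))))) = 7 * eps by ring.
apply: le_trans; apply: ens_pr_le => l1 l2 _ _ _ hosc.
have [?|h1] := ltP (M * sg) `|centered p l1 (- m1%:Z)|; first by left.
have [?|h2] := ltP (M * sg) `|centered p l1 m1%:Z|; first by right; left.
have [?|h3] := ltP (centered p l1 (- m2%:Z)) (- (M * sg)); first by do 2! right; left.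
have [?|h4] := ltP (centered p l1 m2%:Z) (- (M * sg)); first by do 3! right; left.
do 4! right; have [?|h5] := boolP (hit l1); first by left.
by right; have [?|h6] := pselect (small l1 l2); [left|right].
Qed.

End modulus.

(** * Tightness in the space of continuous functions *)

Section compactness.
Context {R : realType}.
Implicit Types r : R.

Lemma ultra_cvg_compact (X : Type) (F : set_system X) (T : topologicalType) (K : set T)
    (f : X -> T) : UltraFilter F -> compact K -> F (f @^-1` K) ->
  exists2 p, K p & f x @[x --> F] --> p.
Proof.
move=> uF cK FK; have [p [Kp clp]] := cK (f @ F) _ FK.
exists p => // U Up; have [//|nU] := in_ultra_setVsetC (f @^-1` U) uF.
by have [q [nUq Uq]] := clp (~` U) U nU Up.
Qed.

Definition modulus_set r (B : R) (dl : nat -> R) : set (Cspace r) :=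
  [set f | (forall x, `|f x| <= B) /\
    forall k (x y : `[- r, r]%classic), `|set_val x - set_val y| < dl k ->
      `|f x - f y| <= k.+1%:R^-1].

Lemma near_le (X : Type) (F : set_system X) (f : X -> R) (a b : R) : ProperFilter F ->
  f x @[x --> F] --> a -> F [set x | `|f x| <= b] -> `|a| <= b.
Proof.
move=> pF /cvg_norm nfa Fb; exact: (@closed_cvg _ R F pF _ _ (@closed_le R b) Fb _ nfa).
Qed.

Lemma ltr_inv_nat (e : R) : 0 < e -> exists k : nat, k.+1%:R^-1 < e.
Proof.
move=> e0; exists (Num.truncn e^-1).
rewrite invf_plt ?posrE //; have := truncnS_gt e^-1; by [].
Qed.

Lemma interval_net r (dl : R) : 0 < r -> 0 < dl ->
  exists n (q : 'I_n -> `[- r, r]%classic), forall x : `[- r, r]%classic,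
    exists i, `|set_val x - set_val (q i)| < dl.
Proof.
move=> r0 dl0; have r20 : 0 < 2 * r by lra.
have [k kd] := ltr_inv_nat (divr_gt0 dl0 r20).
have m0 : 0 < k.+1%:R :> R by [].
pose g (i : nat) := - r + 2 * r * (i%:R / k.+1%:R).
have gP (i : 'I_k.+2) : g i \in `[- r, r]%classic.
  rewrite inE /= in_itv /= /g.
  have : 0 <= (i%:R / k.+1%:R : R) <= 1.
    by rewrite divr_ge0 //= ler_pdivrMr // mul1r ler_nat -ltnS ltn_ord.
  move: (_ / _) => z /andP[z0 z1]; have := mulr_ge0 (ltW r20) z0.
  have : 0 <= 2 * r * (1 - z) by rewrite mulr_ge0 ?subr_ge0 ?(ltW r20).
  by rewrite mulrBr mulr1; move: (2 * r * z) => y h1 h2; apply/andP; split; lra.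
exists k.+2, (fun i => SigSub (gP i)) => x.
pose v : R := set_val x; rewrite -/v.
have /andP[x1 x2] : - r <= v <= r by have /set_mem := valP x; rewrite /= in_itv.
pose u := (v + r) / (2 * r) * k.+1%:R.
have u0 : 0 <= u by rewrite /u mulr_ge0 // divr_ge0 //; [lra|lra].
have um : u <= k.+1%:R.
  by rewrite /u ler_piMl // ler_pdivrMr //; lra.
have iu : (Num.truncn u < k.+2)%N by rewrite ltnS -(@ler_nat R) (le_trans _ um) // truncn_le.
exists (Ordinal iu); rewrite (_ : set_val _ = g (Num.truncn u)) // /g.
have /andP[u1 u2] := truncn_itv u0.
have -> : v - (- r + 2 * r * ((Num.truncn u)%:R / k.+1%:R)) =
   2 * r / k.+1%:R * (u - (Num.truncn u)%:R).
  by rewrite /u; field; rewrite !gt_eqF.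
rewrite normrM ger0_norm ?divr_ge0 ?(ltW r20) // ger0_norm ?subr_ge0 //.
apply: le_lt_trans (_ : 2 * r / k.+1%:R < _).
  by rewrite ler_piMr ?divr_ge0 ?(ltW r20) //; move: u2; rewrite -natr1; lra.
by move: kd; rewrite ltr_pdivlMr // mulrC.
Qed.

(* Arzela-Ascoli, by ultrafilters: pointwise limits along an ultrafilter exist
   and are uniform because of the common modulus of continuity. *)
Lemma compact_modulus_set r (B : R) dl : 0 < r -> (forall k, 0 < dl k) ->
  compact (@modulus_set r B dl).
Proof.
move=> r0 dl0; rewrite compact_ultra /= => F uF FK.
have pF : ProperFilter F by exact: ultra_proper.
have ex x : exists g : R, f x @[f --> F] --> g.
  have [|g _ ?] := @ultra_cvg_compact _ F R `[- B, B]%classic (fun f : Cspace r => f x) uF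
    (@segment_compact _ _ _); last by exists g.
  by apply: filterS FK => f [fB _]; rewrite /= in_itv /= -ler_norml.
have [g gP] := choice ex.
have gB x : `|g x| <= B.
  by apply: near_le (gP x) _; apply: filterS FK => f [h _]; exact: h.
have gm k x y : `|set_val x - set_val y| < dl k -> `|g x - g y| <= k.+1%:R^-1.
  move=> xy; apply: near_le (cvgB (gP x) (gP y)) _.
  by apply: filterS FK => f [_ fm]; exact: fm.
have cg : continuous g.
  move=> x; apply/(@cvgrPdist_le R R _ (nbhs x) (nbhs_filter x)) => e e0.
  have [k ke] := ltr_inv_nat e0.
  have nb : \forall y \near x, `|set_val x - set_val y| < dl k.
    have /cvgrPdist_lt := @initial_continuous _ R (set_val : `[- r, r]%classic -> R) x.
    exact.
  by apply: filterS nb => y xy; apply: le_trans (ltW ke); exact: gm.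
exists (mkcts cg); split => //=.
apply/(@cvg_ballP R (Cspace r)) => e e0.
have e30 : 0 < e / 4 by lra.
have [k ke] := ltr_inv_nat e30.
have [n [q qP]] := interval_net r0 (dl0 k).
have near_q : F [set f : Cspace r | forall i, `|g (q i) - f (q i)| < e / 4].
  apply: filter_forall => i; have /cvgrPdist_lt := gP (q i); exact.
apply: (filterS _ (filterI near_q FK)) => f [fq [_ fm]].
move=> x /=; have [i xi] := qP x.
have h1 := gm _ _ _ xi; have h2 := fm _ _ _ xi; have h3 : `|g (q i) - f (q i)| < e / 4 := fq i.
rewrite /ball /=.
have -> : g x - f x = (g x - g (q i)) + ((g (q i) - f (q i)) - (f x - f (q i))) by ring.
apply: le_lt_trans (ler_normD _ _) _.
apply: le_lt_trans (lerD h1 (le_trans (ler_normB _ _) (lerD (ltW h3) h2))) _.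
by move: k.+1%:R^-1 e0 ke; clear=> z e0 ke; lra.
Qed.

End compactness.

(** * The interpolated curve and its values at integers *)

Section interpolation.
Context {R : realType}.
Implicit Types (p x y s : R) (l : int -> int) (A B i : int).

Definition interp_centered p l x : R := interp l x - p * x.

Lemma interp_centered_int p l i : interp_centered p l i%:~R = centered p l i.
Proof. by rewrite /interp_centered /interp intrKfloor subrr mul0r addr0. Qed.

Lemma interp_centered_floor p l x : interp_centered p l x =
  centered p l (Num.floor x) +
  (x - (Num.floor x)%:~R) * ((l (Num.floor x + 1) - l (Num.floor x))%:~R - p).
Proof. by rewrite /interp_centered /interp /centered; ring. Qed.

Lemma upright_incr p l A B i : 0 <= p <= 1 -> upright A B l -> A <= i -> i < B ->
  `|(l (i + 1) - l i)%:~R - p| <= 1.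
Proof.
move=> /andP[p0 p1] [ul _] Ai iB; have [|->|->] := ul i; first by rewrite Ai.
  by rewrite sub0r normrN ger0_norm.
by rewrite ger0_norm; lra.
Qed.

Lemma centered_lip p l A B i (n : nat) : 0 <= p <= 1 -> upright A B l -> A <= i ->
  i + n%:Z <= B -> `|centered p l (i + n%:Z) - centered p l i| <= n%:R.
Proof.
move=> p01 ul Ai; elim: n => [|n IH] iB; first by rewrite addr0 subrr normr0.
have -> : centered p l (i + n.+1%:Z) - centered p l i =
    ((l (i + n%:Z + 1) - l (i + n%:Z))%:~R - p) + (centered p l (i + n%:Z) - centered p l i).
  by rewrite /centered (_ : i + n.+1%:Z = i + n%:Z + 1) ?intrD ?intrN; [ring|lia].
rewrite -natr1 addrC; apply: le_trans (ler_normD _ _) _; apply: lerD.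
  by apply: IH; lia.
by apply: upright_incr ul _ _ => //; lia.
Qed.

(** The slopes are - p and 1 - p. Points in different cells are joined through the integer after x
    and the floor of y. The inequality y < B is strict because the slope after B would see the value
    0 that paths take off the interval. *)
Lemma interp_centered_lip p l A B x y : 0 <= p <= 1 -> upright A B l ->
  A%:~R <= x -> x <= y -> y < B%:~R ->
  `|interp_centered p l y - interp_centered p l x| <= y - x.
Proof.
move=> p01 ul Ax xy yB; rewrite !interp_centered_floor.
set k := Num.floor x; set m := Num.floor y.
have kx : k%:~R <= x := floor_le x.
have xk : x < (k + 1)%:~R := floorD1_gt x.
have my : m%:~R <= y := floor_le y.
have ym : y < (m + 1)%:~R := floorD1_gt y.
have Ak : A <= k by rewrite /k floor_ge_int.
have mB : m < B by rewrite -(@ltr_int R); apply: le_lt_trans yB.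
have km : k <= m by rewrite /m floor_ge_int; apply: le_trans xy.
have hm := upright_incr p01 ul (le_trans Ak km) mB.
have hk := upright_incr p01 ul Ak (le_lt_trans km mB).
rewrite !intrD /= in xk ym.
move: hm hk; set u := _ - p; set v := _ - p => hm hk.
case: (eqVneq k m) => [ekm|nkm].
  have -> : u = v by rewrite /u /v ekm.
  rewrite ekm (_ : _ - _ = (y - x) * v); last by ring.
  by rewrite normrM ger0_norm ?subr_ge0 // ler_piMr ?subr_ge0.
have [n nE] : exists n : nat, m = k + 1 + n%:Z.
  by exists (absz (m - k - 1)%R); move: km nkm; clear; lia.
have hc := @centered_lip p l A B (k + 1) n p01 ul _ _.
have -> : centered p l m + (y - m%:~R) * u - (centered p l k + (x - k%:~R) * v) =
   (y - m%:~R) * u + (centered p l (k + 1 + n%:Z) - centered p l (k + 1)) + (k%:~R + 1 - x) * v.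
  by rewrite nE /v /centered !(intrD, intrN) /=; ring.
have -> : y - x = (y - m%:~R) + n%:R + (k%:~R + 1 - x).
  by rewrite nE !intrD /= -pmulrn; ring.
apply: le_trans (ler_normD _ _) _; apply: lerD.
  apply: le_trans (ler_normD _ _) _; apply: lerD.
    by rewrite normrM ger0_norm ?subr_ge0 // ler_piMr ?subr_ge0.
  by apply: hc; move: Ak mB; rewrite nE; clear; lia.
have h : 0 <= k%:~R + 1 - x by rewrite subr_ge0 ltW.
by rewrite normrM (ger0_norm h) ler_piMr.
Qed.

Lemma interp_centered_dist p l A B x y : 0 <= p <= 1 -> upright A B l ->
  A%:~R <= x -> A%:~R <= y -> x < B%:~R -> y < B%:~R ->
  `|interp_centered p l x - interp_centered p l y| <= `|x - y|.
Proof.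
move=> p01 ul; wlog xy : x y / x <= y => [hw|] Ax Ay xB yB.
  have [h|/ltW h] := leP x y; first exact: hw.
  by rewrite distrC (distrC x); apply: hw.
rewrite distrC (distrC x) [leRHS]ger0_norm ?subr_ge0 //.
exact: interp_centered_lip ul Ax xy yB.
Qed.

Lemma rescaledE (alpha p : R) (N : nat) l s : (0 < N)%N ->
  rescaled alpha p N l s =
  (N%:R `^ (alpha / 2))^-1 * interp_centered p l (s * (N%:R `^ (alpha / 2)) ^+ 2).
Proof.
move=> N0; rewrite /rescaled powRN /interp_centered.
have -> : (N%:R `^ (alpha / 2)) ^+ 2 = N%:R `^ alpha.
  by rewrite expr2 -powRD ?pnatr_eq0 -?lt0n ?N0 ?implybT // -splitr.
by rewrite mulrA.
Qed.

End interpolation.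

Section ensemble_probability.
Context {R : realType} d {Om : measurableType d} {T0 T1 : int}.
Variables (L : simple_ensemble Om T0 T1) (P : probability Om R).
Implicit Types (Q : (int -> int) -> (int -> int) -> Prop).

Lemma ens_prC Q : ens_pr L P (fun l1 l2 => ~ Q l1 l2) = 1 - ens_pr L P Q.
Proof.
have := ens_pr_split L P (fun _ _ => True) Q.
rewrite (_ : ens_pr L P (fun _ _ => True) = 1); last first.
  by rewrite /ens_pr (_ : [set _ | _] = setT) ?probability_setT.
rewrite (_ : ens_pr L P (fun l1 l2 => True /\ Q l1 l2) = ens_pr L P Q); last first.
  by apply: ens_pr_eq => *; tauto.
rewrite (_ : ens_pr L P (fun l1 l2 => True /\ ~ Q l1 l2) = ens_pr L P (fun l1 l2 => ~ Q l1 l2)).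
  by move=> ->; ring.
by apply: ens_pr_eq => *; tauto.
Qed.

Lemma ens_pr_sigma (Q : nat -> (int -> int) -> (int -> int) -> Prop) (c : R) : 0 <= c ->
  (forall k, ens_pr L P (Q k) <= c / (2 ^ k.+1)%:R) ->
  ens_pr L P (fun l1 l2 => exists k, Q k l1 l2) <= c.
Proof.
move=> c0 Qc; rewrite -lee_fin -ens_prE.
apply: le_trans (epsilon_trick0 xpredT c0).
apply: le_trans (@measure_sigma_subadditive _ _ _ P _
   (fun k => [set w | Q k (ens_top L w) (ens_bot L w)]) _ _ _) _.
- by move=> k; exact: (ens_meas L (Q k)).
- exact: (ens_meas L (fun l1 l2 => exists k, Q k l1 l2)).
- by move=> w /= [k Qk]; exists k.
apply: lee_nneseries => [k _ _|k _]; first exact: measure_ge0.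
by move: (Qc k); rewrite -lee_fin -ens_prE.
Qed.

End ensemble_probability.

Lemma tight_bound (R : realType) (alpha p s : R)
    (d : nat -> measure_display) (Om : forall N, measurableType (d N))
    (P : forall N, probability (Om N) R) (T0 T1 : nat -> int)
    (L : forall N, simple_ensemble (Om N) (T0 N) (T1 N)) (D : set nat) (eps : R) :
  tight D (fun N => distribution (P N) (rescaled_at (L N) alpha p N s)) -> 0 < eps ->
  exists2 M : R, 0 <= M & forall N, D N ->
    ens_pr (L N) (P N) (fun l _ => M < `|rescaled alpha p N l s|) <= eps.
Proof.
move=> tg e0; have [K [cK PK]] := tg _ e0.
have [M0 [_ KM]] := @compact_bounded R R K cK.
pose M := Num.max 0 (M0 + 1); exists M; first by rewrite le_max lexx.
have MM : M0 < M by rewrite lt_max ltrDl ltr01 orbT.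
move=> N DN.
have h : 1 - eps < ens_pr (L N) (P N) (fun l _ => K (rescaled alpha p N l s)).
  by rewrite -lte_fin -ens_prE; exact: PK.
apply: le_trans (_ : ens_pr (L N) (P N) (fun l _ => ~ K (rescaled alpha p N l s)) <= _).
  by apply: ens_pr_le => l _ _ _ _ + Kl; rewrite ltNge => /negP; apply; exact: (KM M MM _ Kl).
by rewrite (ens_prC (L N) (P N) (fun l _ => K (rescaled alpha p N l s))); move: h; lra.
Qed.

(** Both hypotheses hold for all N in D at once, so one compact set serves the whole sequence. The
    modulus for 1/(k+1) is allowed probability e / 4 / 2^(k+1), and the uniform bound follows from
    the value at - r by chaining. *)
Lemma tight_distribution_curve (R : realType) (r alpha p : R) (r0 : 0 < r)
    (d : nat -> measure_display) (Om : forall N, measurableType (d N))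
    (P : forall N, probability (Om N) R) (T0 T1 : nat -> int)
    (L : forall N, simple_ensemble (Om N) (T0 N) (T1 N)) (D : set nat) :
  (forall eps : R, 0 < eps -> exists M : R, forall N, D N ->
    ens_pr (L N) (P N) (fun l _ => M < `|rescaled alpha p N l (- r)|) <= eps) ->
  (forall eps eta : R, 0 < eps -> 0 < eta -> exists2 dl : R, 0 < dl & forall N, D N ->
    ens_pr (L N) (P N) (fun l _ => exists s s' : R, [/\ - r <= s <= r, - r <= s' <= r,
      `|s - s'| < dl & eta < `|rescaled alpha p N l s - rescaled alpha p N l s'|]) <= eps) ->
  tight D (fun N => distribution (P N) (rescaled_curve (L N) r alpha p N)).
Proof.
move=> bd md e e0; have e40 : 0 < e / 4 by rewrite divr_gt0.
have [M hM] := bd _ e40.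
have exk k : exists dl : R, 0 < dl /\ forall N, D N ->
    ens_pr (L N) (P N) (fun l _ => exists s s' : R, [/\ - r <= s <= r, - r <= s' <= r,
      `|s - s'| < dl & k.+1%:R^-1 < `|rescaled alpha p N l s - rescaled alpha p N l s'|]) <=
    e / 4 / (2 ^ k.+1)%:R.
  have [||dl dl0 h] := md (e / 4 / (2 ^ k.+1)%:R) k.+1%:R^-1.
  - by rewrite divr_gt0 // ltr0n expn_gt0.
  - by rewrite invr_gt0.
  by exists dl.
have [dl hdl] := choice exk.
have [n ndl] : exists n : nat, 2 * r / (dl 0%N / 2) < n%:R.
  exists (Num.truncn (2 * r / (dl 0%N / 2))).+1; exact: truncnS_gt.
have dl0 : 0 < dl 0%N by case: (hdl 0%N).
exists (@modulus_set R r (M + n%:R) dl); split.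
  by apply: compact_modulus_set => // k; case: (hdl k).
move=> N DN.
suff : 1 - e < ens_pr (L N) (P N) (fun l _ => modulus_set (M + n%:R) dl (rescaledC r alpha p N l)).
  by rewrite -lte_fin -ens_prE.
pose f := rescaled alpha p N.
pose bad k l := exists s s' : R, [/\ - r <= s <= r, - r <= s' <= r,
      `|s - s'| < dl k & k.+1%:R^-1 < `|f l s - f l s'|].
have := ens_pr_sigma (ltW e40) (fun k => (hdl k).2 N DN).
have := hM N DN; set A := ens_pr _ _ _; set B := ens_pr _ _ _; set C := ens_pr _ _ _ => hA hB.
suff : 1 - C <= A + B by lra.
rewrite -ens_prC; apply: ens_pr_union (lexx A) (lexx B) => l _ _ _ _ nK; apply: contrapT =>
  /not_orP[/negP]; rewrite -leNgt => fM nbad.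
have fm k s s' : - r <= s <= r -> - r <= s' <= r -> `|s - s'| < dl k -> `|f l s - f l s'| <=
  k.+1%:R^-1.
  move=> hs hs' ss'; rewrite leNgt; apply/negP => h.
  by apply: nbad; exists k, s, s'; split.
apply: nK; split => [x|k x y xy]; last first.
  apply: fm => //.
    by have /set_mem := valP x; rewrite /= in_itv.
  by have /set_mem := valP y; rewrite /= in_itv.
have : - r <= (set_val x : R) <= r by have /set_mem := valP x; rewrite /= in_itv.
rewrite (_ : rescaledC r alpha p N l x = f l (set_val x)) //.
move: (set_val x : R) => s /andP[s1 s2].
(* Steps of length dl 0 / 2 are shorter than dl 0, so each changes the curve by at most 1, the
   tolerance for k = 0. The maximum with - r keeps the last step inside the interval. *)
have chain m u : - r <= u <= r -> u + r <= m%:R * (dl 0%N / 2) -> `|f l u - f l (- r)| <= m%:R.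
  elim: m u => [|m IH] u ur.
    rewrite mul0r => h; have -> : u = - r by move: ur => /andP[? ?]; lra.
    by rewrite subrr normr0.
  rewrite -natr1 mulrDl mul1r => h; move: (ur) => /andP[u1 u2].
  pose v := Num.max (- r) (u - dl 0%N / 2).
  have vr : - r <= v <= r.
    by rewrite /v le_max lexx /= ge_max; apply/andP; split; lra.
  have vu : `|u - v| < dl 0%N.
    rewrite ger0_norm; first by rewrite ltrBlDr -ltrBlDl lt_max; apply/orP; right; lra.
    by rewrite subr_ge0 /v ge_max u1 /=; lra.
  have -> : f l u - f l (- r) = (f l v - f l (- r)) + (f l u - f l v) by ring.
  apply: le_trans (ler_normD _ _) _; apply: lerD; last first.
    by have := fm 0%N u v ur vr vu; rewrite invr1.
  apply: IH => //; rewrite -lerBrDr /v ge_max; apply/andP; split; last by lra.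
  by rewrite lerBrDr addNr mulr_ge0 // divr_ge0 // ltW.
have -> : f l s = f l (- r) + (f l s - f l (- r)) by ring.
apply: le_trans (ler_normD _ _) _; apply: lerD => //.
apply: chain; first by rewrite s1.
rewrite -ler_pdivrMr ?divr_gt0 //; apply: le_trans (ltW ndl).
by rewrite ler_pM2r ?invr_gt0 ?divr_gt0 //; lra.
Qed.

(** * From the rescaled curve to lattice paths *)

Section rescaled_modulus.
Context {R : realType}.

Lemma rescaled_near_int (alpha p : R) (N T : nat) l (s : R) (i : int) :
  let sg := N%:R `^ (alpha / 2) in 0 < p < 1 -> (0 < N)%N -> upright (- T%:Z) T%:Z l ->
  `|s| * sg ^+ 2 < T%:R -> - T%:Z <= i -> i < T%:Z -> `|i%:~R - s * sg ^+ 2| <= 1 ->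
  `|centered p l i| <= sg * `|rescaled alpha p N l s| + 1.
Proof.
move=> sg /andP[p0 p1] N0 ul sT Ai iB is1.
have sg0 : 0 < sg by rewrite powR_gt0 ?ltr0n.
have : `|s * sg ^+ 2| < T%:R by rewrite normrM [X in _ * X]ger0_norm ?exprn_ge0 // ltW.
rewrite ltr_norml => /andP[sA sB].
rewrite -interp_centered_int rescaledE // -/sg normrM ger0_norm ?invr_ge0 ?(ltW sg0) //.
rewrite mulVKf ?gt_eqF // -lerBlDl; apply: le_trans (lerB_dist _ _) _.
apply: le_trans is1; apply: interp_centered_dist ul _ _ _ _.
- by rewrite !ltW.
- by rewrite ler_int.
- by rewrite intrN -pmulrn ltW.
- by rewrite ltr_int.
- by rewrite -pmulrn.
Qed.

(** A deterministic bound, for those N whose scale sg is below the threshold of the probabilistic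
    estimate. *)
Lemma rescaled_dist (alpha p : R) (N T : nat) l (s s' : R) :
  let sg := N%:R `^ (alpha / 2) in 0 < p < 1 -> (0 < N)%N -> upright (- T%:Z) T%:Z l ->
  `|s| * sg ^+ 2 < T%:R -> `|s'| * sg ^+ 2 < T%:R ->
  `|rescaled alpha p N l s - rescaled alpha p N l s'| <= sg * `|s - s'|.
Proof.
move=> sg /andP[p0 p1] N0 ul sT sT'.
have sg0 : 0 < sg by rewrite powR_gt0 ?ltr0n.
have : `|s * sg ^+ 2| < T%:R by rewrite normrM [X in _ * X]ger0_norm ?exprn_ge0 // ltW.
rewrite ltr_norml => /andP[sA sB].
have : `|s' * sg ^+ 2| < T%:R by rewrite normrM [X in _ * X]ger0_norm ?exprn_ge0 // ltW.
rewrite ltr_norml => /andP[sA' sB'].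
rewrite !rescaledE // -/sg -mulrBr normrM ger0_norm ?invr_ge0 ?(ltW sg0) //.
rewrite ler_pdivrMl // [leRHS]mulrA -expr2.
have -> : sg ^+ 2 * `|s - s'| = `|s * sg ^+ 2 - s' * sg ^+ 2|.
  by rewrite -mulrBl normrM mulrC (ger0_norm (exprn_ge0 2 (ltW sg0))).
by apply: interp_centered_dist ul _ _ _ _; rewrite ?intrN -?pmulrn ?(ltW p0) ?(ltW p1) ?(ltW sA)
  ?(ltW sA').
Qed.

(** Rounding both arguments down moves each height by at most 1, in total at most eta sg, hence 2
    eta against eta. The floors may be one unit further apart than the arguments, hence the + 1 in
    the bound by m. *)
Lemma window_osc_rescaled (alpha p eta : R) (N T m m1 : nat) l (s s' : R) :
  let sg := N%:R `^ (alpha / 2) in 0 < p < 1 -> (0 < N)%N -> upright (- T%:Z) T%:Z l ->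
  (m1 < T)%N -> `|s| * sg ^+ 2 < m1%:R -> `|s'| * sg ^+ 2 < m1%:R ->
  `|s - s'| * sg ^+ 2 + 1 <= m%:R -> 2 <= eta * sg ->
  2 * eta < `|rescaled alpha p N l s - rescaled alpha p N l s'| ->
  window_osc p (2 * m1) m (eta * sg) (steps l (- m1%:Z) (2 * m1)).
Proof.
move=> sg p01 N0 ul m1T; wlog ss' : s s' / s <= s' => [hw sm sm' sd|].
  by have [h|/ltW h] := leP s s'; [|rewrite distrC]; apply: hw => //; rewrite distrC.
move=> sm sm' sd hsg hf.
have /andP[p0 p1] := p01.
have sg0 : 0 < sg by rewrite powR_gt0 ?ltr0n.
have : `|s * sg ^+ 2| < m1%:R by rewrite normrM [X in _ * X]ger0_norm ?exprn_ge0 // ltW.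
rewrite ltr_norml => /andP[sA sB].
have : `|s' * sg ^+ 2| < m1%:R by rewrite normrM [X in _ * X]ger0_norm ?exprn_ge0 // ltW.
rewrite ltr_norml => /andP[sA' sB'].
move: hf; rewrite !rescaledE // -/sg -mulrBr normrM ger0_norm ?invr_ge0 ?(ltW sg0) //.
rewrite ltr_pdivlMl //.
have xy : s * sg ^+ 2 <= s' * sg ^+ 2 by rewrite ler_pM2r ?exprn_gt0.
have : s' * sg ^+ 2 - s * sg ^+ 2 + 1 <= m%:R.
  by rewrite -mulrBl -(ger0_norm (_ : 0 <= s' - s)) ?subr_ge0 // distrC.
move: (s * sg ^+ 2) (s' * sg ^+ 2) xy sA sB sA' sB' => x y xy xA xB yA yB xym.
have near (z : R) : - m1%:R < z -> z < m1%:R ->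
    `|interp_centered p l z - centered p l (Num.floor z)| <= 1.
  move=> zA zB; rewrite -interp_centered_int.
  apply: (@le_trans _ _ `|z - (Num.floor z)%:~R|).
    have h1 : (- T%:Z)%:~R <= (Num.floor z)%:~R :> R.
      rewrite ler_int floor_ge_int intrN -pmulrn.
      by apply: le_trans (ltW zA); rewrite lerN2 ler_nat ltnW.
    have h2 : z < T%:Z%:~R :> R by rewrite -pmulrn (lt_trans zB) // ltr_nat.
    have fz := floor_le z.
    apply: (interp_centered_dist _ ul (le_trans h1 fz) h1 h2 (le_lt_trans fz h2)).
    by rewrite !ltW.
  have := floor_le z; have := floorD1_gt z; rewrite intrD /= => h1 h2.
  by rewrite ger0_norm; lra.
have fA (z : R) : - m1%:R < z -> - m1%:Z <= Num.floor z.
  by move=> zA; rewrite floor_ge_int intrN -pmulrn ltW.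
have fB (z : R) : z < m1%:R -> Num.floor z < m1%:Z.
  by move=> zB; rewrite -(@ltr_int R) -pmulrn; apply: le_lt_trans (floor_le _) zB.
have hx := near x xA xB; have hy := near y yA yB.
have kA := fA x xA; have kB := fB x xB; have kA' := fA y yA; have kB' := fB y yB.
have kk : Num.floor x <= Num.floor y by rewrite floor_ge_int; apply: le_trans xy; exact: floor_le.
have kd : Num.floor y <= Num.floor x + m%:Z.
  rewrite -ltzD1 -(@ltr_int R) !intrD /= -pmulrn.
  have := floor_le y; have := floorD1_gt x; rewrite intrD /=; lra.
move: (Num.floor x) (Num.floor y) hx hy kA kB kA' kB' kk kd => k k' hx hy kA kB kA' kB' kk kd hf.
pose i := absz (k + m1%:Z)%R; pose j := absz (k' + m1%:Z)%R.
have iE : k = - m1%:Z + i%:Z by rewrite /i; move: kA; clear; lia.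
have jE : k' = - m1%:Z + j%:Z by rewrite /j; move: kA'; clear; lia.
have im : (i <= 2 * m1)%N by rewrite /i; move: kA kB; clear; lia.
have jm : (j <= 2 * m1)%N by rewrite /j; move: kA' kB'; clear; lia.
apply/existsP; exists (Ordinal (im : i < (2 * m1).+1)%N).
apply/existsP; exists (Ordinal (jm : j < (2 * m1).+1)%N) => /=.
apply/and3P; split.
- by move: kk; rewrite iE jE; clear; lia.
- by move: kd; rewrite iE jE; clear; lia.
have cs q : (q <= 2 * m1)%N -> (ups (take q (steps l (- m1%:Z) (2 * m1))))%:R - p * q%:R =
    centered p l (- m1%:Z + q%:Z) - centered p l (- m1%:Z).
  move=> qm; rewrite (@centered_steps _ p l _ _ (- m1%:Z) (2 * m1) q ul) //; first ring.
  - by move: m1T; clear; lia.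
  - by move: m1T; clear; lia.
rewrite !cs // -iE -jE.
rewrite (_ : _ - _ = centered p l k' - centered p l k); last by ring.
have tri (a b u v : R) : `|a - b| <= `|a - u| + `|b - v| + `|v - u|.
  rewrite (_ : a - b = (a - u) - (b - v) - (v - u)); last by ring.
  by apply: le_trans (ler_normB _ _) _; rewrite lerD2r ler_normB.
have := tri (interp_centered p l x) (interp_centered p l y) (centered p l k) (centered p l k').
by move: hx hy hf hsg; clear; lra.
Qed.

End rescaled_modulus.

Lemma good_bound (R : realType) (t alpha r p : R)
    (d : nat -> measure_display) (Om : forall N, measurableType (d N))
    (P : forall N, probability (Om N) R) (TN : nat -> nat)
    (L : forall N, simple_ensemble (Om N) (- (TN N)%:Z) (TN N)%:Z) (N0 : nat) (s eps : R) :
  good_from t alpha p (r + 1) P L N0 -> - (r + 1) <= s <= r + 1 -> 0 < eps ->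
  exists2 M : R, 0 <= M & forall N, (N0 <= N)%N -> forall M', M <= M' ->
    ens_pr (L N) (P N) (fun l _ => M' < `|rescaled alpha p N l s|) <= eps.
Proof.
move=> [_ _ tgs] hs eps0; have tg := tgs s hs.
have [M M0 hM] := tight_bound tg eps0.
exists M => // N NN M' MM'; apply: le_trans (hM N NN).
by apply: ens_pr_le => l _ _ _ _; exact: le_lt_trans.
Qed.

Lemma good_modulus (R : realType) (t alpha r p : R)
    (d : nat -> measure_display) (Om : forall N, measurableType (d N))
    (P : forall N, probability (Om N) R) (TN : nat -> nat)
    (L : forall N, simple_ensemble (Om N) (- (TN N)%:Z) (TN N)%:Z) (N0 : nat) (eps eta : R) :
  0 < t < 1 -> 0 < r -> 0 < p < 1 -> 0 < alpha ->
  good_from t alpha p (r + 1) P L N0 -> 0 < eps -> 0 < eta -> exists2 dl : R, 0 < dl &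
  forall N, (N0 <= N)%N ->
    ens_pr (L N) (P N) (fun l _ => exists s s' : R, [/\ - r <= s <= r, - r <= s' <= r,
      `|s - s'| < dl & eta < `|rescaled alpha p N l s - rescaled alpha p N l s'|]) <= eps.
Proof.
move=> t01 r0 p01 alpha0 good eps0 eta0; have [N00 goodN _] := good.
have e0 : 0 < eps / 7 by rewrite divr_gt0.
have q0 := qconst_gt0 t.
have eq0 : 0 < eps / 7 * (qconst t / 2) by rewrite mulr_gt0 // divr_gt0.
have in_r (s : R) : `|s| <= r + 1 -> - (r + 1) <= s <= r + 1 by rewrite ler_norml.
have nr : `|r| <= r + 1 by rewrite ger0_norm ?lerDl // ltW.
have nr1 : `|r + 1| <= r + 1 by rewrite ger0_norm // addr_ge0 // ltW.
have nrN : `|- r| <= r + 1 by rewrite normrN.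
have nr1N : `|- (r + 1)| <= r + 1 by rewrite normrN.
have [M1 M10 hM1] := good_bound good (in_r _ nrN) e0.
have [M2 M20 hM2] := good_bound good (in_r _ nr) e0.
have [M3 M30 hM3] := good_bound good (in_r _ nr1N) e0.
have [M4 M40 hM4] := good_bound good (in_r _ nr1) e0.
have [M5 M50 hM5] := good_bound good (in_r _ nr) eq0.
pose M := M1 + M2 + M3 + M4.
(* The added 1 pays for replacing the points of the tightness bounds by integers, see [far]. The
   test point gets 2 because its event is a non-strict inequality. *)
have [|||dl [sg0 [dl0 sg01 hmod]]] := @modulus_bound R t p r (eps / 7) (eta / 2) (M + 1) (M5 + 2)
  t01 p01 r0 e0.
- by rewrite divr_gt0.
- by rewrite /M; lra.
- by lra.
(* From sg1 on, the rounding error 2 is at most (eta / 2) sg, and dl sg^2 >= 4 leaves room for the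
   extra unit and the truncation in the window length when |s - s'| < dl / 2. *)
pose sg1 := sg0 + 4 / eta + 4 / dl.
have [h4e h4d] : 0 < 4 / eta /\ 0 < 4 / dl by rewrite !divr_gt0.
have sg10 : 0 < sg1 by rewrite /sg1; lra.
exists (Num.min (dl / 2) (eta / sg1)); first by rewrite lt_min !divr_gt0.
move=> N NN; have [TX gibbs] := goodN N NN.
have Npos : (0 < N)%N by apply: leq_trans NN.
pose sg : R := N%:R `^ (alpha / 2).
have sgX : N%:R `^ alpha = sg ^+ 2.
  by rewrite expr2 -powRD ?pnatr_eq0 -?lt0n ?Npos ?implybT // -splitr.
rewrite sgX in TX.
have sg_1 : 1 <= sg.
  by rewrite -(powRr0 (N%:R : R)) ler_powR ?ler1n // ?divr_ge0 // ltW.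
have X1 : 1 <= sg ^+ 2 by rewrite expr_ge1 // ltW // (lt_le_trans ltr01).
have X0 : 0 < sg ^+ 2 by apply: lt_le_trans X1.
have rX0 : 0 <= r * sg ^+ 2 by rewrite mulr_ge0 ?(ltW r0) ?(ltW X0).
have rX10 : 0 <= (r + 1) * sg ^+ 2 by rewrite mulr_ge0 ?addr_ge0 ?(ltW r0) ?(ltW X0).
pose m1 := (Num.truncn (r * sg ^+ 2)).+1; pose m2 := Num.truncn ((r + 1) * sg ^+ 2).
have /andP[m1a m1b] : r * sg ^+ 2 < m1%:R <= r * sg ^+ 2 + 1.
  have /andP[h1 h2] := truncn_itv rX0; rewrite h2 /=.
  by rewrite /m1 -natr1 lerD2r.
have /andP[m2a m2b] : m2%:R <= (r + 1) * sg ^+ 2 < m2%:R + 1.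
  by have := truncn_itv rX10; rewrite natr1.
have m1T : (m1 < TN N)%N.
  by rewrite -(ltr_nat R); apply: le_lt_trans m1b _; move: TX X1; rewrite mulrDl mul1r; clear; lra.
have m2T : (m2 < TN N)%N by rewrite -(ltr_nat R); apply: le_lt_trans m2a _.
have sX (s : R) : `|s| <= r -> `|s| * sg ^+ 2 <= r * sg ^+ 2 by move=> h; rewrite ler_pM2r.
have rXT : r * sg ^+ 2 < (TN N)%:R by apply: lt_trans TX; rewrite ltr_pM2r // ltrDl.
(* For sg < sg1 the curve is sg-Lipschitz, so |s - s'| < eta / sg1 makes the event empty. This makes
   the modulus valid from N0 on and not only for large N. *)
have [sglt|sgge] := ltP sg sg1.
  apply: le_trans (_ : ens_pr (L N) (P N) (fun _ _ => False) <= _); last first.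
    by rewrite /ens_pr (_ : [set _ | _] = set0) ?measure0 // ltW.
  apply: ens_pr_le => l _ ul _ _ [s [s' [hs hs' ss']]]; apply/negP; rewrite -leNgt.
  have hl : `|s| * sg ^+ 2 < (TN N)%:R by apply: le_lt_trans rXT; apply: sX; rewrite ler_norml.
  have hl' : `|s'| * sg ^+ 2 < (TN N)%:R by apply: le_lt_trans rXT; apply: sX; rewrite ler_norml.
  apply: le_trans (rescaled_dist p01 Npos ul hl hl') _; rewrite -/sg.
  move: ss'; rewrite lt_min => /andP[_]; rewrite ltr_pdivlMr // mulrC => /ltW.
  by apply: le_trans; rewrite ler_wpM2r // ltW.
have near (l : int -> int) (s : R) (i : int) : upright (- (TN N)%:Z) (TN N)%:Z l ->
    `|s| * sg ^+ 2 < (TN N)%:R -> - (TN N)%:Z <= i -> i < (TN N)%:Z ->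
    `|i%:~R - s * sg ^+ 2| <= 1 -> `|centered p l i| <= sg * (`|rescaled alpha p N l s| + 1).
  move=> ul h1 h2 h3 h4; apply: le_trans (rescaled_near_int p01 Npos ul h1 h2 h3 h4) _.
  by rewrite mulrDr mulr1 lerD2l.
have far (l : int -> int) (s : R) (i : int) (B : R) : upright (- (TN N)%:Z) (TN N)%:Z l ->
    `|s| * sg ^+ 2 < (TN N)%:R -> - (TN N)%:Z <= i -> i < (TN N)%:Z ->
    `|i%:~R - s * sg ^+ 2| <= 1 -> (B + 1) * sg < `|centered p l i| ->
    B < `|rescaled alpha p N l s|.
  move=> ul h1 h2 h3 h4 /lt_le_trans /(_ (near l s i ul h1 h2 h3 h4)).
  by rewrite mulrC ltr_pM2l ?ltrD2r // (lt_le_trans ltr01).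
have sg_sg0 : sg0 <= sg by move: sgge h4e h4d sg01; rewrite /sg1; clear; lra.
have hr1 : `|r| * sg ^+ 2 < (TN N)%:R by rewrite ger0_norm // ltW.
have hr1N : `|- r| * sg ^+ 2 < (TN N)%:R by rewrite normrN.
have hr2 : `|r + 1| * sg ^+ 2 < (TN N)%:R by rewrite ger0_norm // addr_ge0 // ltW.
have hr2N : `|- (r + 1)| * sg ^+ 2 < (TN N)%:R by rewrite normrN.
have d1 : `|m1%:Z%:~R - r * sg ^+ 2| <= 1.
  by rewrite -pmulrn ger0_norm; move: m1a m1b; clear; lra.
have d1N : `|(- m1%:Z)%:~R - - r * sg ^+ 2| <= 1 by rewrite intrN mulNr -opprD normrN.
have d2 : `|m2%:Z%:~R - (r + 1) * sg ^+ 2| <= 1.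
  by rewrite -pmulrn distrC ger0_norm; move: m2a m2b; clear; lra.
have d2N : `|(- m2%:Z)%:~R - - (r + 1) * sg ^+ 2| <= 1 by rewrite intrN mulNr -opprD normrN.
have [Tm1 Tm1' Tm1N Tm1N'] : [/\ - (TN N)%:Z <= m1%:Z, m1%:Z < (TN N)%:Z,
   - (TN N)%:Z <= - m1%:Z & - m1%:Z < (TN N)%:Z] by move: m1T; clear; split; lia.
have [Tm2 Tm2' Tm2N Tm2N'] : [/\ - (TN N)%:Z <= m2%:Z, m2%:Z < (TN N)%:Z,
   - (TN N)%:Z <= - m2%:Z & - m2%:Z < (TN N)%:Z] by move: m2T; clear; split; lia.
have [MM1 MM2 MM3 MM4] : [/\ M1 <= M, M2 <= M, M3 <= M & M4 <= M] by rewrite /M; move: M10 M20 M30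
  M40; clear; split; lra.
have := hmod _ _ _ (L N) (P N) sg m1 m2 sg_sg0 erefl erefl (ltnW m2T) gibbs.
have -> : 7 * (eps / 7) = eps by field.
move=> H; apply: le_trans (H _ _ _ _ _); clear H.
- apply: ens_pr_le => l _ ul _ _ [s [s' [hs hs' + hf]]]; rewrite lt_min => /andP[ss' _].
  apply: (window_osc_rescaled p01 Npos ul m1T (alpha := alpha) (eta := eta / 2) (s := s) (s' :=
    s')).
  + by apply: le_lt_trans m1a; apply: sX; rewrite ler_norml.
  + by apply: le_lt_trans m1a; apply: sX; rewrite ler_norml.
  + rewrite -/sg; have h1 : `|s - s'| * sg ^+ 2 <= dl / 2 * sg ^+ 2 by rewrite ler_pM2r // ltW.
    have : 4 <= dl * sg ^+ 2.
      rewrite mulrC -ler_pdivrMr //; apply: le_trans (_ : sg <= _).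
        by move: sgge h4e h4d sg01; rewrite /sg1; clear; lra.
      by rewrite expr2 ler_peMl // (le_trans ler01).
    have := truncnS_gt (dl * sg ^+ 2); rewrite -natr1; move: h1; clear; lra.
  + have : 4 / eta <= sg by move: sgge h4e h4d sg01; rewrite /sg1; clear; lra.
    by rewrite ler_pdivrMr //; rewrite -/sg; clear; lra.
  + by apply: le_lt_trans hf; clear; lra.
- apply: le_trans (hM1 N NN M MM1); apply: ens_pr_le => l _ ul _ _; exact: far.
- apply: le_trans (hM2 N NN M MM2); apply: ens_pr_le => l _ ul _ _; exact: far.
- apply: le_trans (hM3 N NN M MM3); apply: ens_pr_le => l _ ul _ _ h; apply: far ul hr2N Tm2N
  Tm2N' d2N _.
  by rewrite -normrN; apply: lt_le_trans (ler_norm _); rewrite ltrNr.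
- apply: le_trans (hM4 N NN M MM4); apply: ens_pr_le => l _ ul _ _ h; apply: far ul hr2 Tm2 Tm2'
  d2 _.
  by rewrite -normrN; apply: lt_le_trans (ler_norm _); rewrite ltrNr.
- apply: le_trans (hM5 N NN M5 (lexx _)); apply: ens_pr_le => l _ ul _ _ h; apply: far ul hr1 Tm1
  Tm1' d1 _.
  apply: lt_le_trans (ler_norm _); apply: lt_le_trans h.
  by rewrite ltr_pM2r ?(lt_le_trans ltr01) // ltrD2l ltr1n.
Qed.

Theorem theorem3p8 (R : realType) (t alpha r p : R)
    (ht : 0 < t < 1) (halpha : 0 < alpha) (hr : 0 < r) (hp : 0 < p < 1)
    (d : nat -> measure_display) (Om : forall N, measurableType (d N))
    (P : forall N, probability (Om N) R) (TN : nat -> nat)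
    (L : forall N, simple_ensemble (Om N) (- (TN N)%:Z) (TN N)%:Z) (N0 : nat)
    (hL : good_from t alpha p (r + 1) P L N0) :
  tight [set N | (N0 <= N)%N]
    (fun N => distribution (P N) (rescaled_curve (L N) r alpha p N)).
Proof.
apply: tight_distribution_curve => // [eps eps0|eps eta eps0 eta0].
  have hs : - (r + 1) <= - r <= r + 1 by apply/andP; split; lra.
  have [M _ hM] := good_bound hL hs eps0.
  by exists M => N NN; exact: hM.
exact: good_modulus ht hr hp halpha hL eps0 eta0.
Qed.
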